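(* Let $\sigma\in\mathscr P$ be a $d$-dimensional cell contained in the tropical hypersurface $X(\operatorname{trop}(f))$ whose dual edge in $\mathscr T$ has an element of $W$ as a vertex, and let $T_t^\sigma\subset Z_t$ be the corresponding torus cycle. Let $l\ge1$ and $v\in V_l$. Then there is a constant $\epsilon>0$ such that, as $t\to+0$, $$\int_{T_t^\sigma}\Omega_t^{l,v}=\begin{cases}-(2\pi\sqrt{-1})^d+O(t^\epsilon)&\text{if }\tau_v\text{ is (a vertex which is) an element of }W\text{ and }\operatorname{trop}(f)=\mathrm{val}(k_{\tau_v})+\langle\tau_v,\bullet\rangle\text{ on }\sigma,\\ O(t^\epsilon)&\text{otherwise.}\end{cases}$$
   Context: **Basic setting.** $K$ is the field of convergent Puiseux series over $\mathbb C$: formal series $\sum_{j\in\mathbb Z}c_jx^{j/n}$ ($c_j\in\mathbb C$, $n\in\mathbb Z_{\ge1}$) with only finitely many nonzero coefficients of negative index and whose positive part converges near $x=0$; $\mathrm{val}(\sum_jc_jx^{j/n})=\min\{j/n: c_j\ne0\}$. Let $d\ge1$, $N$ a free $\mathbb Z$-module of rank $d+1$, $M=\operatorname{Hom}(N,\mathbb Z)$, $N_Q=N\otimes_{\mathbb Z}Q$, $M_Q=M\otimes_{\mathbb Z}Q$. Fix a basis; $z_0,\dots,z_d$ are the corresponding coordinates on $N_{\mathbb C^*}\cong(\mathbb C^* )^{d+1}$ and $n_0,\dots,n_d$ those on $N_{\mathbb R}$, $N_{\mathbb C}$. Let $\Delta\subset M_{\mathbb R}$ be a lattice polytope of dimension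 $d+1$, $A=\Delta\cap M$, $W=\operatorname{Int}(\Delta)\cap M\neq\emptyset$. Let $f=\sum_{m\in A}k_mz^m\in K[M]$ with $k_m\ne0$ for all $m\in A$, $\lambda_m:=\mathrm{val}(k_m)$, and assume that $m\mapsto\lambda_m$ extends to a strictly convex piecewise affine function on a unimodular triangulation $\mathscr T$ of $\Delta$ (all $(d+1)$-simplices have volume $1/(d+1)!$; convex means $h(sa+(1-s)b)\le sh(a)+(1-s)h(b)$). Let $c_m\in\mathbb C^*$ be the coefficient of $x^{\lambda_m}$ in $k_m$. For small $t>0$, $k_{m,t}\in\mathbb C^*$ is the value of $k_m$ at $x=t$ and $f_t=\sum_mk_{m,t}z^m$. Put $\mu_m(n)=\lambda_m+\langle m,n\rangle$, $\operatorname{trop}(f)=\min_{m\in A}\mu_m$ on $N_{\mathbb R}$. The tropical hypersurface $X(\operatorname{trop}(f))$ is the corner locus of $\operatorname{trop}(f)$; it induces a polyhedral decomposition $\mathscr P$ of $N_{\mathbb R}$ dual to $\mathscr T$ via $\sigma\mapsto\operatorname{conv}\{m\in A:\operatorname{trop}(f)=\mu_m\text{ on }\sigma\}$. **Hypersurface and forms.** $\Sigma$ is a rational simplicial fan in $N_{\mathbb R}$ refining the normal fan of $\Delta$, $Y_\Sigma$ its toric variety, $Z_t$ the closure in $Y_\Sigma$ of $\{z\in N_{\mathbb C^*}:f_t(z)=0\}$. For an integer $l\ge1$, $V_l=M\cap\operatorname{Int}(l\Delta)$. For $v\in V_l$, $\tau_v\in\mathscr T$ is the minimal cell with $v\in l\cdot\tau_v$,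 and $v=\sum_{m\in A\cap\tau_v}p_m m$ uniquely with $p_m\in\mathbb Z\cap(0,l]$, $\sum p_m=l$. Set $$\omega_t^{l,v}=\Big(\bigwedge_{i=0}^d\frac{dz_i}{z_i}\Big)\frac1{(f_t)^l}\prod_{m\in A\cap\tau_v}(k_{m,t}z^m)^{p_m},$$ which extends to an element of $H^0(Y_\Sigma,\Omega^{d+1}(lZ_t))$, and let $\Omega_t^{l,v}=\operatorname{Res}(\omega_t^{l,v})\in H^d(Z_t,\mathbb C)$ be its Poincaré residue: $\int_C\Omega_t^{l,v}=\frac1{2\pi\sqrt{-1}}\int_{T(C)}\omega_t^{l,v}$ for $d$-cycles $C\subset Z_t$, with $T(C)\subset Y_\Sigma\setminus Z_t$ the tube over $C$ (oriented as positively oriented normal circle times $C$). **Cycle $T_t^\sigma$.** Write the edge dual to $\sigma$ as $\operatorname{conv}(\{w,m_0\})$ with $w\in W$, $m_0\in A$. Let $\alpha=\mu_{m_0}-\mu_w$ and choose integral linear functions $\gamma_1,\dots,\gamma_d\in M$ such that $(\alpha,\gamma_1,\dots,\gamma_d)$ is an integral affine coordinate system with $d\alpha\wedge d\gamma_1\wedge\dots\wedge d\gamma_d=dn_0\wedge\dots\wedge dn_d$. Put $y=t^{\lambda_{m_0}-\lambda_w}z^{m_0-w}$, $x_j=z^{\gamma_j}$. Take $n_0\in\operatorname{Int}(\sigma)$ and a small neighborhood $U$ of it on which $\mu_m-\mu_{m_0}$ is bounded below by a positive constant for all $m\in A\setminus\{w,m_0\}$. With $\operatorname{Log}_t(z)=(\log_t|z_0|,\dots,\log_t|z_d|)$,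 on $\operatorname{Log}_t^{-1}(U)$ the equation of $Z_t$ reads $1=-\frac{c_{m_0}}{c_w}y(1+h_t(z))$ with $h_t=O(t^{\epsilon'})$ for some $\epsilon'>0$, and for small $t$ it determines $y=y(x_1,\dots,x_d)$. Then $$T_t^\sigma=\{(y,x_1,\dots,x_d):x_j=t^{\gamma_j(n_0)}e^{\sqrt{-1}\theta_j},\ \theta_j\in\mathbb R/2\pi\mathbb Z,\ y=y(x_1,\dots,x_d)\}\subset Z_t,$$ a $d$-torus oriented by the ordered coordinates $(\theta_1,\dots,\theta_d)$. If both vertices of the dual edge are in $W$, exchanging $w$ and $m_0$ reverses this orientation; the sign convention in the claim is that when $\tau_v$ is a vertex of the dual edge lying in $W$, one uses $w=\tau_v$. *)

(* Defs.v *)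
From HB Require Import structures.
From mathcomp Require Import all_boot all_order all_algebra.
From mathcomp Require Import finmap complex.
From mathcomp Require Import all_classical all_reals all_analysis.

Set Implicit Arguments.
Unset Strict Implicit.
Unset Printing Implicit Defensive.

Import Order.TTheory GRing.Theory Num.Theory.
Import numFieldNormedType.Exports.

Local Open Scope classical_set_scope.
Local Open Scope ring_scope.
Local Open Scope complex_scope.

(* Complex-valued series, integrals and derivatives of one or several real
   variables are taken componentwise on real and imaginary parts. *)
Section ComplexCalculus.
Variable R : realType.

Definition Cmod (z : R[i]) : R := Normc.normc z.

Definition Ccvg_series (a : nat -> R[i]) : Prop :=
  cvgn (series (fun j => complex.Re (a j))) /\
  cvgn (series (fun j => complex.Im (a j))).

Definition Cseries (a : nat -> R[i]) : R[i] :=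
  limn (series (fun j => complex.Re (a j))) +i*
  limn (series (fun j => complex.Im (a j))).

Definition Cexpi (x : R) : R[i] := cos x +i* sin x.

Definition two_pi_i : R[i] := 0 +i* (2 * pi).

Definition Ccircle_integral (g : R -> R[i]) : R[i] :=
  Rintegral lebesgue_measure `[0, 2 * pi] (fun s => complex.Re (g s)) +i*
  Rintegral lebesgue_measure `[0, 2 * pi] (fun s => complex.Im (g s)).

(* Iterated integral over [0, 2 pi]^n, the first variable innermost. *)
Fixpoint torus_integral (n : nat) : ('rV[R]_n -> R[i]) -> R[i] :=
  match n with
  | 0%N => fun g => g 0
  | n'.+1 => fun g =>
      torus_integral (fun th : 'rV[R]_n' =>
        Ccircle_integral (fun s =>
          g (row_mx (const_mx s : 'rV[R]_1) th)))
  end.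

Definition Cpartial (n : nat) (g : 'rV[R]_n.+1 -> R[i]) (j : 'I_n.+1)
    (s : 'rV[R]_n.+1) : R[i] :=
  'D_(delta_mx 0 j) (fun u => complex.Re (g u)) s +i*
  'D_(delta_mx 0 j) (fun u => complex.Im (g u)) s.

(* Integral of the top-degree form  F(z) dz_0/z_0 /\ ... /\ dz_n/z_n  over the
   singular torus Phi : [0, 2 pi]^(n+1) -> (C^* )^(n+1), oriented by the order
   of the parameters. *)
Definition dlog_form_integral (n : nat) (F : 'rV[R[i]]_n.+1 -> R[i])
    (Phi : 'rV[R]_n.+1 -> 'rV[R[i]]_n.+1) : R[i] :=
  torus_integral (fun s =>
    F (Phi s) *
    \det (\matrix_(i, j) (Cpartial (fun u => Phi u 0 i) j s / Phi s 0 i))).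

End ComplexCalculus.

Section Puiseux.
Variable R : realType.

(* A convergent Puiseux series  sum_(j in Z) c_j x^(j/n),  given by n and
   j |-> c_j.  The pairs (n, c) and (r n, c') with c'_(r j) = c_j and c'_i = 0
   for i not divisible by r present the same series; everything below depends
   only on the series.  Convergence near x = 0 is that of sum c_j s^j,
   s = x^(1/n). *)
Record puiseux := Puiseux {
  pden : nat;
  pcoef : int -> R[i];
  pden_gt0 : (0 < pden)%N;
  pcoef_neg : finite_set [set j : int | j < 0 /\ pcoef j != 0];
  pcoef_cvg : exists2 r : R, 0 < r & forall s : R[i], Cmod s < r ->
    Ccvg_series (fun j : nat => pcoef j%:Z * s ^+ j) }.

Definition pnonzero (k : puiseux) : Prop := exists j, pcoef k j != 0.

Definition pord (k : puiseux) : int :=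
  xget 0 [set j | pcoef k j != 0 /\ forall i, pcoef k i != 0 -> j <= i].

Definition pval (k : puiseux) : R := (pord k)%:~R / (pden k)%:R.

(* Value at x = t > 0, with the positive roots t^(1/n). *)
Definition pterm (k : puiseux) (t : R) (j : int) : R[i] :=
  pcoef k j * (t `^ (j%:~R / (pden k)%:R))%:C.

Definition peval (k : puiseux) (t : R) : R[i] :=
  \sum_(j \in [set j : int | j < 0]) pterm k t j +
  Cseries (fun j : nat => pterm k t j%:Z).

End Puiseux.

Section Convexity.
Variables (R : realType) (n : nat).
Implicit Types S : set 'rV[R]_n.

Definition conv S : set 'rV[R]_n :=
  [set x | exists (r : nat) (p : 'I_r -> 'rV[R]_n) (a : 'I_r -> R),
     [/\ forall i, S (p i), forall i, 0 <= a i,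
         \sum_i a i = 1 & x = \sum_i a i *: p i]].

Definition aff S : set 'rV[R]_n :=
  [set x | exists (r : nat) (p : 'I_r -> 'rV[R]_n) (a : 'I_r -> R),
     [/\ forall i, S (p i), \sum_i a i = 1 & x = \sum_i a i *: p i]].

(* S is nonempty and its affine hull has dimension r. *)
Definition affine_dim S (r : nat) : Prop :=
  exists (p : 'rV[R]_n) (B : 'M[R]_(r, n)),
    [/\ S p, forall i, S (p + row i B), row_free B &
        forall q, S q -> (q - p <= B)%MS].

Definition dilate (l : nat) S : set 'rV[R]_n := [set l%:R *: x | x in S].

End Convexity.

Definition relint (R : realType) (n : nat) (S : set 'rV[R]_n.+1) :
    set 'rV[R]_n.+1 :=
  [set x | S x /\ \forall y \near x, aff S y -> S y].

(* A basis of N is fixed: M and N are 'rV[int]_d.+1, M_R and N_R are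
   'rV[R]_d.+1, paired by the standard dot product. *)
Section Lattice.
Variables (R : realType) (d : nat).
Notation M := 'rV[int]_d.+1.
Notation MR := 'rV[R]_d.+1.
Notation NR := 'rV[R]_d.+1.

Definition toR (m : M) : MR := map_mx intr m.

Definition pairing (m : M) (n : NR) : R := \sum_i (m 0 i)%:~R * n 0 i.

Definition lattice_points (P : set MR) : {fset M} :=
  fset_set [set m : M | P (toR m)].

Definition hull (V : {fset M}) : set MR := conv [set toR m | m in [set` V]].

Definition lattice_polytope (P : set MR) : Prop :=
  exists V : {fset M}, P = hull V.

(* The cells of a triangulation are given by their vertex sets. *)
Record triangulation (Delta : set MR) (T : set {fset M}) : Prop := {
  tri_simplex : forall s, T s ->
    (s != fset0)%fset /\ affine_dim [set toR m | m in [set` s]] (#|` s|.-1);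
  tri_face : forall s r, T s -> (r `<=` s)%fset -> (r != fset0)%fset -> T r;
  tri_inter : forall s r, T s -> T r ->
    hull s `&` hull r = hull (s `&` r)%fset;
  tri_cover : \bigcup_(s in T) hull s = Delta }.

(* Volume of the simplex with vertices p_0, ..., p_(d+1):
   |det (p_i - p_0)_i| / (d+1)!. *)
Definition simplex_volume (s : {fset M}) : R :=
  `|\det (\matrix_(i < d.+1, j < d.+1)
      (toR (nth 0 (enum_fset s) i.+1) 0 j - toR (nth 0 (enum_fset s) 0) 0 j))|
  / (d.+1)`!%:R.

Definition unimodular (T : set {fset M}) : Prop :=
  forall s, T s -> #|` s| = d.+2 -> simplex_volume s = 1 / (d.+1)`!%:R.

(* h is affine on the cells, convex on Delta, and the convexity inequality is
   an equality at an interior point of a segment only when the end points lie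
   in a common cell: the maximal cells of T are the maximal domains on which h
   is affine. *)
Definition strictly_convex_pa (Delta : set MR) (T : set {fset M})
    (h : MR -> R) : Prop :=
  [/\ forall s a b (u : R), T s -> hull s a -> hull s b -> 0 <= u <= 1 ->
        h (u *: a + (1 - u) *: b) = u * h a + (1 - u) * h b,
      forall a b (u : R), Delta a -> Delta b -> 0 <= u <= 1 ->
        h (u *: a + (1 - u) *: b) <= u * h a + (1 - u) * h b &
      forall a b (u : R), Delta a -> Delta b -> 0 < u < 1 ->
        (forall s, T s -> ~ (hull s a /\ hull s b)) ->
        h (u *: a + (1 - u) *: b) < u * h a + (1 - u) * h b].

(* v lies in l . tau, and tau is the smallest cell with this property. *)
Definition minimal_cell (T : set {fset M}) (l : nat) (v : M)
    (tau : {fset M}) : Prop :=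
  [/\ T tau, dilate l (hull tau) (toR v) &
      forall s, T s -> dilate l (hull s) (toR v) -> (tau `<=` s)%fset].

End Lattice.

Arguments hull R {d} V.

Section Tropical.
Variables (R : realType) (d : nat).
Notation M := 'rV[int]_d.+1.
Notation NR := 'rV[R]_d.+1.
Variables (A : {fset M}) (k : M -> puiseux R).

Definition mu (m : M) (n : NR) : R := pval (k m) + pairing m n.

Definition trop (n : NR) : R := inf [set mu m n | m in [set` A]].

Definition trop_hypersurface : set NR :=
  [set n | exists m1 m2, [/\ m1 \in A, m2 \in A, m1 != m2,
     mu m1 n = trop n & mu m2 n = trop n]].

(* A cell of the decomposition: the closed set of points at which all the
   monomials that are minimal at a given point n are still minimal. *)
Definition trop_cell (s : set NR) : Prop :=
  exists n, s = [set n' | forall m, m \in A -> mu m n = trop n ->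
                            mu m n' = trop n'].

Definition dual_cell (s : set NR) : set 'rV[R]_d.+1 :=
  conv [set toR R m | m in
          [set m | m \in A /\ forall n, s n -> trop n = mu m n]].

End Tropical.

Section Hypersurface.
Variables (R : realType) (d : nat).
Notation M := 'rV[int]_d.+1.
Notation NR := 'rV[R]_d.+1.
Notation CT := 'rV[R[i]]_d.+1.

Definition monomial (z : CT) (m : M) : R[i] := \prod_i z 0 i ^ m 0 i.

Definition Logt (t : R) (z : CT) : NR := \row_i (ln (Cmod (z 0 i)) / ln t).

Definition fval (A : {fset M}) (k : M -> puiseux R) (t : R) (z : CT) : R[i] :=
  \sum_(m <- A) peval (k m) t * monomial z m.

(* The coefficient of dz_0/z_0 /\ ... /\ dz_d/z_d in omega_t^(l,v), where
   B = A `&` tau_v. *)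
Definition omega_coef (A : {fset M}) (k : M -> puiseux R) (l : nat)
    (B : {fset M}) (p : M -> nat) (t : R) (z : CT) : R[i] :=
  (fval A k t z) ^- l * \prod_(m <- B) (peval (k m) t * monomial z m) ^+ p m.

(* Rows m0 - w, gamma_1, ..., gamma_d: the linear part of the integral affine
   coordinates (alpha, gamma_1, ..., gamma_d), alpha = mu_m0 - mu_w. *)
Definition coord_mx (w m0 : M) (gamma : 'M[int]_(d, d.+1)) : 'M[int]_d.+1 :=
  col_mx (m0 - w) gamma.

(* The point z of (C^* )^(d+1) with z^(m0 - w) = u_0 and z^(gamma_j) = u_j. *)
Definition monomial_chart (w m0 : M) (gamma : 'M[int]_(d, d.+1)) (u : CT) : CT :=
  \row_i \prod_j u 0 j ^ (invmx (coord_mx w m0 gamma) i j).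

Section Torus.
Variables (A : {fset M}) (k : M -> puiseux R).
Variables (w m0 : M) (gamma : 'M[int]_(d, d.+1)) (n0 : NR) (U : set NR).

(* The point with coordinates y and x_j = t^(gamma_j(n0)) e^(i theta_j),
   where y = t^(lambda_m0 - lambda_w) z^(m0 - w). *)
Definition torus_point (t : R) (y : R[i]) (th : 'rV[R]_d) : CT :=
  monomial_chart w m0 gamma
    (row_mx
       (const_mx ((t `^ (pval (k w) - pval (k m0)))%:C * y) : 'rV[R[i]]_1)
       (\row_j ((t `^ (pairing (row j gamma) n0))%:C * Cexpi (th 0 j)))).

(* y(x_1, ..., x_d): the unique solution of f_t = 0 on Log_t^(-1)(U) above
   each point of the torus of the x_j.  The cycle T_t^sigma is
   th |-> torus_point t (Y th) th. *)
Definition torus_branch (t : R) (Y : 'rV[R]_d -> R[i]) : Prop :=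
  forall th, [set y | [/\ y != 0, U (Logt t (torus_point t y th)) &
                        fval A k t (torus_point t y th) = 0]]
             = [set Y th].

(* The closed discs of radius r in the y-coordinate centred at the points of
   T_t^sigma are contained in (C^* )^(d+1) and meet Z_t only in their centres. *)
Definition tube_radius (t : R) (Y : 'rV[R]_d -> R[i]) (r : R) : Prop :=
  0 < r /\
  forall th y, Cmod (y - Y th) <= r ->
    y != 0 /\ (fval A k t (torus_point t y th) = 0 -> y = Y th).

(* The tube over T_t^sigma, parametrised by (phi, theta_1, ..., theta_d):
   positively oriented normal circle first. *)
Definition tube (t : R) (Y : 'rV[R]_d -> R[i]) (r : R) (s : 'rV[R]_(1 + d)) :
    CT :=
  let th := rsubmx s in
  torus_point t (Y th + r%:C * Cexpi (s 0 0)) th.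

(* I is the integral over T_t^sigma of the Poincare residue of
   F dz_0/z_0 /\ ... /\ dz_d/z_d: the common value of
   (2 pi i)^(-1) times the integrals of the form over the small tubes.  The
   cycle and its tubes lie in the open torus, so neither the closure Z_t nor the
   ambient toric variety enters. *)
Definition residue_integral (F : CT -> R[i]) (t : R) (Y : 'rV[R]_d -> R[i])
    (I : R[i]) : Prop :=
  (exists r, tube_radius t Y r) /\
  forall r, tube_radius t Y r ->
    I = (two_pi_i R)^-1 * dlog_form_integral F (tube t Y r).

Definition period (F : CT -> R[i]) (t : R) (I : R[i]) : Prop :=
  exists Y, torus_branch t Y /\ residue_integral F t Y I.

End Torus.
End Hypersurface.

(* Main.v *)
Require Import Defs.
From HB Require Import structures.
From mathcomp Require Import all_boot all_order all_algebra.
From mathcomp Require Import finmap complex.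
From mathcomp Require Import all_classical all_reals all_analysis.
From mathcomp Require Import ring lra zify.

Set Implicit Arguments.
Unset Strict Implicit.
Unset Printing Implicit Defensive.

Import Order.TTheory GRing.Theory Num.Theory.
Import numFieldNormedType.Exports.

Local Open Scope classical_set_scope.
Local Open Scope ring_scope.

(** Divide the equation of the hypersurface by its term of exponent [w].  In the
    monomial chart, on the torus over [n0], it reads
      [1 + b y + (terms of the other exponents) = 0],
    where [b y] is the term of [m0].  A convergent Puiseux series has the size
    of its leading term ([peval_bounds]), so [b] stays between two positive
    constants, while every other term is a coefficient of size [O(t^delta)]
    times a power of [y]: this is what it means for [n0] to lie in the interior
    of the cell dual to the edge [w m0] ([regime]).  In the coordinate
    [s = b y] the equation is thus [1 + s + N(s) = 0] with a small Laurent
    polynomial [N], uniformly in the angles.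

    Such an equation has exactly one solution near [s = -1].  Existence is
    algebraic: a polynomial without roots near [-1] cannot grow fast enough
    between [-1] and [-3/4] ([poly_growth], [perturbation_root]).  Uniqueness,
    and a lower bound away from the solution, follow from the Lipschitz
    estimate of [N] ([perturbation_lower]).  The solution is differentiable in
    each angle ([implicit_derivative]), so that the Jacobian of the tube makes
    sense; as the chart has determinant 1 and the angles do not depend on the
    first parameter, that Jacobian is triangular and the derivatives of the
    solution disappear from it ([tube_det]).

    The period therefore is an iterated integral whose inner integral is, up to
    [i^(d+1)], the residue at [y = Y] of a rational function of [y].  It does
    not depend on the radius of the tube ([residue_radius_indep]).  On the circle
    [|s - s0| = 1/4] around the solution [s0], the integrand is within
    [O(t^delta)] of one with a known mean ([leading_residue]): if the numerator
    involves [w] and [m0] only, with total exponent [q] of [m0], the limit is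
      [Res_(s = -1) s^q / (1 + s)^l ds / s],
    which is [-1] for [q = 0] and [0] for [0 < q < l].  Any other term in the
    numerator makes the integrand [O(t^delta)]
    ([small_numerator_integral]).  The case [q = 0] is that of [tau = {w}].  The
    remaining value [q = l] would mean [tau = {m0}] and [v = l m0]; as [v] is
    interior to [l Delta], the point [m0] would be in [W], and the orientation
    convention then forces [w = m0].

    The inner integral is estimated uniformly in the angles, and the integral is
    monotone even on functions that are not measurable ([integral_mono]), so the
    outer integrals only contribute the factor [(2 pi)^d]
    ([torus_integral_near]). *)

(** * Moduli of complex numbers *)
Section Modulus.
Variable R : realType.
Implicit Types z w : R[i].

Lemma CmodE z : (Cmod z)%:C%C = `|z|.
Proof. by rewrite normc_def; case: z. Qed.

Lemma Cmod_ge0 z : 0 <= Cmod z.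
Proof. by case: z => a b; apply: sqrtr_ge0. Qed.

Lemma Cmod0 : Cmod (0 : R[i]) = 0. Proof. exact: Normc.normc0. Qed.
Lemma Cmod1 : Cmod (1 : R[i]) = 1. Proof. exact: Normc.normc1. Qed.

Lemma Cmod_eq0 z : (Cmod z == 0) = (z == 0).
Proof. by apply/eqP/eqP => [/Normc.eq0_normc//|->]; exact: Cmod0. Qed.

Lemma Cmod_gt0 z : (0 < Cmod z) = (z != 0).
Proof. by rewrite lt0r Cmod_eq0 Cmod_ge0 andbT. Qed.

Lemma CmodM z w : Cmod (z * w) = Cmod z * Cmod w.
Proof. exact: Normc.normcM. Qed.

Lemma CmodV z : Cmod z^-1 = (Cmod z)^-1.
Proof. exact: Normc.normcV. Qed.

Lemma CmodN z : Cmod (- z) = Cmod z.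
Proof. by case: z => a b; rewrite /Cmod /Normc.normc /= !sqrrN. Qed.

Lemma CmodX z n : Cmod (z ^+ n) = Cmod z ^+ n.
Proof. by elim: n => [|n IH]; rewrite ?expr0 ?Cmod1// !exprS CmodM IH. Qed.

Lemma Cmodz z (e : int) : Cmod (z ^ e) = Cmod z ^ e.
Proof. by case: e => n; rewrite -?exprnP ?NegzE -?exprnN ?CmodV CmodX. Qed.

Lemma CmodC (x : R) : Cmod x%:C%C = `|x|.
Proof. by rewrite /Cmod /Normc.normc /= expr0n /= addr0 sqrtr_sqr. Qed.

Lemma ge0_CmodC (x : R) : 0 <= x -> Cmod x%:C%C = x.
Proof. by move=> x0; rewrite CmodC ger0_norm. Qed.

Lemma Cmod_add_le z w : Cmod (z + w) <= Cmod z + Cmod w.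
Proof. by have := ler_normD z w; rewrite -!CmodE -rmorphD /= lecR. Qed.

Lemma Cmod_sub_le z w : Cmod (z - w) <= Cmod z + Cmod w.
Proof. by rewrite -(CmodN w) Cmod_add_le. Qed.

Lemma CmodB z w : Cmod (z - w) = Cmod (w - z).
Proof. by rewrite -CmodN opprB. Qed.

Lemma Cmod_sub_ge z w : Cmod z - Cmod w <= Cmod (z - w).
Proof. by rewrite lerBlDr -{1}(subrK w z) Cmod_add_le. Qed.

Lemma Cmod_sum_le (I : Type) (s : seq I) (P : pred I) (F : I -> R[i]) :
  Cmod (\sum_(i <- s | P i) F i) <= \sum_(i <- s | P i) Cmod (F i).
Proof.
elim/big_rec2 : _ => [|i x y _ IH]; first by rewrite Cmod0.
by apply: le_trans (Cmod_add_le _ _) _; rewrite lerD2l.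
Qed.

Lemma Cmod_prod (I : Type) (s : seq I) (P : pred I) (F : I -> R[i]) :
  Cmod (\prod_(i <- s | P i) F i) = \prod_(i <- s | P i) Cmod (F i).
Proof. by apply: (big_morph (@Cmod R)); [exact: CmodM|exact: Cmod1]. Qed.

Lemma Re_le_Cmod z : `|complex.Re z| <= Cmod z.
Proof. by have := normc_ge_Re z; rewrite -CmodE lecR. Qed.

Lemma Im_le_Cmod z : `|complex.Im z| <= Cmod z.
Proof.
case: z => a b; rewrite /Cmod /Normc.normc /= -sqrtr_sqr ler_sqrt ?addr_ge0 ?sqr_ge0//.
by rewrite lerDr sqr_ge0.
Qed.

Lemma Cmod_le_ReIm z : Cmod z <= `|complex.Re z| + `|complex.Im z|.
Proof.
case: z => a b; rewrite [complex.Re _]/= [complex.Im _]/=.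
have {1}-> : (a +i* b = a%:C + 'i * b%:C)%C.
  by apply/eqP; rewrite eq_complex /=; apply/andP; split; apply/eqP; ring.
apply: le_trans (Cmod_add_le _ _) _; rewrite CmodM !CmodC.
have -> : Cmod ('i%C : R[i]) = 1.
  by rewrite /Cmod /Normc.normc /= expr0n /= add0r expr1n sqrtr1.
by rewrite mul1r.
Qed.

End Modulus.

(** * Integrals over the circle *)

Section Integration.
Variable R : realType.
Local Open Scope ereal_scope.

(** The positive and the negative part are integrated as suprema over simple
    functions, hence monotonically on all functions; this is what allows iterated
    integrals to be estimated without knowing how the inner ones depend on the
    remaining variables. *)
Lemma integral_mono d (T : measurableType d) (mu : {measure set T -> \bar R})
    (D : set T) (f g : T -> \bar R) :
  (forall x, D x -> f x <= g x) ->
  \int[mu]_(x in D) f x <= \int[mu]_(x in D) g x.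
Proof.
move=> fg; rewrite /integral.
have fg' x : (f \_ D) x <= (g \_ D) x.
  by rewrite /patch; case: ifPn => // /set_mem; exact: fg.
apply: leeB; apply: le_ereal_sup => _ [h /= hf <-]; exists h => //= x;
  apply: le_trans (hf x) _.
- by rewrite !funeposE ge_max le_max fg' le_max lexx orbT.
- by rewrite !funenegE ge_max le_max leeN2 fg' le_max lexx orbT.
Qed.

End Integration.

Section CircleIntegral.
Variable R : realType.
Local Notation mu := (@lebesgue_measure R).
Local Notation I2pi := `[0%R, 2 * pi : R].

Lemma pi2_gt0 : 0 < 2 * pi :> R.
Proof. by rewrite mulr_gt0// pi_gt0. Qed.

Lemma lebesgue_I2pi : mu [set` I2pi] = (2 * pi)%:E.
Proof. by rewrite lebesgue_measure_itv /= lte_fin pi2_gt0 oppr0 adde0. Qed.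

Lemma Rint_cst (c : R) : Rintegral mu [set` I2pi] (fun=> c) = c * (2 * pi).
Proof.
rewrite Rintegral_cst//; congr (_ * _).
by transitivity (fine (2 * pi : R)%:E); first exact: (congr1 fine lebesgue_I2pi).
Qed.

Lemma Rint_between (f f1 f2 : R -> R) :
  mu.-integrable [set` I2pi] (EFin \o f1) ->
  mu.-integrable [set` I2pi] (EFin \o f2) ->
  (forall x, f1 x <= f x <= f2 x) ->
  Rintegral mu [set` I2pi] f1 <= Rintegral mu [set` I2pi] f <=
  Rintegral mu [set` I2pi] f2.
Proof.
move=> if1 if2 ff.
have h1 : (\int[mu]_(x in [set` I2pi]) (f1 x)%:E <=
           \int[mu]_(x in [set` I2pi]) (f x)%:E)%E.
  by apply: integral_mono => x _; rewrite lee_fin; case/andP: (ff x).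
have h2 : (\int[mu]_(x in [set` I2pi]) (f x)%:E <=
           \int[mu]_(x in [set` I2pi]) (f2 x)%:E)%E.
  by apply: integral_mono => x _; rewrite lee_fin; case/andP: (ff x).
have /(_ (measurable_itv _)) n1 := fun m => integrable_fin_num m if1.
have /(_ (measurable_itv _)) n2 := fun m => integrable_fin_num m if2.
have n : (\int[mu]_(x in [set` I2pi]) (f x)%:E)%E \is a fin_num.
  rewrite fin_numE; apply/andP; split.
    by apply/eqP => E; move: h1; rewrite E leeNy_eq => /eqP E'; move: n1; rewrite E'.
  by apply/eqP => E; move: h2; rewrite E leye_eq => /eqP E'; move: n2; rewrite E'.
by apply/andP; split; apply: fine_le.
Qed.

Lemma cont_int (f : R -> R) : continuous f ->
  mu.-integrable [set` I2pi] (EFin \o f).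
Proof.
move=> cf; apply: continuous_compact_integrable; first exact: segment_compact.
exact: continuous_subspaceT.
Qed.

Lemma Rint_approx (f h : R -> R) (e : R) : continuous h ->
  (forall x, `|f x - h x| <= e) ->
  `|Rintegral mu [set` I2pi] f - Rintegral mu [set` I2pi] h| <= 2 * pi * e.
Proof.
move=> ch fh.
have cc : continuous (fun _ : R => e) by move=> ?; apply: cst_continuous.
have c1 : continuous (fun x => h x - e).
  by move=> x; apply: cvgB; [exact: ch|exact: cc].
have c2 : continuous (fun x => h x + e).
  by move=> x; apply: cvgD; [exact: ch|exact: cc].
have := @Rint_between f _ _ (cont_int c1) (cont_int c2).
rewrite RintegralB// ?RintegralD// ?Rint_cst; try exact: cont_int.
move=> /(_ _)/andP[|h1 h2].
  by move=> x; have := fh x; rewrite ler_norml; lra.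
by rewrite ler_norml; apply/andP; split; lra.
Qed.

Definition Ccontinuous (g : R -> R[i]) :=
  continuous (fun s => complex.Re (g s)) /\ continuous (fun s => complex.Im (g s)).

(** [g], measurable or not, is squeezed between translates of [h]. *)
Lemma circle_approx (g h : R -> R[i]) (e : R) : Ccontinuous h ->
  (forall x, Cmod (g x - h x) <= e) ->
  Cmod (Ccircle_integral g - Ccircle_integral h) <= 4 * pi * e.
Proof.
move=> [c1 c2] gh; apply: le_trans (Cmod_le_ReIm _) _.
have -> : 4 * pi * e = 2 * pi * e + 2 * pi * e :> R by ring.
rewrite /Ccircle_integral /=; apply: lerD; apply: Rint_approx => // x;
  apply: le_trans (gh x).
- by apply: le_trans (Re_le_Cmod _); case: (g x); case: (h x).
- by apply: le_trans (Im_le_Cmod _); case: (g x); case: (h x).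
Qed.

Lemma CcontinuousD (g h : R -> R[i]) : Ccontinuous g -> Ccontinuous h ->
  Ccontinuous (fun s => g s + h s).
Proof.
move=> [g1 g2] [h1 h2]; split=> x.
- under [X in continuous_at _ X]funext do rewrite raddfD; exact: cvgD (g1 x) (h1 x).
- under [X in continuous_at _ X]funext do rewrite raddfD; exact: cvgD (g2 x) (h2 x).
Qed.

Lemma CcontinuousZ (c : R[i]) (g : R -> R[i]) : Ccontinuous g ->
  Ccontinuous (fun s => c * g s).
Proof.
case: c => a b [g1 g2]; split=> x.
- have -> : (fun s => complex.Re ((a +i* b)%C * g s)) =
     (fun s => a * complex.Re (g s) - b * complex.Im (g s)).
    by apply/funext => s; case: (g s).
  by apply: cvgB; apply: cvgM; [exact: cst_continuous|exact: g1|exact: cst_continuous|exact: g2].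
- have -> : (fun s => complex.Im ((a +i* b)%C * g s)) =
     (fun s => a * complex.Im (g s) + b * complex.Re (g s)).
    by apply/funext => s; case: (g s).
  by apply: cvgD; apply: cvgM; [exact: cst_continuous|exact: g2|exact: cst_continuous|exact: g1].
Qed.

Lemma Ccontinuous_cst c : Ccontinuous (fun=> c).
Proof. by split=> ?; apply: cst_continuous. Qed.

Lemma circle_integralD (g h : R -> R[i]) : Ccontinuous g -> Ccontinuous h ->
  Ccircle_integral (fun s => g s + h s) =
  Ccircle_integral g + Ccircle_integral h.
Proof.
move=> [g1 g2] [h1 h2]; rewrite /Ccircle_integral.
have -> : (fun s => complex.Re (g s + h s)) =
   (fun s => complex.Re (g s) + complex.Re (h s)).
  by apply/funext => s; case: (g s); case: (h s).
have -> : (fun s => complex.Im (g s + h s)) =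
   (fun s => complex.Im (g s) + complex.Im (h s)).
  by apply/funext => s; case: (g s); case: (h s).
by rewrite !RintegralD//; exact: cont_int.
Qed.

Lemma circle_integralZ (c : R[i]) (g : R -> R[i]) : Ccontinuous g ->
  Ccircle_integral (fun s => c * g s) = c * Ccircle_integral g.
Proof.
case: c => a b [g1 g2]; rewrite /Ccircle_integral.
have cZ (c : R) (f : R -> R) : continuous f -> continuous (fun s => c * f s).
  by move=> cf x; apply: cvgM; [exact: cst_continuous|exact: cf].
have -> : (fun s => complex.Re ((a +i* b)%C * g s)) =
   (fun s => a * complex.Re (g s) - b * complex.Im (g s)).
  by apply/funext => s; case: (g s).
have -> : (fun s => complex.Im ((a +i* b)%C * g s)) =
   (fun s => a * complex.Im (g s) + b * complex.Re (g s)).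
  by apply/funext => s; case: (g s).
rewrite RintegralB ?RintegralD//; try exact/cont_int/cZ.
by rewrite !RintegralZl//; exact: cont_int.
Qed.

(** ** Characters of the circle *)

Lemma CexpiD (x y : R) : Cexpi (x + y) = Cexpi x * Cexpi y.
Proof.
by rewrite /Cexpi cosD sinD; apply/eqP; rewrite eq_complex /= eqxx /= addrC mulrC.
Qed.

Lemma Cexpi0 : Cexpi (0 : R) = 1.
Proof. by rewrite /Cexpi cos0 sin0. Qed.

Lemma Cmod_Cexpi (x : R) : Cmod (Cexpi x) = 1.
Proof. by rewrite /Cmod /Normc.normc /= cos2Dsin2 sqrtr1. Qed.

Lemma Cexpi_neq0 (x : R) : Cexpi x != 0.
Proof. by rewrite -Cmod_eq0 Cmod_Cexpi oner_eq0. Qed.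

Lemma CexpiN (x : R) : Cexpi (- x) = (Cexpi x)^-1.
Proof.
by apply: (mulfI (Cexpi_neq0 x)); rewrite -CexpiD subrr Cexpi0 divff// Cexpi_neq0.
Qed.

Lemma CexpiX (x : R) n : Cexpi x ^+ n = Cexpi (n%:R * x).
Proof.
elim: n => [|n IH]; first by rewrite mul0r Cexpi0.
by rewrite exprS IH -CexpiD mulrSr mulrDl mul1r addrC.
Qed.

Lemma CexpiZ (x : R) (e : int) : Cexpi x ^ e = Cexpi (e%:~R * x).
Proof.
case: e => n; first by rewrite -exprnP CexpiX.
by rewrite NegzE -exprnN CexpiX -CexpiN mulrNz mulNr.
Qed.

Lemma Ccontinuous_Cexpi (a : R) : Ccontinuous (fun s => Cexpi (a * s)).
Proof.
have c : continuous (fun s : R => a * s).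
  by move=> x; apply: cvgM; [exact: cst_continuous|exact: cvg_id].
split=> x /=.
- by apply: (@continuous_comp _ _ _ (fun s : R => a * s) cos x (c x)); exact: continuous_cos.
- by apply: (@continuous_comp _ _ _ (fun s : R => a * s) sin x (c x)); exact: continuous_sin.
Qed.

Lemma sin_periodz (k : int) : sin (k%:~R * (2 * pi)) = 0 :> R.
Proof.
have N n : sin (n%:R * (2 * pi)) = 0 :> R.
  elim: n => [|n IH]; first by rewrite mul0r sin0.
  have -> : n.+1%:R * (2 * pi) = n%:R * (2 * pi) + pi *+ 2 :> R.
    by rewrite -[pi *+ 2]mulr_natl mulrSr mulrDl mul1r.
  by rewrite sinD2pi.
case: k => n; first exact: N.
by rewrite NegzE mulrNz mulNr sinN N oppr0.
Qed.

Lemma cos_periodz (k : int) : cos (k%:~R * (2 * pi)) = 1 :> R.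
Proof.
have N n : cos (n%:R * (2 * pi)) = 1 :> R.
  elim: n => [|n IH]; first by rewrite mul0r cos0.
  have -> : n.+1%:R * (2 * pi) = n%:R * (2 * pi) + pi *+ 2 :> R.
    by rewrite -[pi *+ 2]mulr_natl mulrSr mulrDl mul1r.
  by rewrite cosD2pi.
case: k => n; first exact: N.
by rewrite NegzE mulrNz mulNr cosN N.
Qed.

Lemma circle_integral_Cexpi (k : int) :
  Ccircle_integral (fun s : R => Cexpi (k%:~R * s)) = ((2 * pi) *+ (k == 0))%:C%C.
Proof.
have [->|k0] := eqVneq k 0.
  rewrite /Ccircle_integral mulr1n.
  have -> : (fun s : R => complex.Re (Cexpi (R:=R) (0%:~R * s))) = fun=> 1.
    by apply/funext => s; rewrite mul0r Cexpi0.
  have -> : (fun s : R => complex.Im (Cexpi (R:=R) (0%:~R * s))) = fun=> 0.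
    by apply/funext => s; rewrite mul0r Cexpi0.
  by rewrite !Rint_cst mul1r mul0r.
have kR : k%:~R != 0 :> R by rewrite intr_eq0.
have [c1 c2] := Ccontinuous_Cexpi k%:~R.
have dF (F : R -> R) (g : R -> R) :
   (forall x : R, is_derive x (1 : R) F (g x)) -> continuous g ->
   Rintegral mu [set` I2pi] g = F (2 * pi) - F 0.
  move=> dF cg; rewrite /Rintegral (@continuous_FTC2 _ g F) ?pi2_gt0//.
  - exact: continuous_subspaceT.
  - have cF : continuous F.
      by move=> x; apply: differentiable_continuous; apply/derivable1_diffP; case: (dF x).
    split; first by move=> x _; case: (dF x).
      exact: cvg_at_right_filter (cF _).
    exact: cvg_at_left_filter (cF _).
  - by move=> x _; rewrite derive1E; apply: derive_val.
rewrite /Ccircle_integral mulr0n /Cexpi /=.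
rewrite (dF (fun s => k%:~R^-1 * sin (k%:~R * s)) _ _ c1); last first.
  move=> x; apply: is_derive_eq; rewrite !scaler1 /GRing.scale /=.
  by field.
rewrite (dF (fun s => - k%:~R^-1 * cos (k%:~R * s)) _ _ c2); last first.
  move=> x; apply: is_derive_eq; rewrite !scaler1 /GRing.scale /=.
  by field.
by rewrite sin_periodz cos_periodz !mulr0 sin0 cos0 mulr0 !subrr.
Qed.

End CircleIntegral.

(** * Means of rational functions over circles *)
Section Means.
Variable R : realType.
Local Notation C := R[i].

Lemma circle_trig_sum (I : Type) (s : seq I) (c : I -> C) (k : I -> int) :
  let T := fun x : R => \sum_(i <- s) c i * Cexpi ((k i)%:~R * x) in
  Ccontinuous T /\
  Ccircle_integral T = (2 * pi)%:C%C * \sum_(i <- s | k i == 0) c i.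
Proof.
elim: s => [|i s [IH1 IH2]] /=.
  have -> : (fun x : R => \sum_(i <- [::]) c i * Cexpi ((k i)%:~R * x)) = fun=> 0.
    by apply/funext => x; rewrite big_nil.
  split; first exact: Ccontinuous_cst.
  rewrite big_nil mulr0
    /Ccircle_integral !Rint_cst /= !mul0r.
  by [].
have -> : (fun x : R => \sum_(j <- i :: s) c j * Cexpi ((k j)%:~R * x)) =
  fun x => c i * Cexpi ((k i)%:~R * x) + \sum_(j <- s) c j * Cexpi ((k j)%:~R * x).
  by apply/funext => x; rewrite big_cons.
have cE := Ccontinuous_Cexpi ((k i)%:~R : R).
split; first by apply: CcontinuousD => //; apply: CcontinuousZ.
rewrite circle_integralD//; last exact: CcontinuousZ.
rewrite circle_integralZ// IH2 circle_integral_Cexpi big_cons.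
by move: (2 * pi) => u; case: eqP => _; rewrite ?mulr0n ?mulr1n; ring.
Qed.

Section CircleMean.
Variables (x0 : C) (n : nat).
Hypothesis x0_neq0 : x0 != 0.
Local Notation x phi := (x0 * Cexpi phi).

Lemma circle_pt_neq0 phi : x phi != 0.
Proof. by rewrite mulf_neq0// Cexpi_neq0. Qed.

Lemma Cmod_circle_pt phi : Cmod (x phi) = Cmod x0.
Proof. by rewrite CmodM Cmod_Cexpi mulr1. Qed.

Lemma circle_laurent (P : {poly C}) :
  let T := fun phi => P.[x phi] / x phi ^+ n in
  Ccontinuous T /\ Ccircle_integral T = (2 * pi)%:C%C * P`_n.
Proof.
pose c (i : 'I_(size P)) := P`_i * x0 ^ ((i : nat)%:Z - n%:Z).
have -> : (fun phi => P.[x phi] / x phi ^+ n) = fun phi : R =>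
    \sum_(i <- enum 'I_(size P)) c i * Cexpi (((i : nat)%:Z - n%:Z)%:~R * phi).
  apply/funext => phi; rewrite horner_coef mulr_suml big_enum /=.
  apply: eq_bigr => i _; rewrite /c -CexpiZ -!mulrA -expfzMl.
  by rewrite expfzDr ?circle_pt_neq0// -exprnP exprnN.
have [h1 h2] := circle_trig_sum (enum 'I_(size P)) c (fun i => (i : nat)%:Z - n%:Z).
split=> //; rewrite h2; congr (_ * _); rewrite big_enum_cond /=.
have [nP|Pn] := ltnP n (size P); last first.
  rewrite nth_default// big1// => i; rewrite subr_eq0 => /eqP[E].
  by have := ltn_ord i; rewrite E ltnNge Pn.
rewrite (big_pred1 (Ordinal nP)) ?/c /=; first by rewrite subrr expr0z mulr1.
by move=> i; rewrite /= subr_eq0 -val_eqE.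
Qed.

(** The constant Fourier coefficient, in a form that is stable under uniform
    limits: the only functions that ever have to be integrated exactly are
    Laurent polynomials in [x0 e^(i phi)]. *)
Definition has_mean (h : R -> C) (c : C) := forall e : R, 0 < e ->
  exists2 P : {poly C}, Cmod (P`_n - c) <= e &
    forall phi, Cmod (h phi - P.[x phi] / x phi ^+ n) <= e.

Lemma has_meanZ (k c : C) (h : R -> C) : has_mean h c ->
  has_mean (fun phi => k * h phi) (k * c).
Proof.
move=> hc e e0; have k0 : 0 < Cmod k + 1 by rewrite ltr_wpDl ?Cmod_ge0.
have [P h1 h2] := hc _ (divr_gt0 e0 k0).
have bound z : Cmod z <= e / (Cmod k + 1) -> Cmod (k * z) <= e.
  rewrite ler_pdivlMr// => hz; apply: le_trans hz; rewrite CmodM mulrC.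
  by rewrite ler_wpM2l ?Cmod_ge0// lerDl.
exists (k *: P); first by rewrite coefZ -mulrBr bound.
by move=> phi; rewrite hornerZ -mulrA -mulrBr bound.
Qed.

Lemma has_mean_integral (g h : R -> C) (c : C) (eta : R) : has_mean h c ->
  (forall phi, Cmod (g phi - h phi) <= eta) ->
  Cmod (Ccircle_integral g - (2 * pi)%:C%C * c) <= 4 * pi * eta.
Proof.
move=> hc gh; have pi0 := pi_gt0 R.
apply/ler_addgt0Pr => e e0.
have e'0 : 0 < e / (6 * pi) by rewrite divr_gt0// mulr_gt0.
have [P h1 h2] := hc _ e'0.
have [cP iP] := circle_laurent P.
have ->: Ccircle_integral g - (2 * pi)%:C%C * c =
  (Ccircle_integral g - (2 * pi)%:C%C * P`_n) + (2 * pi)%:C%C * (P`_n - c) by ring.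
apply: le_trans (Cmod_add_le _ _) _.
have -> : 4 * pi * eta + e =
  4 * pi * (eta + e / (6 * pi)) + (2 * pi) * (e / (6 * pi)).
  by move: (pi : R) pi0 => u u0; field; rewrite gt_eqF.
apply: lerD.
  rewrite -iP; apply: circle_approx => // phi.
  rewrite -(subrKA (h phi)); apply: le_trans (Cmod_add_le _ _) _.
  by apply: lerD.
rewrite CmodM ge0_CmodC; last by rewrite mulr_ge0// ltW.
by rewrite ler_wpM2l// mulr_ge0// ltW.
Qed.

End CircleMean.

(** ** Uniform approximation of rational functions by polynomials *)

Definition poly_approx (r : R) (g : C -> C) := forall e : R, 0 < e ->
  exists P : {poly C}, forall z, Cmod z <= r -> Cmod (g z - P.[z]) <= e.

Lemma poly_bounded (r : R) (P : {poly C}) :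
  exists2 M : R, 0 < M & forall z, Cmod z <= r -> Cmod P.[z] <= M.
Proof.
elim/poly_ind: P => [|P c [M M0 h]].
  by exists 1 => // z _; rewrite horner0 Cmod0.
exists (M * `|r| + Cmod c + 1) => [|z zr].
  by rewrite ltr_wpDl// addr_ge0 ?Cmod_ge0// mulr_ge0// ltW.
rewrite hornerMXaddC; apply: le_trans (Cmod_add_le _ _) _.
rewrite -addrA [_ + 1]addrC addrA lerD2r ler_wpDr// CmodM.
by apply: ler_pM; rewrite ?Cmod_ge0 ?h// (le_trans zr) ?ler_norm.
Qed.

Lemma poly_approx_poly r (P : {poly C}) : poly_approx r (horner P).
Proof. by move=> e e0; exists P => z _; rewrite subrr Cmod0 ltW. Qed.

Lemma poly_approxM r f g : poly_approx r f -> poly_approx r g ->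
  poly_approx r (fun z => f z * g z).
Proof.
move=> hf hg e e0.
have [P0 hP0] := hf _ ltr01.
have [M M0 hM] := poly_bounded r P0.
have Mf z : Cmod z <= r -> Cmod (f z) <= M + 1.
  move=> zr; rewrite -(subrK P0.[z] (f z)) addrC.
  by apply: le_trans (Cmod_add_le _ _) _; rewrite lerD ?hM ?hP0.
have M1 : 0 < M + 1 by lra.
have e1 : 0 < e / 2 / (M + 1) by rewrite !divr_gt0.
have [Q hQ] := hg _ e1.
have [N N0 hN] := poly_bounded r Q.
have e2 : 0 < e / 2 / N by rewrite !divr_gt0.
have [P hP] := hf _ e2.
exists (P * Q) => z zr; rewrite hornerM.
have -> : f z * g z - P.[z] * Q.[z] = f z * (g z - Q.[z]) + (f z - P.[z]) * Q.[z].
  by ring.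
apply: le_trans (Cmod_add_le _ _) _; rewrite !CmodM.
have -> : e = (M + 1) * (e / 2 / (M + 1)) + (e / 2 / N) * N.
  by field; rewrite !gt_eqF.
by apply: lerD; apply: ler_pM; rewrite ?Cmod_ge0 ?Mf ?hQ ?hP ?hN.
Qed.

(** Partial sums of the geometric series. *)
Lemma poly_approx_invXsubC r (a : C) : 0 <= r -> r < Cmod a ->
  poly_approx r (fun z => (z - a)^-1).
Proof.
move=> r0 ra e e0.
have a0 : 0 < Cmod a by apply: le_lt_trans ra.
have a_neq0 : a != 0 by rewrite -Cmod_gt0.
have q1 : `|r / Cmod a| < 1.
  by rewrite ger0_norm ?divr_ge0 ?Cmod_ge0// ltr_pdivrMr// mul1r.
have d0 : 0 < e * (Cmod a - r) by rewrite mulr_gt0// subr_gt0.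
have [N hN] : exists N : nat, (r / Cmod a) ^+ N <= e * (Cmod a - r).
  have /cvgrPdist_le/(_ _ d0)[N _ hN] := cvg_expr q1.
  exists N; have := hN N (leqnn N); rewrite sub0r normrN.
  exact: le_trans (ler_norm _).
exists (\poly_(k < N) - a^-1 ^+ k.+1) => z zr.
have za : Cmod a - r <= Cmod (z - a).
  rewrite CmodB; apply: le_trans (Cmod_sub_ge _ _); lra.
have za0 : z - a != 0 by rewrite -Cmod_gt0; apply: lt_le_trans za; lra.
have -> : (z - a)^-1 - (\poly_(k < N) - a^-1 ^+ k.+1).[z] = (z / a) ^+ N / (z - a).
  have -> : (\poly_(k < N) - a^-1 ^+ k.+1).[z] =
    - a^-1 * \sum_(k < N) (z / a) ^+ k.
    rewrite horner_poly mulr_sumr; apply: eq_bigr => k _.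
    by rewrite exprS exprMn; ring.
  have H : (z / a) ^+ N - 1 = (z / a - 1) * \sum_(k < N) (z / a) ^+ k.
    by rewrite subrX1.
  have -> : (z / a) ^+ N = 1 + (z / a - 1) * \sum_(k < N) (z / a) ^+ k.
    by rewrite -H; ring.
  by move: (\sum_(k < N) _) => s; field; rewrite a_neq0 za0.
rewrite CmodM CmodX CmodM !CmodV.
have h1 : (Cmod z / Cmod a) ^+ N <= (r / Cmod a) ^+ N.
  rewrite lerXn2r ?nnegrE ?divr_ge0 ?Cmod_ge0//.
  by rewrite ler_pM2r ?invr_gt0.
have ar : 0 < Cmod a - r by lra.
rewrite ler_pdivrMr; last exact: lt_le_trans za.
apply: le_trans h1 _; apply: le_trans hN _.
by rewrite ler_pM2l.
Qed.

(** [Q] splits into linear factors, whose roots lie outside the disc. *)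
Lemma poly_approx_inv r (Q : {poly C}) : 0 <= r ->
  (forall z, Cmod z <= r -> Q.[z] != 0) -> poly_approx r (fun z => Q.[z]^-1).
Proof.
move=> r0; have [s ->] := closed_field_poly_normal Q.
move: (lead_coef Q) => c hQ.
have c0 : c != 0.
  have := hQ 0; rewrite Cmod0 => /(_ r0); apply: contra => /eqP->.
  by rewrite scale0r horner0.
have hs a : a \in s -> r < Cmod a.
  move=> sa; rewrite ltNge; apply/negP => /hQ; rewrite hornerZ mulf_eq0 negb_or.
  have : root (\prod_(z <- s) ('X - z%:P)) a by rewrite root_prod_XsubC.
  by rewrite /root => /eqP->; rewrite eqxx andbF.
have -> : (fun z => (c *: \prod_(z <- s) ('X - z%:P)).[z]^-1) =
   (fun z => (c^-1%:P).[z] * \prod_(a <- s) (z - a)^-1).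
  apply/funext => z; rewrite hornerZ horner_prod invfM hornerC; congr (_ * _).
  by rewrite -prodfV; apply: eq_bigr => a _; rewrite hornerXsubC.
apply: poly_approxM; first exact: poly_approx_poly.
elim: s hs {hQ} => [|a s IH] hs.
  have -> : (fun z => \prod_(a <- [::]) (z - a)^-1) = horner (1%:P : {poly C}).
    by apply/funext => z; rewrite big_nil hornerC.
  exact: poly_approx_poly.
have -> : (fun z => \prod_(a0 <- a :: s) (z - a0)^-1) =
   (fun z => (z - a)^-1 * \prod_(a0 <- s) (z - a0)^-1).
  by apply/funext => z; rewrite big_cons.
apply: poly_approxM; first by apply: poly_approx_invXsubC => //; apply: hs; rewrite mem_head.
by apply: IH => b bs; apply: hs; rewrite inE bs orbT.
Qed.

(** The residue theorem for a pole at the centre.  The integrand is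
    [B / x^n + x E / Q], and the second summand is a uniform limit of polynomials
    that vanish at 0. *)
Lemma rational_mean (x0 : C) n (S Q B E : {poly C}) : x0 != 0 ->
  S = Q * B + 'X^(n.+1) * E ->
  (forall z, Cmod z <= Cmod x0 -> Q.[z] != 0) ->
  has_mean x0 n (fun phi => S.[x0 * Cexpi phi] /
     (Q.[x0 * Cexpi phi] * (x0 * Cexpi phi) ^+ n)) B`_n.
Proof.
move=> x00 SE hQ e e0.
have x0p : 0 < Cmod x0 by rewrite Cmod_gt0.
have H : poly_approx (Cmod x0) (fun z => E.[z] * Q.[z]^-1).
  by apply: poly_approxM (poly_approx_poly _ _) (poly_approx_inv _ hQ); rewrite ltW.
have [P hP] := H (e / Cmod x0) (divr_gt0 e0 x0p).
exists (B + 'X^(n.+1) * P).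
  by rewrite coefD coefXnM ltnSn addr0 subrr Cmod0 ltW.
move=> phi; set z := x0 * _.
have zm : Cmod z = Cmod x0 by rewrite Cmod_circle_pt.
have Qz : Q.[z] != 0 by apply: hQ; rewrite zm.
have z0 : z != 0 by apply: circle_pt_neq0.
rewrite SE !hornerE.
have -> : (Q.[z] * B.[z] + z ^+ n.+1 * E.[z]) / (Q.[z] * z ^+ n) -
   (B.[z] + z ^+ n.+1 * P.[z]) / z ^+ n = z * (E.[z] * Q.[z]^-1 - P.[z]).
  have zn : z ^+ n != 0 by rewrite expf_neq0.
  rewrite exprS; move: (z ^+ n) zn => u u0.
  by field; rewrite Qz.
rewrite CmodM zm -[leRHS](mulVKf (lt0r_neq0 x0p)) [_^-1 * e]mulrC.
by rewrite ler_pM2l// hP// zm.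
Qed.

(** [Q] is invertible modulo a power of [x]. *)
Lemma taylor_poly n (S Q : {poly C}) : Q.[0] != 0 ->
  exists B E : {poly C}, S = Q * B + 'X^(n.+1) * E.
Proof.
move=> Q0.
have cQ : coprimep Q 'X^(n.+1).
  by rewrite coprimep_expr// coprimepX.
have /Bezout_eq1_coprimepP[[u v] /= uv] := cQ.
exists (S * u), (S * v); rewrite -[LHS]mulr1 -uv; ring.
Qed.

(** The Taylor polynomial of [S / Q] at 0, which determines the residue, does
    not involve the radius. *)
Lemma residue_const n (S Q : {poly C}) : exists c : C, forall x0 : C, x0 != 0 ->
  (forall z, Cmod z <= Cmod x0 -> Q.[z] != 0) ->
  has_mean x0 n (fun phi => S.[x0 * Cexpi phi] /
     (Q.[x0 * Cexpi phi] * (x0 * Cexpi phi) ^+ n)) c.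
Proof.
have [Q0|Q0] := eqVneq Q.[0] 0.
  by exists 0 => x0 _ /(_ 0); rewrite Cmod0 Cmod_ge0 Q0 eqxx => /(_ isT).
have [B [E SE]] := taylor_poly n S Q0.
by exists B`_n => x0 x00; apply: rational_mean SE.
Qed.

End Means.

(** * Small perturbations of a linear equation *)
Section Perturbation.
Variable R : realType.
Local Notation C := R[i].

(** A polynomial whose roots all keep a distance from [x] cannot grow fast
    between [x] and a nearby point; a small value at [x] next to a larger one
    at [y] therefore forces a root near [x]. *)
Lemma poly_growth (P : {poly C}) (x y : C) (rho : R) : 0 < rho ->
  (forall a, root P a -> rho <= Cmod (x - a)) ->
  Cmod P.[y] <= (1 + Cmod (y - x) / rho) ^+ (size P).-1 * Cmod P.[x].
Proof.
move=> rho0; have [-> _|P0] := eqVneq P 0.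
  by rewrite !horner0 Cmod0 mulr0.
have [s Ps] := closed_field_poly_normal P; have sP : size P = (size s).+1.
  by rewrite Ps size_scale ?lead_coef_eq0// size_prod_XsubC.
rewrite sP /= => hr.
have hs a : a \in s -> rho <= Cmod (x - a).
  by move=> sa; apply: hr; rewrite Ps rootZ ?lead_coef_eq0// root_prod_XsubC.
rewrite Ps !hornerZ !CmodM mulrCA ler_wpM2l ?Cmod_ge0// !horner_prod !Cmod_prod.
elim: s hs {Ps sP hr} => [|a s IH] hs; first by rewrite !big_nil expr0 mulr1.
rewrite !big_cons /= exprS !hornerXsubC mulrACA.
have hxy : 0 <= Cmod (y - x) / rho by rewrite divr_ge0 ?Cmod_ge0// ltW.
apply: ler_pM; rewrite ?Cmod_ge0//.
- by rewrite prodr_ge0// => b _; exact: Cmod_ge0.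
- have := hs a (mem_head _ _) => xa.
  rewrite -(subrKA x); apply: le_trans (Cmod_add_le _ _) _.
  by rewrite mulrDl mul1r addrC lerD2l mulrAC ler_pdivlMr// ler_wpM2l// Cmod_ge0.
- by apply: IH => b sb; apply: hs; rewrite inE sb orbT.
Qed.

(** The divided difference of [x |-> x^e]. *)
Definition exp_divdiff (e : int) (x y : C) : C :=
  match e with
  | Posz n => \sum_(i < n) x ^+ (n.-1 - i) * y ^+ i
  | Negz n => - (x * y) ^- n.+1 * \sum_(i < n.+1) x ^+ (n - i) * y ^+ i
  end.

Lemma exp_divdiffE e x y : x != 0 -> y != 0 -> x ^ e - y ^ e = (x - y) * exp_divdiff e x y.
Proof.
move=> x0 y0; case: e => n; first by rewrite -!exprnP subrXX.
rewrite NegzE -!exprnN /exp_divdiff.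
have -> : (x - y) * (- (x * y) ^- n.+1 * \sum_(i < n.+1) x ^+ (n - i) * y ^+ i) =
  - (x * y) ^- n.+1 * (x ^+ n.+1 - y ^+ n.+1) by rewrite subrXX /= mulrCA.
rewrite exprMn; have := expf_neq0 n.+1 x0; have := expf_neq0 n.+1 y0.
move: (x ^+ n.+1) (y ^+ n.+1) => u v u0 v0.
by field; rewrite u0.
Qed.

(** A region that contains the disc of radius 1/2 around [-1] and on which the
    powers of [x], of either sign, are bounded and Lipschitz. *)
Definition annulus (x : C) := 2^-1 <= Cmod x <= 2.

Lemma annulus_neq0 x : annulus x -> x != 0.
Proof. by move=> /andP[h _]; rewrite -Cmod_gt0; apply: lt_le_trans h; rewrite invr_gt0. Qed.

Lemma annulus_near x : Cmod (x + 1) <= 2^-1 -> annulus x.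
Proof.
move=> h; have h1 := Cmod_sub_ge (1 : C) (x + 1).
have h2 := Cmod_sub_le (x + 1) (1 : C); move: h1 h2.
rewrite addrK opprD addrCA subrr addr0 CmodN Cmod1 /annulus => h1 h2.
by apply/andP; split; lra.
Qed.

(** A bound on the annulus for [x^e] and for its divided differences. *)
Definition annulus_cst (e : int) : R := (`|e|.+1)%:R * 8 ^+ `|e|.

Lemma annulus_cst_ge1 e : 1 <= annulus_cst e.
Proof.
by rewrite /annulus_cst mulr_ege1 ?ler1n// exprn_ege1// ler1n.
Qed.

Lemma annulus_cst_expz e x : annulus x -> Cmod (x ^ e) <= annulus_cst e.
Proof.
move=> /[dup] /annulus_neq0 x0 /andP[h1 h2]; rewrite Cmodz.
have x0' : 0 < Cmod x by rewrite Cmod_gt0.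
have H : Cmod x ^ e <= 2 ^+ `|e|.
  case: e => n; rewrite ?NegzE -?exprnN /=.
    by rewrite -exprnP lerXn2r ?nnegrE ?Cmod_ge0.
  rewrite -exprVn lerXn2r ?nnegrE ?invr_ge0 ?Cmod_ge0//.
  by rewrite -[leRHS]invrK lef_pV2 ?posrE ?invr_gt0.
apply: le_trans H _; rewrite -[leLHS]mul1r /annulus_cst ler_pM ?ler1n ?exprn_ge0//.
by rewrite lerXn2r ?nnegrE// ler_nat.
Qed.

Lemma annulus_cst_divdiff e x y : annulus x -> annulus y -> Cmod (exp_divdiff e x y) <= annulus_cst e.
Proof.
move=> /[dup] /annulus_neq0 x0 /andP[x1 x2] /[dup] /annulus_neq0 y0 /andP[y1 y2].
have S n : Cmod (\sum_(i < n) x ^+ (n.-1 - i) * y ^+ i) <= n%:R * 2 ^+ n.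
  apply: le_trans (Cmod_sum_le _ _ _) _.
  rewrite -[n in n%:R]card_ord mulr_natl -sumr_const; apply: ler_sum => i _.
  rewrite CmodM !CmodX.
  have -> : 2 ^+ n = 2 * (2 ^+ (n.-1 - i) * 2 ^+ i) :> R.
    by rewrite -exprD -exprS; congr (_ ^+ _); have := ltn_ord i; lia.
  rewrite -[leLHS]mul1r ler_pM ?mulr_ge0 ?exprn_ge0 ?Cmod_ge0 ?ler1n//.
  by rewrite ler_pM ?exprn_ge0 ?Cmod_ge0// lerXn2r ?nnegrE ?Cmod_ge0.
have p0 n : 0 <= n%:R * 2 ^+ n :> R by rewrite mulr_ge0// exprn_ge0.
case: e => n; rewrite /exp_divdiff /annulus_cst /=.
  apply: le_trans (S n) _; apply: ler_pM; rewrite ?exprn_ge0// ?ler_nat//.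
  by rewrite lerXn2r ?nnegrE// ler_nat.
rewrite CmodM CmodN CmodV CmodX CmodM.
have h : (Cmod x * Cmod y) ^- n.+1 <= 4 ^+ n.+1.
  rewrite -exprVn lerXn2r ?nnegrE ?invr_ge0 ?mulr_ge0 ?Cmod_ge0//.
  rewrite -[leRHS]invrK lef_pV2 ?posrE ?invr_gt0 ?mulr_gt0 ?Cmod_gt0//.
  have -> : 4^-1 = 2^-1 * 2^-1 :> R by lra.
  by rewrite ler_pM ?invr_ge0.
have := S n.+1 => /= S1.
apply: le_trans (ler_pM _ _ h S1) _; rewrite ?Cmod_ge0//.
  by rewrite invr_ge0 exprn_ge0// mulr_ge0 ?Cmod_ge0.
rewrite mulrCA -exprMn -natrM; apply: ler_pM; rewrite ?exprn_ge0 ?ler_nat//.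
Qed.

Section Equation.
Variables (I : eqType) (r : seq I) (e : I -> int).
Implicit Type a : I -> C.

Definition laurent a (x : C) : C := \sum_(i <- r) a i * x ^ e i.

(** One number controls the size and the Lipschitz constant of
    [laurent a] on the annulus. *)
Definition small a (eta : R) := \sum_(i <- r) Cmod (a i) * annulus_cst (e i) <= eta.

Lemma laurent_le a eta x : small a eta -> annulus x -> Cmod (laurent a x) <= eta.
Proof.
move=> sa dx; apply: le_trans (Cmod_sum_le _ _ _) _; apply: le_trans sa.
by apply: ler_sum => i _; rewrite CmodM ler_wpM2l ?Cmod_ge0// annulus_cst_expz.
Qed.

Definition laurent_divdiff a (x y : C) : C := \sum_(i <- r) a i * exp_divdiff (e i) x y.

Lemma laurent_divdiff_le a eta x y : small a eta -> annulus x -> annulus y ->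
  Cmod (laurent_divdiff a x y) <= eta.
Proof.
move=> sa dx dy; apply: le_trans (Cmod_sum_le _ _ _) _; apply: le_trans sa.
by apply: ler_sum => i _; rewrite CmodM ler_wpM2l ?Cmod_ge0// annulus_cst_divdiff.
Qed.

Lemma laurentB a x y : x != 0 -> y != 0 ->
  laurent a x - laurent a y = (x - y) * laurent_divdiff a x y.
Proof.
move=> x0 y0; rewrite /laurent /laurent_divdiff -sumrB mulr_sumr; apply: eq_bigr => i _.
by rewrite -mulrBr exp_divdiffE// mulrCA.
Qed.

Lemma laurent_term_le a eta x i : small a eta -> annulus x -> i \in r ->
  Cmod (a i * x ^ e i) <= eta.
Proof.
move=> sa dx ir; apply: le_trans sa; rewrite CmodM.
apply: le_trans (_ : Cmod (a i) * annulus_cst (e i) <= _).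
  by rewrite ler_wpM2l ?Cmod_ge0// annulus_cst_expz.
rewrite (perm_big _ (perm_to_rem ir)) big_cons lerDl sumr_ge0// => j _.
by rewrite mulr_ge0 ?Cmod_ge0// (le_trans ler01) ?annulus_cst_ge1.
Qed.

(** The difference of the values at [x] and [y] is [x - y] times
    [1 + laurent_divdiff a x y]; hence the zero [y] is simple, and the only one
    in the annulus. *)
Lemma perturbation_lower a eta x y : small a eta -> annulus x -> annulus y ->
  1 + y + laurent a y = 0 ->
  (1 - eta) * Cmod (x - y) <= Cmod (1 + x + laurent a x).
Proof.
move=> sa dx dy hy.
have -> : 1 + x + laurent a x = (x - y) * (1 + laurent_divdiff a x y).
  by rewrite mulrDr mulr1 -laurentB ?annulus_neq0// -[LHS]subr0 -hy; ring.
rewrite CmodM mulrC ler_wpM2l ?Cmod_ge0//.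
have := Cmod_sub_ge 1 (- laurent_divdiff a x y); rewrite opprK Cmod1 CmodN.
have := laurent_divdiff_le sa dx dy; lra.
Qed.

Lemma perturbation_inj a eta x y : eta < 1 -> small a eta ->
  annulus x -> annulus y ->
  1 + x + laurent a x = 0 -> 1 + y + laurent a y = 0 -> x = y.
Proof.
move=> e1 sa dx dy hx hy.
have := perturbation_lower sa dx dy hy; rewrite hx Cmod0 => h.
apply/eqP; rewrite -subr_eq0 -Cmod_eq0 eq_le Cmod_ge0 andbT.
by have := Cmod_ge0 (x - y); nra.
Qed.

Lemma perturbation_near a eta x : small a eta -> annulus x ->
  1 + x + laurent a x = 0 -> Cmod (x + 1) <= eta.
Proof.
move=> sa dx hx; have -> : x + 1 = - laurent a x by rewrite addrC; apply/eqP; rewrite -addr_eq0 hx.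
by rewrite CmodN (laurent_le sa).
Qed.

Definition exp_bound : nat := (\sum_(i <- r) `|e i|)%N.

(** Multiplication by a power of [x] turns Laurent polynomials into
    polynomials. *)
Definition laurent_poly a : {poly C} :=
  \sum_(i <- r) (a i) *: 'X^(`|(exp_bound%:Z + e i)%R|).

Definition clear_poly a : {poly C} := 'X^exp_bound * (1 + 'X) + laurent_poly a.

Lemma exp_bound_ge i : i \in r -> 0 <= exp_bound%:Z + e i.
Proof.
move=> ir; rewrite /exp_bound (perm_big _ (perm_to_rem ir)) big_cons /=.
move: (\sum_(j <- _) _)%N => u; lia.
Qed.

Lemma exp_bound_le i : i \in r -> (`|(exp_bound%:Z + e i)%R| <= exp_bound.*2)%N.
Proof.
move=> ir; rewrite /exp_bound (perm_big _ (perm_to_rem ir)) big_cons /=.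
by move: (\sum_(j <- _) _)%N => u; lia.
Qed.

Lemma laurent_polyE a x : x != 0 -> (laurent_poly a).[x] = x ^+ exp_bound * laurent a x.
Proof.
move=> x0; rewrite /laurent_poly /laurent horner_sum mulr_sumr big_seq [RHS]big_seq.
apply: eq_bigr => i ir; rewrite hornerZ hornerXn mulrCA; congr (_ * _).
by rewrite [in LHS]exprnP (gez0_abs (exp_bound_ge ir)) expfzDr// -exprnP.
Qed.

Lemma clear_polyE a x : x != 0 ->
  (clear_poly a).[x] = x ^+ exp_bound * (1 + x + laurent a x).
Proof.
move=> x0; rewrite /clear_poly hornerD laurent_polyE// [RHS]mulrDr; congr (_ + _).
by rewrite -polyC1 !(hornerD, hornerM, hornerXn, hornerX, hornerC).
Qed.

Lemma size_clear_poly a : (size (clear_poly a) <= exp_bound.*2.+2)%N.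
Proof.
rewrite /clear_poly /laurent_poly; apply: leq_trans (size_polyD _ _) _; rewrite geq_max; apply/andP; split.
  apply: leq_trans (size_polyMleq _ _) _; rewrite size_polyXn /=.
  have : (size ((1 + 'X)%R : {poly C}) <= 2)%N.
    by rewrite addrC -polyC1 size_XaddC.
  by move: (size _); lia.
rewrite big_seq; elim/big_rec: _ => [|i P ir sP]; first by rewrite size_poly0.
apply: leq_trans (size_polyD _ _) _; rewrite geq_max sP andbT.
apply: leq_trans (size_scale_leq _ _) _; rewrite size_polyXn.
by have := exp_bound_le ir; lia.
Qed.

(** With [E = exp_bound], the polynomial below has degree at most [2 E + 1], so
    by [poly_growth] it grows by at most [2^(2 E + 1)] from [-1] to [-3/4], while
    its value at [-3/4] is at least [2^-E / 8]. *)
Definition root_threshold : R := 2^-1 ^+ (exp_bound * 3 + 5).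

Lemma root_threshold_gt0 : 0 < root_threshold. Proof. by rewrite exprn_gt0. Qed.
Lemma root_threshold_le : root_threshold <= 16^-1.
Proof.
apply: le_trans (_ : 2^-1 ^+ 5 <= _); last by rewrite !exprS expr0; lra.
by rewrite /root_threshold exprD -[leRHS]mul1r ler_wpM2r// ?exprn_ge0// exprn_ile1//; lra.
Qed.

Lemma perturbation_root a eta : eta < root_threshold -> small a eta ->
  exists2 x, Cmod (x + 1) <= 2^-1 & 1 + x + laurent a x = 0.
Proof.
have arith (u v' : R) : 4^-1 - v' <= u -> v' <= eta -> eta < 16^-1 -> 8^-1 <= u.
  by lra.
have q32 : 0 <= 1 + 4^-1 / 2^-1 :> R by lra.
have q32' : 1 + 4^-1 / 2^-1 <= 2 :> R by lra.
have q14 : 4^-1 <= 2^-1 :> R by lra.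
have sz : ((size (clear_poly a)).-1 <= exp_bound.*2.+1)%N.
  by have := size_clear_poly a; lia.
move=> he sa; have eta16 := lt_le_trans he root_threshold_le.
have key : 2 ^+ exp_bound.*2.+1 * eta < 2^-1 ^+ exp_bound * 8^-1 :> R.
  have -> : 2^-1 ^+ exp_bound * 8^-1 = 2 ^+ exp_bound.*2.+1 * (2 * root_threshold) :> R.
    have -> : root_threshold = (2^-1 ^+ exp_bound) ^+ 3 * 2^-1 ^+ 5 :> R.
      by rewrite /root_threshold exprD exprM.
    have -> : 2 ^+ exp_bound.*2.+1 = 2 * (2 ^+ exp_bound) ^+ 2 :> R.
      by rewrite exprS -exprM muln2.
    have u0 : 2 ^+ exp_bound != 0 :> R by rewrite expf_neq0.
    rewrite !exprVn; move: (2 ^+ exp_bound) u0 => u u0.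
    by rewrite !exprS expr0; field.
  rewrite ltr_pM2l ?exprn_gt0// mulrC mulr_natr mulr2n; apply: lt_le_trans he _.
  by rewrite lerDl ltW// root_threshold_gt0.
clear he; apply: contrapT => no.
have norm12 : 2^-1 <= 1 :> R by lra.
have dm1 : annulus (-1).
  by apply: annulus_near; rewrite addNr Cmod0 invr_ge0.
set y : C := - (3 / 4 : R)%:C%C.
have y1 : Cmod (y + 1) = 4^-1.
  have -> : y + 1 = (4^-1 : R)%:C%C.
    have -> : 1 = (1 : R)%:C%C :> C by [].
    by rewrite /y -rmorphN -rmorphD; congr (_ %:C)%C; lra.
  by rewrite ge0_CmodC// invr_ge0.
have dy : annulus y by apply: annulus_near; rewrite y1.
have half0 : 0 < 2^-1 :> R by rewrite invr_gt0.
have far z : root (clear_poly a) z -> 2^-1 <= Cmod (-1 - z).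
   rewrite leNgt /root => hz; apply/negP => h; apply: no.
  have h' : Cmod (z + 1) <= 2^-1.
    by rewrite -CmodN opprD addrC ltW.
  exists z => //; have z0 := annulus_neq0 (annulus_near h').
  by move: hz; rewrite clear_polyE// mulf_eq0 expf_eq0 (negPf z0) andbF => /eqP.
have := poly_growth y half0 far; rewrite opprK y1 !clear_polyE ?annulus_neq0//.
rewrite subrr add0r !CmodM !CmodX (CmodN 1) Cmod1 expr1n mul1r.
have hN := laurent_le sa dm1; have hNy := laurent_le sa dy.
have hG : 8^-1 <= Cmod (1 + y + laurent a y).
  have := Cmod_sub_ge (1 + y) (- laurent a y); rewrite opprK CmodN [1 + y]addrC y1.
  by move=> /arith; apply => //; exact: eta16.
have hy : 2^-1 <= Cmod y by case/andP: dy.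
have hyn : 2^-1 ^+ exp_bound <= Cmod y ^+ exp_bound.
  by rewrite lerXn2r ?nnegrE ?invr_ge0 ?Cmod_ge0.
have L : 2^-1 ^+ exp_bound * 8^-1 <= Cmod y ^+ exp_bound * Cmod (1 + y + laurent a y).
  by rewrite ler_pM ?exprn_ge0 ?invr_ge0.
have U : (1 + 4^-1 / 2^-1) ^+ (size (clear_poly a)).-1 * Cmod (laurent a (-1)) <=
   2 ^+ exp_bound.*2.+1 * eta :> R.
  apply: (ler_pM _ _ _ hN); [exact: exprn_ge0|exact: Cmod_ge0|].
  apply: le_trans (_ : 2 ^+ (size (clear_poly a)).-1 <= _).
    by apply: lerXn2r q32'; rewrite ?nnegrE.
  by apply: ler_weXn2l sz; rewrite ler1n.
move=> H; have := le_lt_trans (le_trans (le_trans L H) U) key.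
by rewrite ltxx.
Qed.

End Equation.
End Perturbation.

(** * Logarithmic derivatives *)
Section Limits.
Variable R : realType.
Local Notation C := R[i].

(** A bundled name for the field, so that the limit laws of normed fields apply
    to complex-valued functions. *)
Definition Cfield : numFieldType := C.

(** Limits at 0, without the value at 0: all limits below are those of difference
    quotients. *)
Definition Clim (f : R -> C) (l : C) : Prop :=
  (f : R -> Cfield) @ (0 : R)^' --> (l : Cfield).

Lemma ClimP f l : Clim f l <->
  forall e : R, 0 < e -> \forall h \near (0 : R)^', Cmod (f h - l) < e.
Proof.
split.
  move=> /cvgrPdist_lt H e e0.
  have e0' : (0 : Cfield) < e%:C%C by rewrite ltcR.
  apply: filterS (H _ e0') => h.
  have -> : `|(l : Cfield) - f h| = (Cmod (l - f h))%:C%C by rewrite CmodE.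
  by rewrite ltcR CmodB.
move=> H; apply/cvgrPdist_lt => e e0.
have eE : e = (complex.Re (e : C))%:C%C.
  by move: e0; case: e => a b; rewrite ltcE /= => /andP[/eqP-> _].
have e0' : 0 < complex.Re (e : C) by move: e0; rewrite eE ltcR.
apply: filterS (H _ e0') => h fh.
have -> : `|(l : Cfield) - f h| = (Cmod (l - f h))%:C%C by rewrite CmodE.
by rewrite eE ltcR CmodB.
Qed.

Lemma ClimD f g a b : Clim f a -> Clim g b -> Clim (fun h => f h + g h) (a + b).
Proof. exact: (@cvgD _ Cfield). Qed.

Lemma ClimN f a : Clim f a -> Clim (fun h => - f h) (- a).
Proof. exact: (@cvgN _ Cfield). Qed.

Lemma ClimB f g a b : Clim f a -> Clim g b -> Clim (fun h => f h - g h) (a - b).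
Proof. exact: (@cvgB _ Cfield). Qed.

Lemma ClimM f g a b : Clim f a -> Clim g b -> Clim (fun h => f h * g h) (a * b).
Proof. exact: (@cvgM Cfield). Qed.

Lemma ClimV f a : a != 0 -> Clim f a -> Clim (fun h => (f h)^-1) a^-1.
Proof. exact: (@cvgV Cfield). Qed.

Lemma Clim_cst a : Clim (fun=> a) a.
Proof. exact: (@cvg_cst Cfield). Qed.
Arguments Clim_cst a : clear implicits.

Lemma ClimX f a n : Clim f a -> Clim (fun h => f h ^+ n) (a ^+ n).
Proof.
move=> fa; elim: n => [|n IH].
  rewrite expr0; under [X in Clim X]funext do rewrite expr0; exact: Clim_cst.
rewrite exprS; under [X in Clim X]funext do rewrite exprS.
exact: (ClimM fa IH).
Qed.

Lemma Clim_sum (I : Type) (r : seq I) (f : I -> R -> C) (a : I -> C) :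
  (forall i, Clim (f i) (a i)) ->
  Clim (fun h => \sum_(i <- r) f i h) (\sum_(i <- r) a i).
Proof.
move=> H; elim: r => [|i r IH].
  rewrite big_nil; under [X in Clim X]funext do rewrite big_nil; exact: Clim_cst.
rewrite big_cons; under [X in Clim X]funext do rewrite big_cons.
exact: (ClimD (H i) IH).
Qed.

Lemma Clim_squeeze f l (g : R -> C) (c : R) : 0 <= c -> Clim g 0 ->
  (forall h, Cmod (f h - l) <= c * Cmod (g h)) -> Clim f l.
Proof.
move=> c0 /ClimP g0 fg; apply/ClimP => e e0.
have e1 : 0 < e / (c + 1) by rewrite divr_gt0//; lra.
apply: filterS (g0 _ e1) => h; rewrite subr0 => gh.
apply: le_lt_trans (fg h) _; rewrite ltr_pdivlMr in gh; last lra.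
by have := Cmod_ge0 (g h); nra.
Qed.

Lemma eq_Clim f g l : (forall h, h != 0 -> f h = g h) -> Clim f l -> Clim g l.
Proof.
move=> fg /ClimP H; apply/ClimP => e e0.
near=> h; rewrite -fg; first by near: h; apply: H.
by near: h; exact: nbhs_dnbhs_neq.
Unshelve. all: by end_near. Qed.

Lemma Clim_Re f l : Clim f l ->
  (fun h => complex.Re (f h)) @ (0 : R)^' --> complex.Re l.
Proof.
move=> /ClimP H; apply/cvgrPdist_lt => e e0; apply: filterS (H _ e0) => h.
apply: le_lt_trans; rewrite distrC -raddfB; exact: Re_le_Cmod.
Qed.

Lemma Clim_Im f l : Clim f l ->
  (fun h => complex.Im (f h)) @ (0 : R)^' --> complex.Im l.
Proof.
move=> /ClimP H; apply/cvgrPdist_lt => e e0; apply: filterS (H _ e0) => h.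
apply: le_lt_trans; rewrite distrC -raddfB; exact: Im_le_Cmod.
Qed.

Lemma Clim_ReIm f l :
  (fun h => complex.Re (f h)) @ (0 : R)^' --> complex.Re l ->
  (fun h => complex.Im (f h)) @ (0 : R)^' --> complex.Im l -> Clim f l.
Proof.
move=> /cvgrPdist_lt H1 /cvgrPdist_lt H2; apply/ClimP => e e0.
have e2 : 0 < e / 2 by lra.
near=> h; apply: le_lt_trans (Cmod_le_ReIm _) _.
have h1 : `|complex.Re l - complex.Re (f h)| < e / 2 by near: h; exact: H1.
have h2 : `|complex.Im l - complex.Im (f h)| < e / 2 by near: h; exact: H2.
by rewrite !raddfB /= distrC [X in _ + X]distrC; lra.
Unshelve. all: by end_near. Qed.

(** [w] is the ratio of a function along a line to its value at the base point,
    and [a] is the logarithmic derivative of that function. *)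
Definition dlog (w : R -> C) (a : C) : Prop :=
  Clim w 1 /\ Clim (fun h => (h^-1)%:C%C * (w h - 1)) a.

Lemma dlog_slope (u : R -> C) a : Clim (fun h => (h^-1)%:C%C * (u h - 1)) a -> dlog u a.
Proof.
move=> s; split; last exact: s.
have id0 : Clim (fun h : R => h%:C%C) 0.
  apply/ClimP => e e0; near=> h; rewrite subr0 CmodC.
  by near: h; exact: dnbhs0_lt.
have := ClimD (ClimM id0 s) (Clim_cst (1 : C)); rewrite mul0r add0r.
by apply: eq_Clim => h h0; rewrite mulrA -rmorphM divff// mul1r subrK.
Unshelve. all: by end_near. Qed.

Lemma dlog_cst : dlog (fun=> 1) 0.
Proof.
split; first exact: Clim_cst.
by under [X in Clim X]funext do rewrite subrr mulr0; exact: Clim_cst.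
Qed.

Lemma dlogM u v a b : dlog u a -> dlog v b -> dlog (fun h => u h * v h) (a + b).
Proof.
move=> [u1 ua] [v1 vb]; split; first by rewrite -[X in Clim _ X]mulr1; exact: ClimM.
have := ClimD (ClimM ua v1) vb; rewrite mulr1; apply: eq_Clim => h _; ring.
Qed.

Lemma dlogV u a : (forall h, u h != 0) -> dlog u a ->
  dlog (fun h => (u h)^-1) (- a).
Proof.
move=> u0 [u1 ua].
have uV : Clim (fun h => (u h)^-1) 1.
  by have := ClimV (oner_neq0 C) u1; rewrite invr1.
split; first exact: uV.
have := ClimN (ClimM ua uV); rewrite mulr1; apply: eq_Clim => h _.
by move: (h^-1)%:C%C => c; field; rewrite u0.
Qed.

Lemma dlogX u a n : dlog u a -> dlog (fun h => u h ^+ n) (n%:R * a).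
Proof.
move=> ua; elim: n => [|n IH].
  under [X in dlog X]funext do rewrite expr0.
  by rewrite mul0r; exact: dlog_cst.
under [X in dlog X]funext do rewrite exprS.
by rewrite -natr1 mulrDl mul1r addrC; exact: dlogM.
Qed.

Lemma dlogZ u a (e : int) : (forall h, u h != 0) -> dlog u a ->
  dlog (fun h => u h ^ e) (e%:~R * a).
Proof.
move=> u0 ua; case: e => n; first exact: dlogX.
rewrite NegzE mulrNz mulNr; under [X in dlog X]funext do rewrite -exprnN.
by apply: dlogV (dlogX _ _) => // h; rewrite expf_neq0.
Qed.

Lemma dlog_prod (I : Type) (r : seq I) (u : I -> R -> C) (a : I -> C) :
  (forall i, dlog (u i) (a i)) ->
  dlog (fun h => \prod_(i <- r) u i h) (\sum_(i <- r) a i).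
Proof.
move=> H; elim: r => [|i r IH].
  by rewrite big_nil; under [X in dlog X]funext do rewrite big_nil; exact: dlog_cst.
rewrite big_cons; under [X in dlog X]funext do rewrite big_cons.
exact: (dlogM (H i) IH).
Qed.

Lemma dlog_Cexpi (c : R) : dlog (fun h => Cexpi (c * h)) (0 +i* c)%C.
Proof.
have d1 : is_derive (0 : R) (1 : R) (fun h => cos (c * h)) 0.
  by apply: is_derive_eq; rewrite mulr0 sin0 /GRing.scale /=; ring.
have d2 : is_derive (0 : R) (1 : R) (fun h => sin (c * h)) c.
  by apply: is_derive_eq; rewrite mulr0 cos0 /GRing.scale /=; ring.
have q (f : R -> R) l : is_derive (0 : R) (1 : R) f l ->
    (fun h => h^-1 * (f h - f 0)) @ (0 : R)^' --> l.
  move=> df; have := @ex_derive _ _ _ _ _ _ _ df.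
  rewrite /derivable -[in X in _ -> X](@derive_val _ _ _ _ _ _ _ df) /derive.
  by under eq_fun do rewrite /= /GRing.scale /= mulr1 addr0.
apply/dlog_slope/Clim_ReIm => /=.
    have := q _ _ d1; rewrite mulr0 cos0; under [X in X @ _ --> _ -> _]eq_fun do rewrite -[_ * _]subr0.
    by under [X in _ -> X @ _ --> _]eq_fun do rewrite mul0r.
  have := q _ _ d2; rewrite mulr0 sin0; under [X in X @ _ --> _ -> _]eq_fun do rewrite -[_ * _]addr0.
  by under [X in _ -> X @ _ --> _]eq_fun do rewrite mul0r.
Qed.

(** The monomial chart is multiplicative, so its partial derivatives are most
    easily found as logarithmic ones. *)
Lemma Cpartial_dlog (n : nat) (g : 'rV[R]_n.+1 -> C) (j : 'I_n.+1) s a :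
  g s != 0 -> dlog (fun h => g (h *: delta_mx 0 j + s) / g s) a ->
  Cpartial g j s / g s = a.
Proof.
move=> gs [_ ga].
have H : Clim (fun h => (h^-1)%:C%C * (g (h *: delta_mx 0 j + s) - g s)) (a * g s).
  have := ClimM ga (Clim_cst (g s)); apply: eq_Clim => h _.
  by rewrite -mulrA mulrBl mul1r divfK.
apply: (canLR (mulfK gs)); rewrite /Cpartial /derive.
have -> : a * g s = (complex.Re (a * g s) +i* complex.Im (a * g s))%C by case: (a * g s).
congr (_ +i* _)%C; apply: cvg_lim => //.
  rewrite (_ : (fun h => _) =
    fun h => complex.Re ((h^-1)%:C%C * (g (h *: delta_mx 0 j + s) - g s))).
    exact: Clim_Re H.
  apply/funext => h /=.
  by rewrite /GRing.scale /=; case: (g _); case: (g s) => * /=; rewrite mul0r subr0.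
rewrite (_ : (fun h => _) =
  fun h => complex.Im ((h^-1)%:C%C * (g (h *: delta_mx 0 j + s) - g s))).
  exact: Clim_Im H.
apply/funext => h /=.
by rewrite /GRing.scale /=; case: (g _); case: (g s) => * /=; rewrite mul0r addr0.
Qed.

(** ** Implicit differentiation *)

Lemma Clim_divdiff e (f : R -> C) l : l != 0 -> Clim f l ->
  Clim (fun h => exp_divdiff e (f h) l) (exp_divdiff e l l).
Proof.
move=> l0 fl.
have S n : Clim (fun h => \sum_(i < n) f h ^+ (n.-1 - i) * l ^+ i)
    (\sum_(i < n) l ^+ (n.-1 - i) * l ^+ i).
  rewrite -!big_enum; under [X in Clim X]funext do rewrite -big_enum.
  by apply: Clim_sum => i; apply: ClimM (Clim_cst _); exact: ClimX.
case: e => n; first exact: S.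
rewrite /exp_divdiff; apply: ClimM; last exact: (S n.+1).
apply: ClimN; apply: ClimV; first by rewrite expf_neq0// mulf_neq0.
by apply: ClimX; apply: ClimM fl (Clim_cst _).
Qed.

(** Subtracting the equations at [h] and at 0 gives
    [(s h - s 0) (1 + D h) = - dN h], where [D h] is a divided difference in [s],
    bounded by [eta], and [dN h] only sees the change of the coefficients.  This
    yields first the continuity of [s] at 0, then that of [D], and finally the
    limit of the difference quotient. *)
Lemma implicit_derivative (I : eqType) (r : seq I) (e : I -> int) (a : I -> C)
    (k : I -> R) (eta : R) (s : R -> C) :
  eta <= 2^-1 -> small r e a eta ->
  (forall h, annulus (s h)) ->
  (forall h, 1 + s h + laurent r e (fun i => a i * Cexpi (k i * h)) (s h) = 0) ->
  exists L, Clim (fun h => (h^-1)%:C%C * (s h - s 0)) L.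
Proof.
move=> eta2 sa ds sE.
pose ah h i := a i * Cexpi (k i * h).
have sah h : small r e (ah h) eta.
  by rewrite /small; under eq_bigr do rewrite CmodM Cmod_Cexpi mulr1.
have s0 h : s h != 0 by apply: annulus_neq0.
pose D h := laurent_divdiff r e (ah h) (s h) (s 0).
pose dN h := \sum_(i <- r) (a i * (Cexpi (k i * h) - 1)) * s 0 ^ e i.
have key h : (s h - s 0) * (1 + D h) = - dN h.
  have h1 := sE h; have h2 := sE 0.
  have h3 : laurent r e (ah h) (s h) - laurent r e (ah h) (s 0) = (s h - s 0) * D h.
    by apply: laurentB.
  have h4 : dN h = laurent r e (ah h) (s 0) - laurent r e (ah 0) (s 0).
    rewrite /dN /laurent -sumrB; apply: eq_bigr => i _.
    by rewrite /ah mulr0 Cexpi0; ring.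
  rewrite h4 mulrDr mulr1 -h3.
  have alg (u v x y z : C) : 1 + u + x = 0 -> 1 + v + z = 0 ->
      u - v + (x - y) = - (y - z).
    by move=> e1 e2; rewrite -[RHS]addr0 -[RHS]subr0 -{1}e1 -e2; ring.
  exact: (alg (s h) (s 0) (laurent r e (ah h) (s h)) (laurent r e (ah h) (s 0))
    (laurent r e (ah 0) (s 0)) h1 h2).
have D2 h : 2^-1 <= Cmod (1 + D h).
  have := Cmod_sub_ge 1 (- D h); rewrite opprK Cmod1 CmodN.
  have := laurent_divdiff_le (sah h) (ds h) (ds 0); rewrite -/(D h); lra.
have D0 h : 1 + D h != 0 by rewrite -Cmod_gt0; apply: lt_le_trans (D2 h); rewrite invr_gt0.
have E h : s h - s 0 = - dN h / (1 + D h) by rewrite -key mulfK.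
have [dNl dN0] : (exists l, Clim (fun h => (h^-1)%:C%C * dN h) l) /\ Clim dN 0.
  split.
    exists (\sum_(i <- r) a i * (0 +i* k i)%C * s 0 ^ e i).
    apply: (@eq_Clim (fun h => \sum_(i <- r) a i * ((h^-1)%:C%C * (Cexpi (k i * h) - 1)) * s 0 ^ e i)).
      by move=> h _; rewrite /dN mulr_sumr; apply: eq_bigr => i _; ring.
    apply: Clim_sum => i; apply: ClimM (Clim_cst _); apply: ClimM (Clim_cst _) _.
    exact: (dlog_Cexpi (k i)).2.
  have -> : 0 = \sum_(i <- r) a i * (1 - 1) * s 0 ^ e i :> C.
    by rewrite big1// => i _; ring.
  apply: Clim_sum => i; apply: ClimM (Clim_cst _); apply: ClimM (Clim_cst _) _.
  by apply: ClimB (dlog_Cexpi (k i)).1 (Clim_cst 1).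
have sl : Clim s (s 0).
  apply: (@Clim_squeeze _ _ dN 2) => // h.
  rewrite E CmodM CmodN CmodV mulrC ler_wpM2r ?Cmod_ge0//.
  rewrite -[leRHS]invrK lef_pV2 ?posrE ?invr_gt0 ?Cmod_gt0//.
have aCl i : Clim (fun h => ah h i) (a i).
  rewrite -[X in Clim _ X]mulr1; apply: ClimM (Clim_cst _) _.
  exact: (dlog_Cexpi (k i)).1.
have Dl : Clim D (laurent_divdiff r e a (s 0) (s 0)).
  apply: Clim_sum => i; apply: ClimM (aCl i) _; exact: Clim_divdiff.
case: dNl => l dNl; exists (- l / (1 + laurent_divdiff r e a (s 0) (s 0))).
have D00 : 1 + laurent_divdiff r e a (s 0) (s 0) != 0.
  have := D0 0; rewrite /D; congr (1 + _ != 0); apply: eq_bigr => i _.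
  by rewrite /ah mulr0 Cexpi0 mulr1.
have := ClimM (ClimN dNl) (ClimV D00 (ClimD (Clim_cst (1 : C)) Dl)).
by apply: eq_Clim => h _; rewrite E; ring.
Qed.

End Limits.
Arguments Clim_cst : clear implicits.
Arguments Clim_cst {R} a.

(** * The size of a convergent Puiseux series near the origin *)
Section PuiseuxBounds.
Variable R : realType.
Local Notation C := R[i].

Lemma geometric_tail (q : R) n0 m : 0 <= q <= 2^-1 ->
  \sum_(i < m) q ^+ (n0 + i) <= 2 * q ^+ n0 * (1 - 2^-1 ^+ m).
Proof.
move=> /andP[q0 q2]; elim: m => [|m IH].
  by rewrite big_ord0 expr0 subrr mulr0.
rewrite big_ord_recr /= exprD.
have h : q ^+ m <= 2^-1 ^+ m by rewrite lerXn2r ?nnegrE.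
have h0 : 0 <= q ^+ n0 by rewrite exprn_ge0.
have h2 := ler_wpM2l h0 h.
rewrite exprS; move: IH h2; move: (\sum_(i < m) _) (q ^+ n0) (q ^+ m) (2^-1 ^+ m) => S u w x.
by lra.
Qed.

Lemma lim_within (u : R^nat) (b B : R) n0 : cvgn u ->
  (forall n, (n0 <= n)%N -> `|u n - b| <= B) -> `|limn u - b| <= B.
Proof.
move=> cu uB; apply/ler_addgt0Pr => e e0.
have /cvgrPdist_le/(_ _ e0)[N _ hN] := cu.
have h1 := hN (maxn N n0) (leq_maxl _ _).
have h2 := uB (maxn N n0) (leq_maxr _ _).
rewrite -(subrKA (u (maxn N n0))); apply: le_trans (ler_normD _ _) _.
by rewrite addrC lerD.
Qed.

(** Convergence at one positive point bounds the terms by a geometric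
    sequence. *)
Lemma powerseries_tail (a : nat -> C) (r : R) n0 : 0 < r ->
  (forall s : C, Cmod s < r -> Ccvg_series (fun j => a j * s ^+ j)) ->
  exists M d : R, [/\ 0 < M, 0 < d & forall s : R, 0 <= s <= d ->
    Cmod (Cseries (fun j => a j * (s ^+ j)%:C%C) -
          \sum_(j < n0) a j * (s ^+ j)%:C%C) <= M * s ^+ n0].
Proof.
move=> r0 ha; pose s1 := r / 2; have s10 : 0 < s1 by rewrite divr_gt0.
have [K K0 hK] : exists2 K : R, 0 < K & forall j, Cmod (a j) * s1 ^+ j <= K.
  have [c1 c2] : Ccvg_series (fun j => a j * s1%:C%C ^+ j).
    by apply: ha; rewrite ge0_CmodC ?ltW// /s1; lra.
  have [M1 [_ B1]] := cvg_seq_bounded (cvgP _ (cvg_series_cvg_0 c1)).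
  have [M2 [_ B2]] := cvg_seq_bounded (cvgP _ (cvg_series_cvg_0 c2)).
  exists (`|M1| + 1 + (`|M2| + 1)) => [|j]; first by rewrite addr_gt0// ltr_wpDl.
  have -> : Cmod (a j) * s1 ^+ j = Cmod (a j * s1%:C%C ^+ j).
    by rewrite CmodM CmodX ge0_CmodC ?ltW.
  apply: le_trans (Cmod_le_ReIm _) _; apply: lerD.
    by apply: B1; rewrite ?ltr_pwDr// ?ler_norm.
  by apply: B2; rewrite ?ltr_pwDr// ?ler_norm.
exists (2 * (2 * K / s1 ^+ n0)), (s1 / 2); split.
- by rewrite mulr_gt0// divr_gt0 ?exprn_gt0// mulr_gt0.
- by rewrite divr_gt0.
move=> s /andP[s0 sd].
have [c1 c2] : Ccvg_series (fun j => a j * (s ^+ j)%:C%C).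
  have := ha s%:C%C; rewrite ge0_CmodC//.
  under [X in _ -> Ccvg_series X]funext do rewrite rmorphXn.
  by apply; move: sd; rewrite /s1; lra.
pose q := s / s1.
have q12 : 0 <= q <= 2^-1.
  apply/andP; split; first by rewrite divr_ge0 // ltW.
  by rewrite /q ler_pdivrMr//; lra.
have bnd n : (n0 <= n)%N -> Cmod (\sum_(j < n) a j * (s ^+ j)%:C%C -
     \sum_(j < n0) a j * (s ^+ j)%:C%C) <= 2 * K / s1 ^+ n0 * s ^+ n0.
  move=> n0n; rewrite -(subnKC n0n) big_split_ord /= addrAC subrr add0r.
  apply: le_trans (Cmod_sum_le _ _ _) _.
  apply: le_trans (_ : K * \sum_(i < n - n0) q ^+ (n0 + i) <= _).
    rewrite mulr_sumr; apply: ler_sum => i _.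
    rewrite CmodM ge0_CmodC ?exprn_ge0// /q expr_div_n [leRHS]mulrA.
    by rewrite ler_pdivlMr ?exprn_gt0// mulrAC ler_wpM2r ?exprn_ge0.
  have := geometric_tail n0 (n - n0) q12.
  have -> : 2 * K / s1 ^+ n0 * s ^+ n0 = K * (2 * q ^+ n0).
    by rewrite /q (expr_div_n s s1); move: (s ^+ n0) (s1 ^+ n0)^-1 => u w; ring.
  move=> h; rewrite ler_pM2l//; apply: le_trans h _.
  have q0 : 0 <= q ^+ n0 by rewrite exprn_ge0//; case/andP: q12.
  apply: ler_piMr; first by rewrite mulr_ge0.
  by rewrite gerBl exprn_ge0 // invr_ge0.
apply: le_trans (Cmod_le_ReIm _) _.
have -> : 2 * (2 * K / s1 ^+ n0) * s ^+ n0 =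
  2 * K / s1 ^+ n0 * s ^+ n0 + 2 * K / s1 ^+ n0 * s ^+ n0 by ring.
rewrite !raddfB /=; apply: lerD; apply: (lim_within (n0 := n0)) => // n n0n;
  apply: le_trans (bnd n n0n).
- apply: le_trans (Re_le_Cmod _); rewrite raddfB /= seriesEord /=.
  by rewrite [complex.Re (\sum_(j < n) _)]raddf_sum.
- apply: le_trans (Im_le_Cmod _); rewrite raddfB /= seriesEord /=.
  by rewrite [complex.Im (\sum_(j < n) _)]raddf_sum.
Qed.

(** The leading index exists because only finitely many indices are negative. *)
Lemma pord_spec (k : puiseux R) : pnonzero k ->
  pcoef k (pord k) != 0 /\ forall i, pcoef k i != 0 -> pord k <= i.
Proof.
move=> [j0 hj0].
suff: exists j, pcoef k j != 0 /\ forall i, pcoef k i != 0 -> j <= i.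
  by move=> h; exact: (xgetPex 0 h).
have fin := pcoef_neg k; pose F := fset_set [set j : int | j < 0 /\ pcoef k j != 0].
pose B := (\sum_(j <- F) `|j|)%N.
have HB j : pcoef k j != 0 -> 0 <= j + B%:Z.
  move=> hj; have [|j0'] := leP 0 j; first by lia.
  have jF : j \in F by rewrite in_fset_set//; apply: mem_set.
  rewrite /B (big_fsetD1 j)//=; lia.
have ex : exists n : nat, pcoef k (n%:Z - B%:Z) != 0.
  exists `|(j0 + B%:Z)%R|%N; rewrite gez0_abs ?HB// addrK//.
case: (ex_minnP ex) => n hn nmin; exists (n%:Z - B%:Z); split=> // i hi.
have := nmin `|(i + B%:Z)%R|%N; rewrite gez0_abs ?HB// addrK => /(_ hi).
by have := HB i hi; lia.
Qed.

Lemma pterm_root (k : puiseux R) (t : R) j : 0 < t ->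
  pterm k t j = pcoef k j * ((t `^ (pden k)%:R^-1) ^ j)%:C%C.
Proof.
move=> t0; rewrite /pterm; congr (_ * _%:C)%C.
by rewrite mulrC powRrM powR_intmul ?powR_ge0.
Qed.

Lemma ler_wiexpz (s : R) (i j : int) : 0 < s <= 1 -> i <= j -> s ^ j <= s ^ i.
Proof.
move=> /andP[s0 s1] ij; have -> : j = i + (j - i) by lia.
rewrite expfzDr ?gt_eqF// -[leRHS]mulr1 ler_wpM2l ?exprz_ge0 ?(ltW s0)//.
have -> : j - i = `|j - i|%N%:Z by lia.
by rewrite -exprnP exprn_ile1 // ltW.
Qed.

(** Beyond the leading term there are finitely many terms of negative index and
    the tail of a power series in [s = t^(1/n)]; each is of order [s^(J + 1)],
    where [J] is the leading index. *)
Lemma peval_leading (k : puiseux R) : pnonzero k ->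
  exists M d : R, [/\ 0 < M, 0 < d & forall t : R, 0 < t ->
    let s := t `^ (pden k)%:R^-1 in s <= d ->
    Cmod (peval k t - pcoef k (pord k) * (s ^ pord k)%:C%C) <= M * s ^ (pord k + 1)].
Proof.
move=> /pord_spec [cJ minJ]; set J := pord k in cJ minJ *.
(* The power series is cut after its leading term, or before its first term if
   the leading term has negative index. *)
pose n0 := if J is Posz j then j.+1 else 0%N.
have [r r0 hr] := pcoef_cvg k.
have [M [d [M0 d0 hM]]] := powerseries_tail n0 r0 hr.
have fin := pcoef_neg k; pose F := fset_set [set j : int | j < 0 /\ pcoef k j != 0].
pose M' := \sum_(j <- F) Cmod (pcoef k j).
have M'0 : 0 <= M' by apply: sumr_ge0 => j _; exact: Cmod_ge0.
exists (M + M'), (Num.min d 1); split; first by rewrite ltr_wpDr.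
  by rewrite lt_min d0 ltr01.
move=> t t0 s; rewrite le_min => /andP[sd s1].
have s0 : 0 < s by rewrite powR_gt0.
have pE j : pterm k t j = pcoef k j * (s ^ j)%:C%C by apply: pterm_root.
have s01 : 0 < s <= 1 by rewrite s0.
have hs : Cmod (Cseries (fun j : nat => pterm k t j%:Z) -
   \sum_(j < n0) pterm k t (j : nat)%:Z) <= M * s ^+ n0.
  have := hM s; rewrite ltW//= => /(_ sd).
  have -> : (fun j : nat => pterm k t j%:Z) = (fun j => pcoef k j * (s ^+ j)%:C%C).
    by apply/funext => j; rewrite pE -exprnP.
  by under [X in _ -> Cmod (_ - X) <= _]eq_bigr do rewrite pE -exprnP.
have FE : \sum_(j \in [set j : int | j < 0]) pterm k t j = \sum_(j <- F) pterm k t j.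
  have F0 j : j \in F -> j < 0 by rewrite in_fset_set// => /set_mem[].
  rewrite (fsbigE F) ?fset_uniq//.
    rewrite big_seq_cond [RHS]big_seq; apply: eq_bigl => j.
    by apply: andb_idr => /F0 j0; apply: mem_set.
  move=> j /= j0; rewrite in_fset_set// => /negP jF.
  have /eqP cj : pcoef k j == 0.
    by apply: contrapT => /negP h; apply: jF; apply: mem_set.
  by rewrite /pterm cj mul0r.
rewrite /peval FE -/J.
set S := Cseries _ in hs *.
have fin_tail (P : pred int) : (forall j, j \in F -> P j -> J + 1 <= j) ->
    Cmod (\sum_(j <- F | P j) pterm k t j) <= M' * s ^ (J + 1).
  move=> PJ; apply: le_trans (Cmod_sum_le _ _ _) _.
  rewrite /M' mulr_suml [leRHS](bigID P) /= ler_wpDr//; last first.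
    rewrite big_seq_cond [leRHS]big_seq_cond; apply: ler_sum => j /andP[jF Pj].
    rewrite pE CmodM ler_wpM2l ?Cmod_ge0//.
    by rewrite ge0_CmodC ?exprz_ge0 ?(ltW s0)// ler_wiexpz// PJ.
  by apply: sumr_ge0 => j _; rewrite mulr_ge0 ?Cmod_ge0 ?exprz_ge0 ?ltW.
rewrite mulrDl.
case EJ: J => [j|j].
- have F0 : \sum_(j <- F) pterm k t j = 0.
    rewrite big_seq big1// => i; rewrite in_fset_set// => /set_mem[i0 /minJ].
    by rewrite EJ; clear -i0; lia.
  have n0E : n0 = j.+1 by rewrite /n0 EJ.
  rewrite F0 add0r.
  have -> : pcoef k j * (s ^ j)%:C%C = \sum_(i < n0) pterm k t (i : nat)%:Z.
    rewrite n0E big_ord_recr /= big1 ?add0r ?pE// => i _.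
    rewrite /pterm; case: (eqVneq (pcoef k i) 0) => [->|/minJ]; first by rewrite mul0r.
    by rewrite EJ; have := ltn_ord i; clear; lia.
  apply: le_trans hs _; rewrite n0E -PoszD addn1 -exprnP lerDl.
  by rewrite mulr_ge0 ?exprn_ge0 ?(ltW s0).
- have n0E : n0 = 0%N by rewrite /n0 EJ.
  move: hs; rewrite n0E big_ord0 subr0 expr0 mulr1 => hs.
  have JF : J \in F by rewrite in_fset_set//; apply: mem_set; rewrite /= cJ EJ.
  rewrite (bigD1_seq J)//= ?fset_uniq// pE -EJ addrAC [_ + _ - _]addrAC subrr add0r addrC.
  apply: le_trans (Cmod_add_le _ _) _; apply: lerD.
    apply: le_trans hs _; rewrite ler_peMr ?(ltW M0)//.
    by rewrite -[leLHS](expr0z s) ler_wiexpz// EJ; clear; lia.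
  apply: fin_tail => i; rewrite in_fset_set// => /set_mem[_ /minJ].
  by rewrite -/J EJ; clear; lia.
Qed.

Lemma peval_bounds (k : puiseux R) : pnonzero k ->
  exists c1 c2 : R, [/\ 0 < c1, 0 < c2 & \forall t \near 0^'+,
    c1 * t `^ pval k <= Cmod (peval k t) <= c2 * t `^ pval k].
Proof.
move=> /[dup] /pord_spec[cJ _] /peval_leading[M [d [M0 d0 H]]].
set J := pord k in cJ H *; pose c := Cmod (pcoef k J).
have c0 : 0 < c by rewrite Cmod_gt0.
have n0 : 0 < (pden k)%:R^-1 :> R by rewrite invr_gt0 ltr0n pden_gt0.
exists (c / 2), (2 * c); split; [by rewrite divr_gt0|by rewrite mulr_gt0|].
have e0 : 0 < Num.min d (c / 2 / M) by rewrite lt_min d0 !divr_gt0.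
have lim := powR_cvg0 n0; near=> t.
have t0 : 0 < t by near: t; exact: nbhs_right_gt.
have ts : t `^ (pden k)%:R^-1 <= Num.min d (c / 2 / M).
  near: t; have /cvgrPdist_le/(_ _ e0) := lim; apply: filterS => t.
  by rewrite sub0r normrN ger0_norm ?powR_ge0.
have := H t t0; set s := t `^ _ in ts *; move: ts; rewrite le_min => /andP[sd sM] /(_ sd).
have s0 : 0 < s by rewrite powR_gt0.
have -> : t `^ pval k = s ^ J.
  by rewrite /pval -/J mulrC powRrM powR_intmul ?powR_ge0.
rewrite expfzDr ?gt_eqF// expr1z => hp.
have sJ : 0 < s ^ J by rewrite exprz_gt0.
have lead : Cmod (pcoef k J * (s ^ J)%:C%C) = c * s ^ J.
  by rewrite CmodM ge0_CmodC ?ltW.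
have sM' : M * (s ^ J * s) <= c / 2 * s ^ J.
  rewrite mulrCA mulrC ler_pM2r//; move: sM; rewrite ler_pdivlMr// mulrC //.
have h1 := Cmod_sub_ge (pcoef k J * (s ^ J)%:C%C) (pcoef k J * (s ^ J)%:C%C - peval k t).
have h2 := Cmod_sub_ge (peval k t) (pcoef k J * (s ^ J)%:C%C).
move: h1 h2; rewrite opprB addrCA subrr addr0 [Cmod (_ - peval k t)]CmodB lead => h1 h2.
by apply/andP; split; lra.
Unshelve. all: by end_near. Qed.

End PuiseuxBounds.

(** * Residues along small circles *)
Section CircleResidue.
Variable R : realType.
Local Notation C := R[i].

(** Splits an integer power into natural ones, so that Laurent monomials become
    quotients of polynomials. *)
Lemma expz_shift (y : C) (E : int) (n : nat) : y != 0 ->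
  let u := E + n%:Z - 1 in
  y ^ E = y ^+ `|(u + `|u|%N%:Z)%R| / y ^+ `|u| / y ^+ n * y.
Proof.
move=> y0 u; have u0 : 0 <= u + `|u|%N%:Z by lia.
rewrite exprnP [in RHS]gez0_abs// !exprnN -[X in _ * X]expr1z -!expfzDr//.
by congr (_ ^ _); rewrite /u; lia.
Qed.

(** After multiplication by powers of [y], the integrand is [S / (Q x^n)] with
    polynomials [S] and [Q], and [Q] without zeros on the discs.  The zero [Y]
    may be multiple: its multiplicity only enters [n]. *)
Lemma residue_radius_indep (I : eqType) (r : seq I) (e : I -> int) (a : I -> C)
    (l : nat) (c : C) (E : int) (Y : C) (r1 r2 : R) :
  (0 < l)%N -> laurent r e a Y = 0 -> 0 < r1 -> 0 < r2 ->
  (forall y, Cmod (y - Y) <= r1 -> y != 0 /\ (laurent r e a y = 0 -> y = Y)) ->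
  (forall y, Cmod (y - Y) <= r2 -> y != 0 /\ (laurent r e a y = 0 -> y = Y)) ->
  let g (rho : R) phi := let x := rho%:C%C * Cexpi phi in
    c * (Y + x) ^ E / laurent r e a (Y + x) ^+ l * (x / (Y + x)) in
  Ccircle_integral (g r1) = Ccircle_integral (g r2).
Proof.
move=> l0 GY r10 r20 h1 h2 g.
set P := laurent_poly r e a; set B := exp_bound r e.
have PE y : y != 0 -> P.[y] = y ^+ B * laurent r e a y by apply: laurent_polyE.
have [Y0 _] : Y != 0 /\ (laurent r e a Y = 0 -> Y = Y).
  by apply: h1; rewrite subrr Cmod0 ltW.
have P0 : P != 0.
  have [y0 hy] : Y + r1%:C%C != 0 /\ (laurent r e a (Y + r1%:C%C) = 0 -> Y + r1%:C%C = Y).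
    by apply: h1; rewrite addrC addKr (ge0_CmodC (ltW r10)).
  apply/eqP => P0; have := PE _ y0; rewrite P0 horner0 => /esym/eqP.
  rewrite mulf_eq0 expf_eq0 (negPf y0) andbF /= => /eqP/hy/eqP.
  by rewrite -subr_eq0 addrC addKr -Cmod_eq0 (ge0_CmodC (ltW r10)) gt_eqF.
have [m [q + Pq]] := multiplicity_XsubC P Y.
rewrite P0 /= => qY.
have m0 : (0 < m)%N.
  rewrite lt0n; apply/eqP => m0; move: qY; rewrite /root.
  by have := PE _ Y0; rewrite GY mulr0 Pq m0 expr0 mulr1 => ->; rewrite eqxx.
pose u : int := E + (B * l)%N%:Z - 1.
pose n := (m * l).-1.
pose S : {poly C} := c *: ('X + Y%:P) ^+ `|(u + `|u|%N%:Z)%R|.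
pose Q : {poly C} := ('X + Y%:P) ^+ `|u| * (q \Po ('X + Y%:P)) ^+ l.
have [k hk] := residue_const n S Q.
suff key rho : 0 < rho ->
    (forall y, Cmod (y - Y) <= rho -> y != 0 /\ (laurent r e a y = 0 -> y = Y)) ->
    Ccircle_integral (g rho) = (2 * pi)%:C%C * k.
  by rewrite !key.
move=> rho0 h.
have qn y : Cmod (y - Y) <= rho -> q.[y] != 0.
  move=> hy; have [y0 hyY] := h y hy; apply/eqP => q0.
  have := PE _ y0; rewrite Pq hornerM q0 mul0r => /esym/eqP.
  rewrite mulf_eq0 expf_eq0 (negPf y0) andbF /= => /eqP/hyY yY.
  by move: qY; rewrite /root -yY q0 eqxx.
have rc0 : rho%:C%C != 0 :> C by rewrite -Cmod_eq0 (ge0_CmodC (ltW rho0)) gt_eqF.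
have hQ z : Cmod z <= Cmod (rho%:C%C : C) -> Q.[z] != 0.
  rewrite (ge0_CmodC (ltW rho0)) => hz.
  have hy : Cmod (z + Y - Y) <= rho by rewrite addrK.
  have [y0 _] := h _ hy.
  rewrite /Q hornerM !horner_exp horner_comp !hornerE.
  by rewrite mulf_neq0// expf_neq0// qn.
have := has_mean_integral (eta := 0) rc0 (hk _ rc0 hQ).
move=> /(_ (g rho)); rewrite mulr0 => H; apply/eqP.
rewrite -subr_eq0 -Cmod_eq0 eq_le Cmod_ge0 andbT; apply: H => phi.
rewrite [X in Cmod X](_ : _ = 0) ?Cmod0//; apply/eqP; rewrite subr_eq0; apply/eqP.
rewrite /g; set x := rho%:C%C * Cexpi phi.
have x0 : x != 0 by apply: circle_pt_neq0.
have hy : Cmod (Y + x - Y) <= rho.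
  by rewrite addrC addKr Cmod_circle_pt (ge0_CmodC (ltW rho0)).
clearbody x; have [y0 _] := h _ hy; have qy := qn _ hy.
have GE : laurent r e a (Y + x) = q.[Y + x] * x ^+ m / (Y + x) ^+ B.
  have := PE _ y0; rewrite Pq hornerM horner_exp hornerXsubC addrAC subrr add0r => ->.
  by rewrite mulrC mulrA mulVf ?mul1r// expf_neq0.
rewrite GE /S /Q !(hornerE, horner_exp, horner_comp) [x + Y]addrC.
set y := Y + x in y0 qy *.
have uE := expz_shift E (B * l) y0; rewrite -/u exprM in uE.
have nE : x ^+ m ^+ l = x ^+ n * x.
  by rewrite -exprM -exprSr /n prednK// muln_gt0 m0 l0.
rewrite uE expr_div_n exprMn nE.
have yu := expf_neq0 `|u| y0; have yB := expf_neq0 l (expf_neq0 B y0).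
have ql := expf_neq0 l qy; have xn := expf_neq0 n x0.
move: (y ^+ `|_|) (y ^+ `|u|) (_ ^+ l) (q.[y] ^+ l) (x ^+ n) yu yB ql xn => A1 A2 A3 A4 A5.
by move=> u0 v0 w0 z0 /=; field; rewrite y0 x0 u0 v0 w0 z0.
Qed.

Lemma Cpow_sub1 (z : C) n : Cmod z <= 2 ->
  Cmod (z ^+ n - 1) <= n%:R * 2 ^+ n * Cmod (z - 1).
Proof.
move=> z2; rewrite -[X in _ - X](expr1n _ n) subrXX CmodM mulrC ler_wpM2r ?Cmod_ge0//.
apply: le_trans (Cmod_sum_le _ _ _) _.
rewrite -[n in n%:R]card_ord mulr_natl -sumr_const; apply: ler_sum => i _.
rewrite expr1n mulr1 CmodX.
apply: le_trans (_ : 2 ^+ (n.-1 - i) <= _); first by rewrite lerXn2r ?nnegrE ?Cmod_ge0.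
by rewrite ler_weXn2l ?ler1n//; lia.
Qed.

Section Core.
Variables (I : eqType) (r : seq I) (e : I -> int) (a : I -> C) (eta : R).
Variables (s0 x0 : C).
Hypothesis eta_small : eta <= 16^-1.
Hypothesis a_small : small r e a eta.
Hypothesis s0_annulus : annulus s0.
Hypothesis s0_root : 1 + s0 + laurent r e a s0 = 0.
Hypothesis x0_norm : Cmod x0 = 4^-1.
Local Notation x phi := (x0 * Cexpi phi).
Local Notation G z := (1 + z + laurent r e a z).

Let eta_ge0 : 0 <= eta.
Proof.
by apply: le_trans a_small; apply: sumr_ge0 => i _; rewrite mulr_ge0 ?Cmod_ge0// (le_trans ler01) ?annulus_cst_ge1.
Qed.

Let x0_neq0 : x0 != 0.
Proof. by rewrite -Cmod_eq0 x0_norm invr_eq0. Qed.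

Let Cmod_x phi : Cmod (x phi) = 4^-1.
Proof. by rewrite Cmod_circle_pt. Qed.

Lemma circle_annulus phi : annulus (s0 + x phi).
Proof.
apply: annulus_near; have := perturbation_near a_small s0_annulus s0_root.
have := Cmod_add_le (s0 + 1) (x phi); rewrite Cmod_x.
have -> : s0 + x phi + 1 = s0 + 1 + x phi by ring.
move=> h1 h2; have := eta_small. lra.
Qed.

Lemma circle_lower phi : 8^-1 <= Cmod (G (s0 + x phi)).
Proof.
have := perturbation_lower a_small (circle_annulus phi) s0_annulus s0_root.
rewrite [s0 + _ - s0]addrC addKr Cmod_x; apply: le_trans; have := eta_small; lra.
Qed.

(** On the circle the denominator stays away from 0. *)
Lemma small_numerator_integral (l : nat) (N : C -> C) (delta : R) :
  (forall phi, Cmod (N (s0 + x phi)) <= delta) ->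
  Cmod (Ccircle_integral (fun phi =>
    N (s0 + x phi) / G (s0 + x phi) ^+ l * (x phi / (s0 + x phi)))) <=
  4 * pi * (delta * 8 ^+ l).
Proof.
move=> hN; pose z0 : R -> C := fun=> 0.
have c0 : Ccontinuous z0 by exact: Ccontinuous_cst.
have i0 : Ccircle_integral z0 = 0.
  by rewrite /Ccircle_integral !Rint_cst /= !mul0r.
rewrite -[X in Cmod X]subr0 -i0; apply: circle_approx => // phi.
rewrite subr0 CmodM [Cmod (N _ / _)]CmodM [Cmod (x _ / _)]CmodM !CmodV CmodX Cmod_x.
have d0 : 0 <= delta by apply: le_trans (hN phi); exact: Cmod_ge0.
rewrite -[leRHS]mulr1; apply: ler_pM.
- by rewrite divr_ge0 ?exprn_ge0 ?Cmod_ge0.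
- by rewrite divr_ge0 ?Cmod_ge0 ?invr_ge0.
- apply: ler_pM; rewrite ?Cmod_ge0 ?invr_ge0 ?exprn_ge0 ?Cmod_ge0//.
  rewrite -exprVn lerXn2r ?nnegrE ?invr_ge0 ?Cmod_ge0//.
  rewrite -[leRHS]invrK lef_pV2 ?posrE ?invr_gt0 ?circle_lower//.
  by apply: lt_le_trans (circle_lower phi); rewrite invr_gt0.
- case/andP: (circle_annulus phi) => h _.
  rewrite ler_pdivrMr; last by apply: lt_le_trans h; rewrite invr_gt0.
  by rewrite mul1r; lra.
Qed.

(** On the circle, [G] is its linear part [x] at the zero [s0] up to a factor
    [1 + D] close to 1. *)
Let D phi := laurent_divdiff r e a (s0 + x phi) s0.

Let GE phi : G (s0 + x phi) = x phi * (1 + D phi).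
Proof.
have := laurentB r e a (annulus_neq0 (circle_annulus phi)) (annulus_neq0 s0_annulus).
rewrite [s0 + _ - s0]addrC addKr mulrDr mulr1 => <-.
by rewrite -[LHS]subr0 -s0_root; ring.
Qed.

Let DE phi : Cmod (D phi) <= eta.
Proof. exact: laurent_divdiff_le a_small (circle_annulus phi) s0_annulus. Qed.

(** The first summand bounds the effect of replacing [G] by its linear part, the
    second that of moving the zero [s0] to [-1]. *)
Definition leading_residue_cst (l : nat) : R :=
  4 * pi * (2 ^+ l * 2 * 4 ^+ l * (l%:R * 2 ^+ l * 2)) + 2 * pi * (l%:R * 2 ^+ l * 2).

Let leading_residue_approx (kappa : C) (l p : nat) (h : R -> C) (c : C) :
  Cmod kappa = 1 -> (p < l)%N ->
  (forall phi, h phi = (s0 + x phi) ^+ p / (s0 + x phi) / x phi ^+ l.-1) ->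
  has_mean x0 l.-1 h c ->
  Cmod (Ccircle_integral (fun phi => kappa *
    ((s0 + x phi) ^+ p / G (s0 + x phi) ^+ l * (x phi / (s0 + x phi)))) -
    (2 * pi)%:C%C * (kappa * c)) <= 4 * pi * (2 ^+ l * 2 * 4 ^+ l * (l%:R * 2 ^+ l * 2)) * eta.
Proof.
move=> k1 pl hE hc; rewrite -mulrA.
apply: has_mean_integral (has_meanZ kappa hc) _ => // phi.
rewrite -mulrBr CmodM k1 mul1r.
set s := s0 + x phi; have /andP[s1 s2] := circle_annulus phi; rewrite -/s in s1 s2.
have s_neq0 : s != 0 := annulus_neq0 (circle_annulus phi).
have xn0 : x phi != 0 by apply: circle_pt_neq0.
pose rho := (1 + D phi)^-1.
have D2 : 2^-1 <= Cmod (1 + D phi).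
  have := Cmod_sub_ge 1 (- D phi); rewrite opprK Cmod1 CmodN.
  have := DE phi; have := eta_small; lra.
have D0 : 1 + D phi != 0 by rewrite -Cmod_gt0; apply: lt_le_trans D2; rewrite invr_gt0.
have rho2 : Cmod rho <= 2.
  by rewrite CmodV -[leRHS]invrK lef_pV2 ?posrE ?invr_gt0 ?Cmod_gt0.
have rho1 : Cmod (rho - 1) <= 2 * eta.
  have -> : rho - 1 = rho * - D phi by rewrite /rho; field.
  by rewrite CmodM CmodN ler_pM ?Cmod_ge0.
have alg (XL X SP z DL : C) : XL != 0 -> X != 0 -> z != 0 -> DL != 0 ->
    SP / (XL * X * DL) * (X / z) - SP / z / XL = SP / z / XL * (DL^-1 - 1).
  by move=> h1 h2 h3 h4; field; rewrite h1 h2 h3 h4.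
have -> : s ^+ p / G s ^+ l * (x phi / s) - h phi = h phi * (rho ^+ l - 1).
  rewrite /s GE -/s hE -/s exprMn /rho exprVn.
  have -> : x phi ^+ l = x phi ^+ l.-1 * x phi by rewrite -exprSr prednK// (leq_ltn_trans _ pl).
  have xl := expf_neq0 l.-1 xn0; have Dl := expf_neq0 l D0.
  exact: alg.
rewrite CmodM -[leRHS]mulrA; apply: ler_pM; rewrite ?Cmod_ge0//.
  rewrite hE -/s !CmodM !CmodV !CmodX Cmod_x.
  apply: ler_pM; rewrite ?mulr_ge0 ?invr_ge0 ?exprn_ge0 ?Cmod_ge0 ?invr_ge0//.
    apply: ler_pM; rewrite ?invr_ge0 ?exprn_ge0 ?Cmod_ge0//.
      apply: le_trans (_ : 2 ^+ p <= _); first by rewrite lerXn2r ?nnegrE ?Cmod_ge0.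
      by rewrite ler_weXn2l ?ler1n// ltnW.
    by rewrite -[leRHS]invrK lef_pV2 ?posrE ?invr_gt0 ?Cmod_gt0.
  rewrite -exprVn invrK ler_weXn2l ?ler1n// leq_pred//.
apply: le_trans (Cpow_sub1 l rho2) _.
by rewrite -!mulrA !ler_wpM2l// exprn_ge0.
Qed.

(** With [G] replaced by [x], the integrand is [s^(p-1) / x^(l-1)] where
    [s = s0 + x].  For [0 < p < l] this has no constant term, as [s^(p-1)] has
    degree less than [l - 1] in [x]; for [p = 0], expanding [1 / (s0 + x)] gives
    the constant term [- (- 1 / s0)^l], which is close to [-1]. *)
Lemma leading_residue (kappa : C) (l p : nat) : Cmod kappa = 1 -> (p < l)%N ->
  Cmod (Ccircle_integral (fun phi => kappa *
    ((s0 + x phi) ^+ p / G (s0 + x phi) ^+ l * (x phi / (s0 + x phi)))) +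
    (2 * pi)%:C%C * kappa * (p == 0%N)%:R) <= leading_residue_cst l * eta.
Proof.
move=> k1 pl; have l0 : (0 < l)%N by apply: leq_ltn_trans pl.
have s00 := annulus_neq0 s0_annulus.
have pp : 0 < pi :> R := pi_gt0 R.
have cpos : 0 <= l%:R * 2 ^+ l * 2 :> R by rewrite !mulr_ge0// exprn_ge0.
have K0 : 0 <= 2 * pi * (l%:R * 2 ^+ l * 2) * eta.
  by rewrite mulr_ge0// mulr_ge0// mulr_ge0// ltW.
case: p pl => [|p] pl; last first.
  rewrite mulr0 addr0 /leading_residue_cst [(_ + _) * eta]mulrDl.
  apply: le_trans (_ : 4 * pi * (2 ^+ l * 2 * 4 ^+ l * (l%:R * 2 ^+ l * 2)) * eta <= _);
    last by rewrite lerDl.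
  pose S : {poly C} := ('X + s0%:P) ^+ p.
  have SE : S = 1%:P * S + 'X^(l.-1.+1) * 0 by rewrite mul1r mulr0 addr0.
  have hm := rational_mean x0_neq0 SE.
  have Sl : S`_l.-1 = 0.
    rewrite nth_default//; apply: leq_trans (size_poly_exp_leq _ _) _.
    by rewrite size_XaddC /= mul1n; clear -pl; lia.
  rewrite Sl in hm.
  have := leading_residue_approx k1 pl _ (hm _); rewrite !mulr0 subr0; apply.
    move=> phi; rewrite hornerC mul1r /S horner_exp !hornerE [_ + s0]addrC.
    by rewrite exprSr mulfK// annulus_neq0// circle_annulus.
  by move=> z _; rewrite hornerC oner_eq0.
pose B : {poly C} := s0^-1 *: \sum_(k < l) (- s0^-1 *: 'X) ^+ k.
have SE : 1 = ('X + s0%:P) * B + 'X^(l.-1.+1) * ((- s0^-1) ^+ l)%:P.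
  rewrite prednK// /B -scalerAr.
  have H : (- s0^-1 *: 'X) ^+ l - 1 = (- s0^-1 *: 'X - 1) * \sum_(k < l) (- s0^-1 *: 'X) ^+ k :> {poly C}.
    by rewrite subrX1.
  have -> : s0^-1 *: (('X + s0%:P) * \sum_(k < l) (- s0^-1 *: 'X) ^+ k) =
     - ((- s0^-1 *: 'X) ^+ l - 1).
    rewrite H -mulNr scalerAl; congr (_ * _).
    rewrite scalerDr -[s0%:P]alg_polyC scalerA mulVf// scale1r opprB addrC.
    by rewrite scaleNr opprK.
  by rewrite exprZn -mul_polyC; ring.
have hm := rational_mean x0_neq0 SE.
have Bl : B`_l.-1 = - (- s0^-1) ^+ l.
  rewrite /B coefZ coef_sum (bigD1 (Ordinal (ltac:(by rewrite prednK) : (l.-1 < l)%N)))//=.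
  rewrite exprZn coefZ coefXn eqxx mulr1 big1 ?addr0 => [|i il]; last first.
    rewrite exprZn coefZ coefXn; case: eqP => [E|]; last by rewrite mulr0.
    by case/eqP: il; apply: val_inj; rewrite /= E.
  by rewrite -[in RHS](prednK l0) exprS mulNr opprK.
rewrite Bl in hm.
have h1 := leading_residue_approx (h := fun phi => (1 : {poly C}).[x phi] / (('X + s0%:P : {poly C}).[x phi] * x phi ^+ l.-1)) k1 pl.
have {}h1 := h1 _ _ (hm _).
have h2 : Cmod ((2 * pi)%:C%C * (kappa * - ((- s0^-1) ^+ l - 1))) <= 2 * pi * (l%:R * 2 ^+ l * 2) * eta.
  rewrite CmodM [Cmod (kappa * _)]CmodM k1 mul1r CmodN ge0_CmodC ?mulr_ge0 ?(ltW pp)// -[leRHS]mulrA ler_wpM2l ?mulr_ge0 ?(ltW pp)//.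
  have s02 : Cmod (- s0^-1) <= 2.
    rewrite CmodN CmodV -[leRHS]invrK lef_pV2 ?posrE ?invr_gt0 ?Cmod_gt0//.
    by case/andP: s0_annulus.
  apply: le_trans (Cpow_sub1 l s02) _.
  rewrite -[leRHS]mulrA ler_wpM2l ?mulr_ge0 ?exprn_ge0//.
  have -> : - s0^-1 - 1 = - s0^-1 * (s0 + 1) by field.
  rewrite CmodM ler_pM ?Cmod_ge0//.
  exact: perturbation_near a_small s0_annulus s0_root.
rewrite eqxx mulr1 /leading_residue_cst [(_ + _) * eta]mulrDl.
set J := Ccircle_integral _ in h1 *.
have -> : J + (2 * pi)%:C%C * kappa = (J - (2 * pi)%:C%C * (kappa * - (- s0^-1) ^+ l)) +
   (2 * pi)%:C%C * (kappa * - ((- s0^-1) ^+ l - 1)) by ring.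
apply: le_trans (Cmod_add_le _ _) _; apply: lerD => //; apply: h1.
  by move=> phi; rewrite !hornerE [_ + s0]addrC invfM ?mul1r ?div1r.
move=> z hz; rewrite !hornerE addrC -Cmod_gt0.
have := Cmod_sub_ge s0 (- z); rewrite opprK CmodN.
move: s0_annulus hz; rewrite /annulus x0_norm => /andP[h _] hz; apply: lt_le_trans.
by rewrite subr_gt0; apply: le_lt_trans hz _; apply: lt_le_trans h; lra.
Qed.

End Core.
End CircleResidue.

(** * The monomial chart around the torus cycle *)
Section Chart.
Variable R : realType.
Local Notation C := R[i].

Lemma prod_expz (F : fieldType) (I : Type) (r : seq I) (x : F) (k : I -> int) :
  x != 0 -> \prod_(i <- r) x ^ k i = x ^ (\sum_(i <- r) k i).
Proof.
move=> x0; elim: r => [|i r IH]; first by rewrite !big_nil expr0z.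
by rewrite !big_cons IH expfzDr.
Qed.

Lemma prod_expzl (F : fieldType) (I : Type) (r : seq I) (x : I -> F) (k : int) :
  (\prod_(i <- r) x i) ^ k = \prod_(i <- r) x i ^ k.
Proof.
elim: r => [|i r IH]; first by rewrite !big_nil exp1rz.
by rewrite !big_cons expfzMl IH.
Qed.

Lemma Cexpi_sum (I : Type) (r : seq I) (x : I -> R) :
  \prod_(i <- r) Cexpi (x i) = Cexpi (\sum_(i <- r) x i).
Proof.
elim: r => [|i r IH]; first by rewrite !big_nil Cexpi0.
by rewrite !big_cons IH CexpiD.
Qed.

Lemma powR_sum (I : Type) (r : seq I) (t : R) (x : I -> R) : 0 < t ->
  \prod_(i <- r) t `^ x i = t `^ (\sum_(i <- r) x i).
Proof.
move=> t0; elim: r => [|i r IH]; first by rewrite !big_nil powRr0.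
by rewrite !big_cons IH powRD// (gt_eqF t0) implybT.
Qed.

Section FixedChart.
Variables (d : nat) (w m0 : 'rV[int]_d.+1) (gamma : 'M[int]_(d, d.+1)).
Hypothesis det1 : \det (coord_mx w m0 gamma) = 1.
Local Notation K := (coord_mx w m0 gamma).

Lemma coord_unit : K \in unitmx.
Proof. by rewrite unitmxE det1 unitr1. Qed.

(** The exponents of the chart coordinates in the monomial of [m], that is, the
    coordinates of [m] in the basis [m0 - w, gamma_1, ..., gamma_d]. *)
Definition cexp (m : 'rV[int]_d.+1) : 'rV[int]_(1 + d) := m *m invmx K.

Lemma cexpB m m' : cexp (m - m') = cexp m - cexp m'.
Proof. exact: mulmxBl. Qed.

Lemma cexpK m : cexp m *m K = m.
Proof. by rewrite /cexp mulmxKV// coord_unit. Qed.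

Lemma cexp_edge : cexp (m0 - w) = delta_mx 0 0.
Proof.
have <- : row 0 K *m invmx K = cexp (m0 - w).
  congr (_ *m _); apply/rowP => j; rewrite mxE /coord_mx.
  have -> : (0 : 'I_(1 + d)) = lshift d 0 by apply: val_inj.
  exact: (col_mxEu (m0 - w) gamma 0 j).
by rewrite -row_mul mulmxV ?coord_unit// rowE mulmx1.
Qed.

Lemma monomial_chartE (u : 'rV[C]_d.+1) m : (forall j, u 0 j != 0) ->
  monomial (monomial_chart w m0 gamma u) m = \prod_j u 0 j ^ cexp m 0 j.
Proof.
move=> u0; rewrite /monomial.
transitivity (\prod_i \prod_j u 0 j ^ (m 0 i * invmx K i j)).
  apply: eq_bigr => i _; rewrite mxE prod_expzl; apply: eq_bigr => j _.
  by rewrite exprz_exp mulrC.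
rewrite exchange_big; apply: eq_bigr => j _ /=.
by rewrite prod_expz// mxE.
Qed.

Lemma chart_neq0 (u : 'rV[C]_d.+1) i : (forall j, u 0 j != 0) ->
  monomial_chart w m0 gamma u 0 i != 0.
Proof.
by move=> u0; rewrite mxE; apply/prodf_neq0 => j _; rewrite expfz_neq0.
Qed.

Lemma pairingD (m m' : 'rV[int]_d.+1) (n : 'rV[R]_d.+1) :
  pairing (m + m') n = pairing m n + pairing m' n.
Proof.
rewrite /pairing -big_split; apply: eq_bigr => i _ /=.
by rewrite mxE rmorphD mulrDl.
Qed.

Lemma pairingB (m m' : 'rV[int]_d.+1) (n : 'rV[R]_d.+1) :
  pairing (m - m') n = pairing m n - pairing m' n.
Proof. by apply/eqP; rewrite eq_sym subr_eq -pairingD subrK. Qed.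

Lemma pairing_cexp m (n : 'rV[R]_d.+1) :
  pairing m n = (cexp m 0 0)%:~R * pairing (m0 - w) n +
    \sum_j (cexp m 0 (rshift 1 j))%:~R * pairing (row j gamma) n.
Proof.
rewrite -{1}(cexpK m) /pairing.
transitivity (\sum_(k < 1 + d) (cexp m 0 k)%:~R * \sum_i (K k i)%:~R * n 0 i : R).
  under [RHS]eq_bigr do rewrite mulr_sumr.
  rewrite exchange_big; apply: eq_bigr => i _ /=.
  rewrite mxE rmorph_sum mulr_suml; apply: eq_bigr => k _ /=.
  by rewrite intrM mulrA.
rewrite big_split_ord big_ord1 /=; congr (_ + _).
  have -> : lshift d 0 = 0 :> 'I_(1 + d) by apply: val_inj.
  congr (_ * _); apply: eq_bigr => i _; congr (_%:~R * _).
  have -> : (0 : 'I_(1 + d)) = lshift d 0 by apply: val_inj.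
  exact: (col_mxEu (m0 - w) gamma 0 i).
apply: eq_bigr => j _; congr (_ * _); apply: eq_bigr => i _; congr (_%:~R * _).
by rewrite [RHS]mxE; exact: (col_mxEd (m0 - w) gamma j i).
Qed.

Lemma Cmod_monomial_Logt t (z : 'rV[C]_d.+1) m : 0 < t < 1 ->
  (forall i, z 0 i != 0) -> Cmod (monomial z m) = t `^ pairing m (Logt t z).
Proof.
move=> /andP[t0 t1] z0; have lt0 : ln t != 0 by rewrite lt_eqF// ln_lt0// t0.
rewrite Cmod_prod /pairing -powR_sum//; apply: eq_bigr => i _.
rewrite Cmodz mxE mulrC powRrM powR_intmul ?powR_ge0//; congr (_ ^ _).
by rewrite /powR gt_eqF// divfK// lnK// posrE Cmod_gt0.
Qed.

Section TorusPoint.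
Variables (k : 'rV[int]_d.+1 -> puiseux R) (n0 : 'rV[R]_d.+1).
Hypothesis n0_edge : pval (k w) - pval (k m0) = pairing (m0 - w) n0.
Local Notation pt := (torus_point k w m0 gamma n0).

Definition tcoord t (y : C) (th : 'rV[R]_d) : 'rV[C]_(1 + d) :=
  row_mx (const_mx ((t `^ (pval (k w) - pval (k m0)))%:C%C * y) : 'rV[C]_1)
    (\row_j ((t `^ (pairing (row j gamma) n0))%:C%C * Cexpi (th 0 j))).

Lemma tcoordl t y th :
  tcoord t y th 0 0 = (t `^ (pval (k w) - pval (k m0)))%:C%C * y.
Proof.
have -> : (0 : 'I_(1 + d)) = lshift d 0 by apply: val_inj.
by rewrite row_mxEl mxE.
Qed.

Lemma tcoordr t y th j : tcoord t y th 0 (rshift 1 j) =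
  (t `^ (pairing (row j gamma) n0))%:C%C * Cexpi (th 0 j).
Proof. by rewrite row_mxEr mxE. Qed.

Lemma ordS_split (P : 'I_(1 + d) -> Prop) :
  P 0 -> (forall j, P (rshift 1 j)) -> forall i, P i.
Proof.
move=> P0 Pr i; case: (split_ordP i) => j ->; last exact: Pr.
by rewrite ord1; have -> : lshift d 0 = 0 :> 'I_(1 + d) by apply: val_inj.
Qed.

Lemma powRC_neq0 (t x : R) : 0 < t -> (t `^ x)%:C%C != 0 :> C.
Proof. by move=> t0; rewrite -Cmod_eq0 ge0_CmodC ?powR_ge0// gt_eqF// powR_gt0. Qed.

Lemma tcoord_neq0 t y th j : 0 < t -> y != 0 -> tcoord t y th 0 j != 0.
Proof.
move=> t0 y0; move: j; apply: ordS_split => [|j].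
  by rewrite tcoordl mulf_neq0// powRC_neq0.
by rewrite tcoordr mulf_neq0 ?powRC_neq0 ?Cexpi_neq0.
Qed.

Lemma torus_point_neq0 t y th i : 0 < t -> y != 0 -> pt t y th 0 i != 0.
Proof. by move=> t0 y0; apply: chart_neq0 => j; apply: tcoord_neq0. Qed.

Definition phase m (th : 'rV[R]_d) : R :=
  \sum_j (cexp m 0 (rshift 1 j))%:~R * th 0 j.

Lemma phaseB m m' th : phase (m - m') th = phase m th - phase m' th.
Proof.
rewrite /phase -sumrB; apply: eq_bigr => j _.
by rewrite cexpB !mxE rmorphB mulrBl.
Qed.

Lemma phase_edge th : phase (m0 - w) th = 0.
Proof.
rewrite /phase cexp_edge big1// => j _; rewrite mxE eqxx /=.
by rewrite mul0r.
Qed.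

(** The positive factors of the chart coordinates combine to [t^<m, n0>]; for the
    first coordinate this uses that [n0] lies on the edge. *)
Lemma torus_monomial t y th m : 0 < t -> y != 0 ->
  monomial (pt t y th) m =
  (t `^ pairing m n0)%:C%C * Cexpi (phase m th) * y ^ cexp m 0 0.
Proof.
move=> t0 y0; rewrite /torus_point monomial_chartE => [|j]; last exact: tcoord_neq0.
rewrite -/(tcoord t y th).
have -> : \prod_j tcoord t y th 0 j ^ cexp m 0 j =
   tcoord t y th 0 0 ^ cexp m 0 0 *
   \prod_j tcoord t y th 0 (rshift 1 j) ^ cexp m 0 (rshift 1 j).
  rewrite (@big_split_ord _ _ _ 1 d) big_ord1 /=.
  by have -> : lshift d 0 = 0 :> 'I_(1 + d) by apply: val_inj.
have pz (x : R) (e : int) : (t `^ x)%:C%C ^ e = (t `^ (e%:~R * x))%:C%C :> C.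
  rewrite mulrC powRrM powR_intmul ?powR_ge0//.
  case: e => n; rewrite ?NegzE -?exprnP -?exprnN ?rmorphXn//=.
  by rewrite fmorphV rmorphXn.
under eq_bigr do rewrite tcoordr expfzMl pz CexpiZ.
rewrite tcoordl expfzMl pz big_split /= Cexpi_sum -/(phase m th) pairing_cexp n0_edge.
rewrite powRD ?(gt_eqF t0) ?implybT// -powR_sum// rmorphM rmorph_prod /=.
by rewrite mulrAC !mulrA.
Qed.

Lemma Logt_torus t y th : 0 < t < 1 -> y != 0 -> Logt t (pt t y th) =
  n0 + (ln (Cmod y) / ln t) *: \row_i (cexp (delta_mx 0 i) 0 0)%:~R.
Proof.
move=> /[dup] t01 /andP[t0 t1] y0.
have lt0 : ln t != 0 by rewrite lt_eqF// ln_lt0// t0.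
have pd (n : 'rV[R]_d.+1) i : pairing (delta_mx 0 i) n = n 0 i.
  rewrite /pairing (bigD1 i)//= mxE !eqxx mul1r big1 ?addr0// => j ji.
  by rewrite mxE (negPf ji) andbF mul0r.
apply/rowP => i; rewrite -[LHS]pd.
have := Cmod_monomial_Logt (delta_mx 0 i) t01 (fun j => torus_point_neq0 th j t0 y0).
rewrite torus_monomial// !CmodM Cmod_Cexpi ge0_CmodC ?powR_ge0// mulr1 Cmodz pd.
move/(congr1 (@ln R)); rewrite lnM ?posrE ?powR_gt0 ?exprz_gt0 ?Cmod_gt0//.
rewrite -powR_intmul ?Cmod_ge0// !ln_powR => H.
apply: (mulIf lt0); rewrite -H !mxE mulrDl; congr (_ + _).
by rewrite mulrAC divfK// mulrC.
Qed.

(** ** The Jacobian of the tube *)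

Variables (t : R) (Y : 'rV[R]_d -> C) (r : R).
Hypothesis t_gt0 : 0 < t.
Hypothesis Y_derivable : forall th (j : 'I_d),
  exists L, Clim (fun h => (h^-1)%:C%C * (Y (h *: delta_mx 0 j + th) - Y th)) L.
Let y (s : 'rV[R]_(1 + d)) : C := Y (rsubmx s) + r%:C%C * Cexpi (s 0 0).
Hypothesis y_neq0 : forall s, y s != 0.
Local Notation tb := (tube k w m0 gamma n0 t Y r).

Let tube_coord s : tb s = monomial_chart w m0 gamma (tcoord t (y s) (rsubmx s)).
Proof. by []. Qed.

(** The logarithmic Jacobian of the chart coordinates is block triangular: the
    angles are constant along the normal circle, and of the derivatives of [Y],
    collected in [L], only the existence matters. *)
Let coord_dlog s : exists L : 'rV[C]_d, forall j k' : 'I_(1 + d),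
  dlog (fun h => tcoord t (y (h *: delta_mx 0 j + s)) (rsubmx (h *: delta_mx 0 j + s)) 0 k' /
                 tcoord t (y s) (rsubmx s) 0 k')
   ((block_mx (('i%C * (r%:C%C * Cexpi (s 0 0)) / y s)%:M : 'M[C]_1) L 0 ('i%C%:M : 'M[C]_d)) k' j).
Proof.
have Lex (j : 'I_d) := cid (Y_derivable (rsubmx s) j).
exists (\row_j (projT1 (Lex j) / y s)).
have I0 : (0 : 'I_(1 + d)) = lshift d 0 by apply: val_inj.
have r0 i : (rshift 1 i == 0 :> 'I_(1 + d)) = false by [].
set B := block_mx _ _ _ _.
have B00 : B 0 0 = 'i%C * (r%:C%C * Cexpi (s 0 0)) / y s.
  transitivity (B (lshift d 0) (lshift d 0)); first by rewrite -I0.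
  by rewrite block_mxEul mxE eqxx mulr1n.
have B0r j : B 0 (rshift 1 j) = projT1 (Lex j) / y s.
  transitivity (B (lshift d 0) (rshift 1 j)); first by rewrite -I0.
  by rewrite block_mxEur mxE.
have Br0 j : B (rshift 1 j) 0 = 0.
  transitivity (B (rshift 1 j) (lshift d 0)); first by rewrite -I0.
  by rewrite block_mxEdl mxE.
apply: ordS_split => [|j]; apply: ordS_split => [|k'].
- have E h : h *: delta_mx 0 0 + s = row_mx (const_mx (h + s 0 0)) (rsubmx s) :> 'rV[R]_(1 + d).
    apply/rowP; apply: ordS_split => [|i]; rewrite !mxE.
      by rewrite I0 (unsplitK (inl _)) !mxE eqxx mulr1.
    by rewrite (unsplitK (inr _)) !mxE r0 andbF mulr0 add0r.
  rewrite B00.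
  apply: dlog_slope; have [_ D] := dlog_Cexpi (1 : R).
  have := ClimM (Clim_cst (r%:C%C * Cexpi (s 0 0) / y s)) D.
  rewrite (_ : _ * (0 +i* 1)%C = 'i%C * (r%:C%C * Cexpi (s 0 0)) / y s); last first.
    by rewrite mulrC !mulrA.
  apply: eq_Clim => h h0; rewrite !tcoordl mul1r.
  have -> : y (h *: delta_mx 0 0 + s) = y s + r%:C%C * Cexpi (s 0 0) * (Cexpi h - 1).
    have E0 : (h *: delta_mx 0 0 + s) 0 0 = h + s 0 0 by rewrite !mxE !eqxx mulr1.
    by rewrite /y E0 E row_mxKr CexpiD; ring.
  have := y_neq0 s; have := powRC_neq0 (pval (k w) - pval (k m0)) t_gt0.
  move: (y s) (_ %:C%C) (h^-1)%:C%C (Cexpi h) => ys T hi E1 T0 ys0.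
  by field; rewrite T0 ys0.
- have E h : h *: delta_mx 0 0 + s = row_mx (const_mx (h + s 0 0)) (rsubmx s) :> 'rV[R]_(1 + d).
    apply/rowP; apply: ordS_split => [|i]; rewrite !mxE.
      by rewrite I0 (unsplitK (inl _)) !mxE eqxx mulr1.
    by rewrite (unsplitK (inr _)) !mxE r0 andbF mulr0 add0r.
  rewrite Br0.
  under [X in dlog X]funext do rewrite E row_mxKr !tcoordr divff ?mulf_neq0 ?powRC_neq0 ?Cexpi_neq0//.
  exact: dlog_cst.
- have E1 h : rsubmx (h *: delta_mx 0 (rshift 1 j) + s) = h *: delta_mx 0 j + rsubmx s.
    by apply/rowP => i; rewrite !mxE (inj_eq (@rshift_inj _ _)).
  have E2 h : (h *: delta_mx 0 (rshift 1 j) + s) 0 0 = s 0 0.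
    by rewrite !mxE eq_sym r0 andbF mulr0 add0r.
  rewrite B0r.
  apply: dlog_slope; have := ClimM (projT2 (Lex j)) (Clim_cst (y s)^-1).
  apply: eq_Clim => h h0; rewrite !tcoordl.
  have -> : y (h *: delta_mx 0 (rshift 1 j) + s) =
      y s + (Y (h *: delta_mx 0 j + rsubmx s) - Y (rsubmx s)).
    by rewrite /y E1 E2; ring.
  have := y_neq0 s; have := powRC_neq0 (pval (k w) - pval (k m0)) t_gt0.
  move: (y s) (_ %:C%C) (h^-1)%:C%C (Y _ - Y _) => ys T hi Yh T0 ys0.
  by field; rewrite T0 ys0.
- have E1 h : rsubmx (h *: delta_mx 0 (rshift 1 j) + s) = h *: delta_mx 0 j + rsubmx s.
    by apply/rowP => i; rewrite !mxE (inj_eq (@rshift_inj _ _)).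
  have -> : B (rshift 1 k') (rshift 1 j) = (0 +i* (k' == j)%:R)%C.
    by rewrite block_mxEdr mxE; case: eqP => _; rewrite ?mulr1n ?mulr0n.
  have := dlog_Cexpi ((k' == j)%:R : R); congr (dlog _ _); apply/funext => h.
  rewrite !tcoordr E1 !mxE eqxx /= CexpiD mulrC [h * _]mulrC.
  have := Cexpi_neq0 (s 0 (rshift 1 k')); have := powRC_neq0 (pairing (row k' gamma) n0) t_gt0.
  move: (Cexpi _) (Cexpi _) (_ %:C%C) => A1 A2 T T0 A20.
  by field; rewrite A20 T0.
Qed.

(** The chart contributes the determinant 1, and the block triangular factor the
    product of its diagonal. *)
Lemma tube_det s :
  \det (\matrix_(i, j) (Cpartial (fun u => tb u 0 i) j s / tb s 0 i)) =
  'i%C ^+ d.+1 * (r%:C%C * Cexpi (s 0 0) / y s).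
Proof.
have [L hL] := coord_dlog s.
set U := block_mx _ _ _ _ in hL.
have u0 s' j : tcoord t (y s') (rsubmx s') 0 j != 0 by apply: tcoord_neq0.
have -> : \matrix_(i, j) (Cpartial (fun u => tb u 0 i) j s / tb s 0 i) =
   map_mx intr (invmx K) *m U :> 'M[C]_(1 + d).
  apply/matrixP => i j; rewrite mxE.
  apply: Cpartial_dlog; first by rewrite tube_coord chart_neq0.
  have := dlog_prod (index_enum 'I_(1 + d)) (fun k' => dlogZ (invmx K i k') _ (hL j k')).
  move=> /(_ (fun k' h => mulf_neq0 (u0 _ k') (invr_neq0 (u0 _ k')))).
  rewrite [X in dlog _ X](_ : _ = (map_mx intr (invmx K) *m U) i j); last first.
    by rewrite [RHS]mxE; apply: eq_bigr => k' _; rewrite [map_mx _ _ _ _]mxE.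
  congr (dlog _ _); apply/funext => h.
  rewrite !tube_coord !mxE -prodf_div; apply: eq_bigr => k' _.
  by rewrite expfzMl exprz_inv invr_expz.
rewrite det_mulmx det_map_mx det_inv det1 invr1 rmorph1 mul1r.
have dU : \det U = 'i%C * (r%:C%C * Cexpi (s 0 0)) / y s * 'i%C ^+ d.
  by rewrite /U det_ublock det_scalar1 det_scalar.
by apply: etrans dU _; rewrite exprS; move: ('i%C ^+ d) => q; ring.
Qed.

End TorusPoint.
End FixedChart.
End Chart.

(** * The period at a fixed parameter *)
Section TorusIntegral.
Variable R : realType.
Local Notation C := R[i].

Lemma torus_integral_near n (g : 'rV[R]_n -> C) (c : C) (e : R) :
  (forall th, Cmod (g th - c) <= e) ->
  Cmod (torus_integral g - (2 * pi)%:C%C ^+ n * c) <= (4 * pi) ^+ n * e.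
Proof.
elim: n g c e => [|n IH] g c e hg; first by rewrite !expr0 !mul1r; exact: hg.
rewrite !exprSr -[_ ^+ n * _ * c]mulrA -[leRHS]mulrA; apply: IH => th.
have cc : Ccontinuous (fun _ : R => c) by exact: Ccontinuous_cst.
have -> : (2 * pi)%:C%C * c = Ccircle_integral (fun _ : R => c).
  have := circle_integralZ c (Ccontinuous_cst (1 : C)).
  have -> : Ccircle_integral (fun _ : R => 1 : C) = (2 * pi)%:C%C.
    by rewrite /Ccircle_integral !Rint_cst /= mul0r mul1r.
  by under [X in Ccircle_integral X = _]funext do rewrite mulr1; rewrite mulrC.
exact: circle_approx.
Qed.

End TorusIntegral.

Section FixedTime.
Variables (R : realType) (d : nat).
Local Notation C := R[i].
Local Notation M := 'rV[int]_d.+1.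
Variables (A : {fset M}) (k : M -> puiseux R) (w m0 : M).
Variables (gamma : 'M[int]_(d, d.+1)) (n0 : 'rV[R]_d.+1) (U : set 'rV[R]_d.+1).
Hypothesis det1 : \det (coord_mx w m0 gamma) = 1.
Hypothesis n0_edge : pval (k w) - pval (k m0) = pairing (m0 - w) n0.
Hypothesis wA : w \in A.
Hypothesis m0A : m0 \in A.
Hypothesis wm0 : w != m0.
Variable t : R.
Hypothesis t_gt0 : 0 < t.
Local Notation pt := (torus_point k w m0 gamma n0 t).
Local Notation Kt m := (peval (k m) t).
Hypothesis Kw_neq0 : Kt w != 0.

(** In the chart, the ratio of the terms of [m] and of [w] is
    [base_coef m * e^(i term_phase m) * y^(term_exp m)]. *)
Definition base_coef (m : M) : C := Kt m / Kt w * (t `^ pairing (m - w) n0)%:C%C.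
Definition term_exp (m : M) : int := cexp w m0 gamma (m - w) 0 0.
Definition term_phase (m : M) (th : 'rV[R]_d) : R := phase w m0 gamma (m - w) th.
Definition chart_coef (th : 'rV[R]_d) (m : M) : C := base_coef m * Cexpi (term_phase m th).

Lemma term_ratio m th y : y != 0 ->
  Kt m * monomial (pt y th) m =
  Kt w * monomial (pt y th) w * (chart_coef th m * y ^ term_exp m).
Proof.
move=> y0; rewrite !torus_monomial// /chart_coef /base_coef /term_exp /term_phase pairingB phaseB cexpB !mxE.
rewrite powRD ?(gt_eqF t_gt0) ?implybT// powRN CexpiD CexpiN.
rewrite [y ^ (_ - _)]expfzDr// -invr_expz rmorphM /= fmorphV.
have alg (K1 K2 T1 T2 P1 P2 Y1 Y2 : C) : K1 != 0 -> T1 != 0 -> P1 != 0 ->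
    Y1 != 0 -> K2 * (T2 * P2 * Y2) =
    K1 * (T1 * P1 * Y1) * (K2 / K1 * (T2 * T1^-1) * (P2 * P1^-1) * (Y2 * Y1^-1)).
  by move=> h1 h2 h3 h4; field; rewrite h1 h2 h3 h4.
exact: alg Kw_neq0 (powRC_neq0 _ t_gt0) (Cexpi_neq0 _) (expfz_neq0 _ y0).
Qed.

Lemma fval_ratio th y : y != 0 ->
  fval A k t (pt y th) = Kt w * monomial (pt y th) w * laurent A term_exp (chart_coef th) y.
Proof.
move=> y0; rewrite /fval /laurent mulr_sumr; apply: eq_bigr => m _.
exact: term_ratio.
Qed.

Lemma chart_coef_w th y : chart_coef th w * y ^ term_exp w = 1.
Proof.
rewrite /chart_coef /base_coef /term_exp /term_phase subrr /cexp mul0mx mxE expr0z mulr1.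
have -> : pairing (0 : M) n0 = 0 by rewrite -(subrr w) pairingB subrr.
have -> : phase w m0 gamma 0 th = 0 by rewrite -(subrr w) phaseB subrr.
by rewrite powRr0 Cexpi0 divff// !mul1r.
Qed.

Local Notation b := (base_coef m0).

Lemma chart_coef_m0 th y : chart_coef th m0 * y ^ term_exp m0 = b * y.
Proof. by rewrite /chart_coef /term_exp /term_phase phase_edge// cexp_edge// mxE Cexpi0 mulr1 expr1z. Qed.

Hypothesis b_neq0 : b != 0.

Definition other_terms : {fset M} := (A `\ w `\ m0)%fset.

(** The coefficients of the remaining terms with respect to [s = b y]. *)
Definition scaled_base_coef (m : M) : C := base_coef m * b ^ (- term_exp m).
Definition scaled_coef (th : 'rV[R]_d) (m : M) : C := scaled_base_coef m * Cexpi (term_phase m th).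
Local Notation G th s := (1 + s + laurent other_terms term_exp (scaled_coef th) s).

Lemma chart_coef_scaled th m y : chart_coef th m * y ^ term_exp m = scaled_coef th m * (b * y) ^ term_exp m.
Proof.
rewrite /chart_coef /scaled_coef /scaled_base_coef (expfzMl b y) -invr_expz.
have alg (K P Y B : C) : B != 0 -> K * P * Y = K * B^-1 * P * (B * Y).
  by move=> B0; field.
exact: alg (expfz_neq0 _ b_neq0).
Qed.

Lemma laurent_scaled th y : laurent A term_exp (chart_coef th) y = G th (b * y).
Proof.
rewrite /laurent (big_fsetD1 w wA) /= chart_coef_w (big_fsetD1 m0) /=; last first.
  by rewrite in_fsetD1 eq_sym wm0.
rewrite chart_coef_m0 addrA; congr (_ + _); apply: eq_bigr => m _.
exact: chart_coef_scaled.
Qed.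

Lemma fval_eq0 th y : y != 0 ->
  (fval A k t (pt y th) = 0) <-> (G th (b * y) = 0).
Proof.
move=> y0; rewrite fval_ratio// laurent_scaled.
have mw0 : Kt w * monomial (pt y th) w != 0.
  rewrite mulf_neq0// /monomial; apply/prodf_neq0 => i _; rewrite expfz_neq0//.
  exact: torus_point_neq0.
by split=> [/eqP|->]; rewrite ?mulr0// mulf_eq0 (negPf mw0) => /eqP.
Qed.

Variable eta : R.
Hypothesis eta_lt : eta < root_threshold R other_terms term_exp.
Hypothesis a_small : small other_terms term_exp scaled_base_coef eta.
Hypothesis U_near : forall th y, y != 0 -> U (Logt t (pt y th)) ->
  G th (b * y) = 0 -> Cmod (b * y + 1) <= 2^-1.
Hypothesis U_contains : forall th y, y != 0 -> Cmod (b * y + 1) <= eta ->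
  U (Logt t (pt y th)).

Let eta16 : eta <= 16^-1.
Proof. exact: ltW (lt_le_trans eta_lt (root_threshold_le _ _ _)). Qed.

Lemma scaled_coef_small th : small other_terms term_exp (scaled_coef th) eta.
Proof. by rewrite /small; under eq_bigr do rewrite CmodM Cmod_Cexpi mulr1. Qed.

Let root_ex th : exists s, annulus s /\ G th s = 0.
Proof.
have [s h1 h2] := perturbation_root eta_lt (scaled_coef_small th).
by exists s; split=> //; exact: annulus_near.
Qed.

Definition sroot th : C := projT1 (cid (root_ex th)).
Definition yroot th : C := sroot th / b.

Let sroot_annulus th : annulus (sroot th).
Proof. by rewrite /sroot; case: cid => s []. Qed.
Let sroot_root th : G th (sroot th) = 0.
Proof. by rewrite /sroot; case: cid => s []. Qed.
Let sroot_near th : Cmod (sroot th + 1) <= eta.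
Proof. exact: perturbation_near (scaled_coef_small th) (sroot_annulus th) (sroot_root th). Qed.

Let eta1 : eta < 1.
Proof. by have := eta16; lra. Qed.

Let sroot_uniq th s : annulus s -> G th s = 0 -> s = sroot th.
Proof.
move=> h1 h2.
exact: perturbation_inj eta1 (scaled_coef_small th) h1 (sroot_annulus th) h2 (sroot_root th).
Qed.

Let byroot th : b * yroot th = sroot th.
Proof. by rewrite /yroot mulrC divfK. Qed.

Let yroot_neq0 th : yroot th != 0.
Proof. by rewrite mulf_neq0 ?invr_eq0// annulus_neq0// sroot_annulus. Qed.

Lemma yroot_branch : torus_branch A k w m0 gamma n0 U t yroot.
Proof.
move=> th; apply/seteqP; split=> y /=.
  move=> [y0 hU /(fval_eq0 th y0) hG].
  have h := annulus_near (U_near y0 hU hG).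
  by apply: (mulfI b_neq0); rewrite byroot; exact: sroot_uniq.
move=> ->; split; first exact: yroot_neq0.
  by apply: U_contains; rewrite ?yroot_neq0// byroot.
by apply/fval_eq0; rewrite ?yroot_neq0// byroot.
Qed.

Lemma yroot_derivable th (j : 'I_d) : exists L,
  Clim (fun h => (h^-1)%:C%C * (yroot (h *: delta_mx 0 j + th) - yroot th)) L.
Proof.
have phE m h : term_phase m (h *: delta_mx 0 j + th) = term_phase m (delta_mx 0 j) * h + term_phase m th.
  rewrite /term_phase /phase mulr_suml -big_split /=; apply: eq_bigr => i _.
  by rewrite !mxE; ring.
have eta2 : eta <= 2^-1 by have := eta16; lra.
pose s h := sroot (h *: delta_mx 0 j + th).
have hs h : 1 + s h + laurent other_terms term_exp
    (fun m => scaled_coef th m * Cexpi (term_phase m (delta_mx 0 j) * h)) (s h) = 0.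
  rewrite -[RHS](sroot_root (h *: delta_mx 0 j + th)); congr (_ + _).
  apply: eq_bigr => m _; rewrite /scaled_coef phE CexpiD; congr (_ * _).
  by rewrite -mulrA [Cexpi (term_phase m th) * _]mulrC.
have [L hL] := implicit_derivative eta2 (scaled_coef_small th) (fun h => sroot_annulus _) hs.
exists (L * b^-1); have := ClimM hL (Clim_cst b^-1); apply: eq_Clim => h _.
by rewrite /s scale0r add0r /yroot -mulrBl mulrA.
Qed.

(** The radius 1/4 in the coordinate [s = b y]. *)
Definition tube_rad : R := (4 * Cmod b)^-1.

Let tube_rad_gt0 : 0 < tube_rad.
Proof. by rewrite invr_gt0 mulr_gt0// Cmod_gt0. Qed.

Lemma yroot_radius : tube_radius A k w m0 gamma n0 t yroot tube_rad.
Proof.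
split=> // th y hy.
have dby : annulus (b * y).
  apply: annulus_near.
  have -> : b * y + 1 = (sroot th + 1) + b * (y - yroot th) by rewrite mulrBr byroot; ring.
  apply: le_trans (Cmod_add_le _ _) _.
  have : Cmod (b * (y - yroot th)) <= 4^-1.
    have b0 : 0 < Cmod b by rewrite Cmod_gt0.
    rewrite CmodM mulrC -ler_pdivlMr//; apply: le_trans hy _.
    by rewrite /tube_rad invfM.
  have := sroot_near th; have := eta16; lra.
have y0 : y != 0.
  by have := annulus_neq0 dby; rewrite mulf_eq0 negb_or => /andP[].
split=> // /(fval_eq0 th y0) hG; apply: (mulfI b_neq0).
by rewrite byroot; exact: sroot_uniq.
Qed.

(** By [tube_det], the form restricts to the tube as a form along the normal
    circles times the standard form in the angles. *)
Lemma tube_integralE (F : 'rV[C]_d.+1 -> C) r :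
  tube_radius A k w m0 gamma n0 t yroot r ->
  dlog_form_integral F (tube k w m0 gamma n0 t yroot r) =
  torus_integral (fun th => Ccircle_integral (fun phi =>
    let x := r%:C%C * Cexpi phi in
    F (pt (yroot th + x) th) * ('i%C ^+ d.+1 * (x / (yroot th + x))))).
Proof.
move=> [r0 hr]; rewrite /dlog_form_integral /=; congr torus_integral.
apply/funext => th; congr Ccircle_integral; apply/funext => phi.
rewrite (@tube_det _ _ _ _ _ det1 _ _ _ _ _ t_gt0 yroot_derivable); last first.
  move=> s; case: (hr (rsubmx s) (yroot (rsubmx s) + r%:C%C * Cexpi (s 0 0))) => //.
  by rewrite addrC addKr CmodM Cmod_Cexpi mulr1 ge0_CmodC// ltW.
have I0 : (0 : 'I_(1 + d)) = lshift d 0 by apply: val_inj.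
have E0 : (row_mx (const_mx phi : 'rV[R]_1) th) 0 0 = phi.
  by rewrite I0 row_mxEl mxE.
by rewrite /tube row_mxKr E0.
Qed.

Section Omega.
Variables (l : nat) (B : {fset M}) (p : M -> nat).
Hypothesis l_gt0 : (0 < l)%N.
Hypothesis p_sum : (\sum_(m <- B) p m)%N = l.

Lemma omega_ratio th y : y != 0 ->
  omega_coef A k l B p t (pt y th) =
  \prod_(m <- B) (chart_coef th m * y ^ term_exp m) ^+ p m / laurent A term_exp (chart_coef th) y ^+ l.
Proof.
move=> y0; rewrite /omega_coef fval_ratio//.
have mw0 : Kt w * monomial (pt y th) w != 0.
  rewrite mulf_neq0// /monomial; apply/prodf_neq0 => i _; rewrite expfz_neq0//.
  exact: torus_point_neq0.
have -> : \prod_(m <- B) (Kt m * monomial (pt y th) m) ^+ p m =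
   (Kt w * monomial (pt y th) w) ^+ l * \prod_(m <- B) (chart_coef th m * y ^ term_exp m) ^+ p m.
  rewrite -p_sum -prodrXr -big_split /=; apply: eq_bigr => m _.
  rewrite -exprMn; exact: (congr1 (fun z => z ^+ p m) (term_ratio m th y0)).
move: (Kt w * monomial (pt y th) w) mw0 => X X0.
by rewrite exprMn invfM mulrACA mulVf ?expf_neq0// mul1r mulrC.
Qed.

Definition inner_integral r th : C := Ccircle_integral (fun phi =>
    let x := r%:C%C * Cexpi phi in
    omega_coef A k l B p t (pt (yroot th + x) th) * ('i%C ^+ d.+1 * (x / (yroot th + x)))).

(** The equality holds angle by angle, hence passes to the iterated integral. *)
Lemma inner_indep r th : tube_radius A k w m0 gamma n0 t yroot r ->
  inner_integral r th = inner_integral tube_rad th.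
Proof.
pose c := 'i%C ^+ d.+1 * \prod_(m <- B) chart_coef th m ^+ p m.
pose E := \sum_(m <- B) term_exp m * (p m)%:Z.
have key r' : tube_radius A k w m0 gamma n0 t yroot r' ->
   inner_integral r' th = Ccircle_integral (fun phi => let x := r'%:C%C * Cexpi phi in
     c * (yroot th + x) ^ E / laurent A term_exp (chart_coef th) (yroot th + x) ^+ l * (x / (yroot th + x))).
  move=> [r0 hr]; congr Ccircle_integral; apply/funext => phi /=.
  set x := r'%:C%C * _.
  have y0 : yroot th + x != 0.
    case: (hr th (yroot th + x)) => //.
    by rewrite addrC addKr CmodM Cmod_Cexpi mulr1 ge0_CmodC// ltW.
  clearbody x; rewrite omega_ratio//.
  have -> : \prod_(m <- B) (chart_coef th m * (yroot th + x) ^ term_exp m) ^+ p m =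
     \prod_(m <- B) chart_coef th m ^+ p m * (yroot th + x) ^ E.
    rewrite /E -prod_expz// -big_split /=; apply: eq_bigr => m _.
    by rewrite exprMn -exprz_exp.
  by rewrite /c mulrCA -!mulrA.
move=> hr; rewrite (key _ hr) (key _ yroot_radius).
apply: residue_radius_indep => //.
- by rewrite laurent_scaled byroot.
- by case: hr.
- move=> y hy; have [y0 h] := hr.2 th y hy; split=> // hG; apply: h.
  by apply/fval_eq0 => //; rewrite -laurent_scaled.
- move=> y hy; have [y0 h] := yroot_radius.2 th y hy; split=> // hG; apply: h.
  by apply/fval_eq0 => //; rewrite -laurent_scaled.
Qed.

Lemma period_fixed (c : C) (e : R) :
  (forall th, Cmod (inner_integral tube_rad th - c) <= e) ->
  exists2 I, period A k w m0 gamma n0 U (omega_coef A k l B p t) t I &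
    Cmod (I - (two_pi_i R)^-1 * ((2 * pi)%:C%C ^+ d * c)) <=
    (2 * pi)^-1 * ((4 * pi) ^+ d * e).
Proof.
move=> hc.
exists ((two_pi_i R)^-1 * torus_integral (fun th => inner_integral tube_rad th)).
  exists yroot; split; first exact: yroot_branch.
  split; first by exists tube_rad; exact: yroot_radius.
  move=> r hr; rewrite (tube_integralE _ hr); congr (_ * torus_integral _).
  by apply/funext => th; rewrite -(inner_indep th hr).
rewrite -mulrBr CmodM CmodV.
have -> : Cmod (two_pi_i R) = 2 * pi.
  rewrite /Cmod /Normc.normc /two_pi_i expr0n /= add0r sqrtr_sqr ger0_norm//.
  by rewrite mulr_ge0// pi_ge0.
by rewrite ler_wpM2l ?invr_ge0 ?mulr_ge0 ?pi_ge0// torus_integral_near.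
Qed.

(** The inner circle in the coordinate [s = b y]; its starting point depends on
    the argument of [b]. *)
Definition scaled_rad : C := b * tube_rad%:C%C.

Lemma scaled_rad_norm : Cmod scaled_rad = 4^-1.
Proof.
have b0 : Cmod b != 0 by rewrite Cmod_eq0.
rewrite CmodM ge0_CmodC ?(ltW tube_rad_gt0)// /tube_rad; field.
exact: b0.
Qed.

Lemma innerE th (N : C -> C) :
  (forall s, s != 0 -> \prod_(m <- B) (chart_coef th m * (s / b) ^ term_exp m) ^+ p m = N s) ->
  inner_integral tube_rad th = Ccircle_integral (fun phi =>
    let s := sroot th + scaled_rad * Cexpi phi in
    'i%C ^+ d.+1 * (N s / G th s ^+ l * (scaled_rad * Cexpi phi / s))).
Proof.
move=> hN; congr Ccircle_integral; apply/funext => phi /=.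
set x := tube_rad%:C%C * Cexpi phi.
have hx : Cmod (yroot th + x - yroot th) <= tube_rad.
  by rewrite addrC addKr CmodM Cmod_Cexpi mulr1 ge0_CmodC// ltW.
have [y0 _] := yroot_radius.2 th _ hx.
have sE : sroot th + scaled_rad * Cexpi phi = b * (yroot th + x).
  by rewrite mulrDr byroot /scaled_rad mulrA.
have xE : scaled_rad * Cexpi phi = b * x by rewrite /scaled_rad /x mulrA.
have bq : b * x / (b * (yroot th + x)) = x / (yroot th + x).
  by rewrite -mulf_div divff// mul1r.
have bK : b * (yroot th + x) / b = yroot th + x by rewrite mulrC mulKf.
rewrite (omega_ratio th y0) laurent_scaled sE xE bq.
rewrite -(hN _ (mulf_neq0 b_neq0 y0)) bK; exact: mulrCA.
Qed.

Let kappa1 : Cmod ('i%C ^+ d.+1 : C) = 1.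
Proof.
by rewrite CmodX /Cmod /Normc.normc /= expr0n /= add0r expr1n sqrtr1 expr1n.
Qed.

Let chart_coef_div_m0 th s : chart_coef th m0 * (s / b) ^ term_exp m0 = s.
Proof. by rewrite chart_coef_m0 mulrC divfK. Qed.

Let eta_ge0 : 0 <= eta.
Proof.
apply: le_trans a_small; apply: sumr_ge0 => m _.
by rewrite mulr_ge0 ?Cmod_ge0// (le_trans ler01) ?annulus_cst_ge1.
Qed.

(** The term of [w] is 1 and that of [m0] is [s], so the numerator is [s^q]. *)
Lemma inner_edge th : (forall m, m \in B -> m = w \/ m = m0) ->
  let q := (\sum_(m <- B | m == m0) p m)%N in (q < l)%N ->
  Cmod (inner_integral tube_rad th + (2 * pi)%:C%C * 'i%C ^+ d.+1 * (q == 0%N)%:R) <=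
  leading_residue_cst R l * eta.
Proof.
move=> hB q ql; rewrite (@innerE th (fun s => s ^+ q)).
  exact: (leading_residue eta16 (scaled_coef_small th) (sroot_annulus th) (sroot_root th) scaled_rad_norm).
move=> s _; rewrite /q -prodrXr [RHS]big_mkcond /= big_seq [RHS]big_seq.
apply: eq_bigr => m /hB[->|->]; first by rewrite chart_coef_w expr1n (negPf wm0).
by rewrite eqxx chart_coef_div_m0.
Qed.

(** The factor of [m1] in the numerator is at most [eta], and every other base is
    at most 2. *)
Lemma inner_other th m1 : (forall m, m \in B -> m \in A) ->
  m1 \in B -> m1 != w -> m1 != m0 -> (0 < p m1)%N ->
  Cmod (inner_integral tube_rad th) <= 4 * pi * (2 ^+ l * eta * 8 ^+ l).
Proof.
move=> BA m1B m1w m1m0 pm1.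
pose N s : C := \prod_(m <- B) (chart_coef th m * (s / b) ^ term_exp m) ^+ p m.
have other_le m s : annulus s -> m \in other_terms ->
    Cmod (chart_coef th m * (s / b) ^ term_exp m) <= eta.
  move=> ds mr; rewrite chart_coef_scaled mulrC [b * _]mulrC divfK// mulrC.
  exact: laurent_term_le (scaled_coef_small th) ds mr.
have term_le m s : annulus s -> m \in B -> Cmod (chart_coef th m * (s / b) ^ term_exp m) <= 2.
  move=> ds mB; have [->|mw] := eqVneq m w.
    by rewrite chart_coef_w Cmod1 ler1n.
  have [->|mm0] := eqVneq m m0.
    by rewrite chart_coef_div_m0; case/andP: ds.
  apply: le_trans (_ : eta <= _); last by have := eta1; lra.
  by apply: other_le => //; rewrite !in_fsetD1 mm0 mw BA.
have N_le s : annulus s -> Cmod ('i%C ^+ d.+1 * N s) <= 2 ^+ l * eta.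
  move=> ds; rewrite CmodM kappa1 mul1r /N (big_fsetD1 m1)//= CmodM mulrC.
  apply: ler_pM; rewrite ?Cmod_ge0//.
    rewrite Cmod_prod; apply: le_trans (_ : \prod_(m <- (B `\ m1)%fset) 2 ^+ p m <= _).
      rewrite big_seq [leRHS]big_seq; apply: ler_prod => m.
      rewrite in_fsetD1 => /andP[_ mB]; rewrite Cmod_ge0 CmodX /=.
      by apply: lerXn2r; rewrite ?nnegrE ?Cmod_ge0 ?term_le.
    have lE : l = (p m1 + \sum_(m <- (B `\ m1)%fset) p m)%N.
      by rewrite -p_sum (big_fsetD1 m1).
    by rewrite prodrXr lE; apply: ler_weXn2l; rewrite ?ler1n ?leq_addl.
  rewrite CmodX -(prednK pm1) exprS.
  have h : Cmod (chart_coef th m1 * (s / b) ^ term_exp m1) <= eta.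
    by apply: other_le => //; rewrite !in_fsetD1 m1m0 m1w BA.
  rewrite -[leRHS]mulr1; apply: ler_pM; rewrite ?exprn_ge0 ?Cmod_ge0//.
  apply: exprn_ile1; first exact: Cmod_ge0.
  exact: le_trans h (ltW eta1).
rewrite (@innerE th N)//.
have := small_numerator_integral (N := fun s => 'i%C ^+ d.+1 * N s) eta16 (scaled_coef_small th) (sroot_annulus th) (sroot_root th) scaled_rad_norm
  l (fun phi => N_le _ (circle_annulus eta16 (scaled_coef_small th) (sroot_annulus th) (sroot_root th) scaled_rad_norm phi)).
congr (Cmod (Ccircle_integral _) <= _); apply/funext => phi /=.
by rewrite !mulrA.
Qed.

End Omega.
End FixedTime.

(** * The tropical regime *)
Section Regime.
Variables (R : realType) (d : nat).
Local Notation C := R[i].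
Local Notation M := 'rV[int]_d.+1.
Variables (A : {fset M}) (k : M -> puiseux R).

Lemma common_bounds (s : seq M) : (forall m, m \in s -> pnonzero (k m)) ->
  exists c1 c2 : R, [/\ 0 < c1, 0 < c2 & \forall t \near 0^'+, forall m, m \in s ->
    c1 * t `^ pval (k m) <= Cmod (peval (k m) t) <= c2 * t `^ pval (k m)].
Proof.
elim: s => [|m s IH] hs.
  by exists 1, 1; split=> //; apply: nearW => t m; rewrite in_nil.
have [|c1 [c2 [c10 c20 H]]] := IH; first by move=> m' h; apply: hs; rewrite inE h orbT.
have [a1 [a2 [a10 a20 H']]] := peval_bounds (hs m (mem_head _ _)).
exists (Num.min c1 a1), (Num.max c2 a2); split.
- by rewrite lt_min c10.
- by rewrite lt_max c20.
near=> t => m'; rewrite inE => /orP[/eqP->|m's].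
  have /andP[h1 h2] : a1 * t `^ pval (k m) <= Cmod (peval (k m) t) <= a2 * t `^ pval (k m).
    by near: t; exact: H'.
  apply/andP; split; [apply: le_trans h1|apply: le_trans h2 _];
    by rewrite ler_wpM2r ?powR_ge0// ?ge_min ?le_max lexx orbT.
have /andP[h1 h2] : c1 * t `^ pval (k m') <= Cmod (peval (k m') t) <= c2 * t `^ pval (k m').
  by move: (m') m's; near: t; exact: H.
apply/andP; split; [apply: le_trans h1|apply: le_trans h2 _];
  by rewrite ler_wpM2r ?powR_ge0// ?ge_min ?le_max lexx.
Unshelve. all: by end_near. Qed.

Lemma expz_between (x rho : R) (e : int) : 0 < rho -> rho^-1 <= x <= rho ->
  x ^ e <= rho ^+ `|e|.
Proof.
move=> r0 /andP[h1 h2]; have x0 : 0 < x by apply: lt_le_trans h1; rewrite invr_gt0.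
case: e => n; rewrite ?NegzE -?exprnN /=.
  by rewrite -exprnP lerXn2r ?nnegrE ?(ltW r0) ?(ltW x0).
rewrite -exprVn lerXn2r ?nnegrE ?invr_ge0 ?(ltW r0) ?(ltW x0)//.
by rewrite -[leRHS]invrK lef_pV2 ?posrE ?invr_gt0.
Qed.

Variables (w m0 : M) (gamma : 'M[int]_(d, d.+1)).
Variables (n0 : 'rV[R]_d.+1) (U : set 'rV[R]_d.+1) (delta : R).
Hypothesis det1 : \det (coord_mx w m0 gamma) = 1.
Hypothesis n0_edge : pval (k w) - pval (k m0) = pairing (m0 - w) n0.
Hypothesis wA : w \in A.
Hypothesis m0A : m0 \in A.
Hypothesis wm0 : w != m0.
Hypothesis delta_gt0 : 0 < delta.
Hypothesis n0U : U n0.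
Hypothesis U_small : forall m n, m \in A -> m != w -> m != m0 -> U n ->
  delta <= mu k m n - mu k m0 n.
Local Notation e := (term_exp w m0 gamma).
Local Notation rst := (other_terms A w m0).

(** For each of the other terms, [rho^|e|] comes from the factor [b^(-e)] of its
    scaled coefficient and one more [rho] from the ratio of Puiseux series; the
    summand 1 makes the constant positive. *)
Definition regime_cst (rho : R) : R :=
  \sum_(m <- rst) rho ^+ `|e m|.+1 * annulus_cst R (e m) + 1.

Section FixedT.
Variables (t c1 c2 : R).
Hypothesis t01 : 0 < t < 1.
Hypothesis c1_gt0 : 0 < c1.
Hypothesis c2_gt0 : 0 < c2.
Hypothesis K_bounds : forall m, m \in A ->
  c1 * t `^ pval (k m) <= Cmod (peval (k m) t) <= c2 * t `^ pval (k m).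
Local Notation Kt m := (peval (k m) t).
Local Notation rho := (c2 / c1 + 1).
Local Notation b := (base_coef k w n0 t m0).
Local Notation pt := (torus_point k w m0 gamma n0 t).
Local Notation eta := (regime_cst rho * t `^ delta).

Let t_gt0 : 0 < t. Proof. by case/andP: t01. Qed.

Let tpow (x y : R) : x <= y -> t `^ y <= t `^ x.
Proof. by apply: ger_powR; case/andP: t01 => -> /ltW. Qed.

Let rho_ge1 : 1 <= rho.
Proof. by rewrite lerDr divr_ge0// ltW. Qed.

Let rho_gt0 : 0 < rho. Proof. exact: lt_le_trans ltr01 rho_ge1. Qed.

Lemma K_neq0 m : m \in A -> Kt m != 0.
Proof.
move=> mA; rewrite -Cmod_gt0; case/andP: (K_bounds mA) => h _.
by apply: lt_le_trans h; rewrite mulr_gt0 ?powR_gt0.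
Qed.

Lemma K_ratio m m' : m \in A -> m' \in A ->
  Cmod (Kt m) <= rho * t `^ (pval (k m) - pval (k m')) * Cmod (Kt m').
Proof.
move=> mA m'A; case/andP: (K_bounds mA) => _ h1; case/andP: (K_bounds m'A) => h2 _.
apply: le_trans h1 _; rewrite powRD ?(gt_eqF t_gt0) ?implybT// powRN.
have T := powR_gt0 (pval (k m)) t_gt0; have T' := powR_gt0 (pval (k m')) t_gt0.
move: (t `^ pval (k m)) (t `^ pval (k m')) T T' h2 => u v u0 v0 h2.
apply: le_trans (_ : rho * (u / v) * (c1 * v) <= _).
  have -> : rho * (u / v) * (c1 * v) = (c2 + c1) * u by field; rewrite !gt_eqF.
  by rewrite ler_wpM2r ?(ltW u0)// lerDl ltW.
by rewrite ler_wpM2l// mulr_ge0 ?divr_ge0 ?(ltW u0) ?(ltW v0) ?(ltW rho_gt0).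
Qed.

Let muB m m' n : mu k m n - mu k m' n =
  (pval (k m) - pval (k m')) + pairing (m - m') n.
Proof. by rewrite /mu pairingB; ring. Qed.

Lemma base_coef_le m : m \in A -> Cmod (base_coef k w n0 t m) <= rho * t `^ (mu k m n0 - mu k w n0).
Proof.
move=> mA; rewrite /base_coef !CmodM CmodV ge0_CmodC ?powR_ge0// muB.
rewrite powRD ?(gt_eqF t_gt0) ?implybT// mulrA ler_wpM2r ?powR_ge0//.
by rewrite ler_pdivrMr ?Cmod_gt0 ?K_neq0// K_ratio.
Qed.

Let mu_edge : mu k m0 n0 = mu k w n0.
Proof.
apply/eqP; rewrite -subr_eq0 muB -n0_edge; apply/eqP; ring.
Qed.

Lemma b_le : Cmod b <= rho.
Proof. by have := base_coef_le m0A; rewrite mu_edge subrr powRr0 mulr1. Qed.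

Lemma b_neq0 : b != 0.
Proof.
by rewrite /base_coef !mulf_neq0 ?invr_eq0 ?K_neq0// powRC_neq0.
Qed.

Lemma b_ge : rho^-1 <= Cmod b.
Proof.
rewrite -[leRHS]invrK lef_pV2 ?posrE ?invr_gt0 ?Cmod_gt0 ?b_neq0//.
rewrite -CmodV /base_coef !invfM invrK !CmodM !CmodV ge0_CmodC ?powR_ge0//.
have := K_ratio wA m0A; rewrite n0_edge => h.
rewrite ler_pdivrMr ?powR_gt0// mulrC ler_pdivrMr ?Cmod_gt0 ?K_neq0//.
Qed.

Lemma regime_term_ge1 m : rho <= rho ^+ `|e m|.+1 * annulus_cst R (e m).
Proof.
rewrite -[leLHS]mulr1 ler_pM ?annulus_cst_ge1 ?(ltW rho_gt0)//.
by rewrite exprS ler_peMr ?(ltW rho_gt0)// exprn_ege1.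
Qed.

Lemma other_in m : m \in rst -> [/\ m \in A, m != w & m != m0].
Proof. by rewrite !in_fsetD1 => /andP[-> /andP[-> ->]]. Qed.

Lemma scaled_base_coef_small : small rst e (scaled_base_coef k w m0 gamma n0 t) eta.
Proof.
rewrite /small /regime_cst mulrDl mul1r ler_wpDr ?powR_ge0// mulr_suml.
rewrite big_seq [leRHS]big_seq; apply: ler_sum => m /other_in[mA mw mm0].
rewrite mulrAC ler_wpM2r ?(le_trans ler01) ?annulus_cst_ge1//.
rewrite /scaled_base_coef CmodM Cmodz exprS mulrAC; apply: ler_pM; rewrite ?Cmod_ge0//.
- by rewrite exprz_ge0 ?Cmod_ge0.
- apply: le_trans (base_coef_le mA) _; rewrite ler_wpM2l ?(ltW rho_gt0)//.
  by apply: tpow; rewrite -mu_edge U_small.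
- have := expz_between (- e m) rho_gt0 (_ : rho^-1 <= Cmod b <= rho).
  by rewrite abszN; apply; rewrite b_ge b_le.
Qed.

Hypothesis eta16 : eta <= 16^-1.

(** At a point of the hypersurface over [U], the condition on [U] compares the
    terms at that point itself: all of them but those of [w] and [m0] are at most
    [O(t^delta)] times the term of [m0]. *)
Lemma regime_near th y : y != 0 -> U (Logt t (pt y th)) ->
  1 + b * y + laurent rst e (scaled_coef k w m0 gamma n0 t th) (b * y) = 0 ->
  Cmod (b * y + 1) <= 2^-1.
Proof.
move=> y0 nU hG; set n := Logt t (pt y th) in nU.
have mon m : Cmod (monomial (pt y th) m) = t `^ pairing m n.
  by apply: Cmod_monomial_Logt => // i; exact: torus_point_neq0.
have Kw0 := K_neq0 wA.
have key m : m \in rst -> Cmod (chart_coef k w m0 gamma n0 t th m * y ^ e m) <=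
    rho * t `^ delta * Cmod (b * y).
  move=> /other_in[mA mw mm0].
  have W0 : 0 < Cmod (Kt w * monomial (pt y th) w).
    by rewrite CmodM mulr_gt0 ?Cmod_gt0// -Cmod_gt0 mon powR_gt0.
  rewrite -(ler_pM2l W0) -CmodM -(term_ratio det1 n0_edge t_gt0 Kw0 m th y0).
  rewrite mulrCA -(CmodM (Kt w * _)) -(chart_coef_m0 k n0 det1 t th y).
  rewrite -(term_ratio det1 n0_edge t_gt0 Kw0 m0 th y0).
  rewrite (CmodM (Kt m)) (CmodM (Kt m0)) !mon.
  have := K_ratio mA m0A => h; have hT := powR_ge0 t (pairing m n).
  apply: le_trans (ler_wpM2r hT h) _.
  rewrite -!mulrA ler_wpM2l ?(ltW rho_gt0)// mulrCA [leRHS]mulrCA ler_wpM2l ?Cmod_ge0//.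
  rewrite -!powRD ?(gt_eqF t_gt0) ?implybT//; apply: tpow.
  have := U_small mA mw mm0 nU; rewrite /mu; lra.
have tl : Cmod (laurent rst e (scaled_coef k w m0 gamma n0 t th) (b * y)) <= eta * Cmod (b * y).
  apply: le_trans (Cmod_sum_le _ _ _) _.
  rewrite /regime_cst mulrDl mulrDl mul1r ler_wpDr ?mulr_ge0 ?powR_ge0 ?Cmod_ge0//.
  rewrite !mulr_suml big_seq [leRHS]big_seq; apply: ler_sum => m mr.
  rewrite -(chart_coef_scaled gamma b_neq0); apply: le_trans (key m mr) _.
  by rewrite !ler_wpM2r ?powR_ge0 ?Cmod_ge0 ?regime_term_ge1.
have h1 : Cmod (b * y + 1) <= 16^-1 * Cmod (b * y).
  have -> : b * y + 1 = - laurent rst e (scaled_coef k w m0 gamma n0 t th) (b * y).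
    by apply/eqP; rewrite -addr_eq0 addrC -hG; apply/eqP; ring.
  by rewrite CmodN; apply: le_trans tl _; rewrite ler_wpM2r ?Cmod_ge0.
have h2 := Cmod_sub_le (b * y + 1) 1; rewrite addrK Cmod1 in h2.
by have := Cmod_ge0 (b * y + 1); lra.
Qed.

(** Bounded [|y|] moves the image under [Logt] by [O(1 / ln t)] only. *)
Lemma regime_contains th y (eps : R) : 0 < eps ->
  (forall c : R, `|c| < eps -> U (n0 + c *: \row_i (cexp w m0 gamma (delta_mx 0 i) 0 0)%:~R)) ->
  ln (2 * rho) < eps * - ln t ->
  y != 0 -> Cmod (b * y + 1) <= eta -> U (Logt t (pt y th)).
Proof.
move=> eps0 hU lnt y0 hy; rewrite Logt_torus//; apply: hU.
have /andP[s1 s2] : annulus (b * y).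
  by apply: annulus_near; apply: le_trans hy _; apply: le_trans eta16 _; lra.
have yp : 0 < Cmod y by rewrite Cmod_gt0.
have bp : 0 < Cmod b by rewrite Cmod_gt0 b_neq0.
have lt0 : 0 < - ln t by rewrite oppr_gt0 ln_lt0.
have r2 : 0 < 2 * rho by rewrite mulr_gt0.
have y2 : Cmod y <= 2 * rho.
  rewrite CmodM in s2; have := b_ge; rewrite -(ler_pM2r yp) => h.
  have := le_trans h s2; rewrite mulrC ler_pdivrMr// => //.
have y1 : (2 * rho)^-1 <= Cmod y.
  rewrite CmodM in s1; have := b_le; rewrite -(ler_pM2r yp) => h.
  have := le_trans s1 h; rewrite invfM -ler_pdivrMl// mulrC //.
have l2 : ln (Cmod y) <= ln (2 * rho) by rewrite ler_ln ?posrE.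
have l1 : - ln (2 * rho) <= ln (Cmod y) by rewrite -lnV ?posrE// ler_ln ?posrE ?invr_gt0.
rewrite normrM normfV -(normrN (ln t)) (gtr0_norm lt0) ltr_pdivrMr//.
by apply: le_lt_trans lnt; rewrite ler_norml l1 l2.
Qed.

End FixedT.

(** For small [t] the hypersurface is, near the cycle, a perturbation of size
    [t^delta] of [1 + b y = 0]. *)
Lemma regime (U_nbhs : nbhs n0 U) (k_neq0 : forall m, m \in A -> pnonzero (k m)) :
  exists C0 : R, \forall t \near 0^'+, [/\ 0 < t, peval (k w) t != 0,
    base_coef k w n0 t m0 != 0, C0 * t `^ delta < root_threshold R rst e &
    [/\ small rst e (scaled_base_coef k w m0 gamma n0 t) (C0 * t `^ delta),
     forall th y, y != 0 -> U (Logt t (torus_point k w m0 gamma n0 t y th)) ->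
       1 + base_coef k w n0 t m0 * y +
         laurent rst e (scaled_coef k w m0 gamma n0 t th) (base_coef k w n0 t m0 * y) = 0 ->
       Cmod (base_coef k w n0 t m0 * y + 1) <= 2^-1 &
     forall th y, y != 0 -> Cmod (base_coef k w n0 t m0 * y + 1) <= C0 * t `^ delta ->
       U (Logt t (torus_point k w m0 gamma n0 t y th))]].
Proof.
have [c1 [c2 [c10 c20 Hc]]] := common_bounds k_neq0.
exists (regime_cst (c2 / c1 + 1)); set C0 := regime_cst _.
have C00 : 0 < C0.
  rewrite /C0 /regime_cst ltr_wpDl// sumr_ge0// => m _.
  by rewrite mulr_ge0 ?exprn_ge0 ?addr_ge0 ?divr_ge0 ?(ltW c10) ?(ltW c20)// (le_trans ler01) ?annulus_cst_ge1.
set v : 'rV[R]_d.+1 := \row_i (cexp w m0 gamma (delta_mx 0 i) 0 0)%:~R.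
have [eps eps0 hU] : exists2 eps : R, 0 < eps & forall c : R, `|c| < eps -> U (n0 + c *: v).
  have cf : (fun c : R => n0 + c *: v) @ (0 : R) --> n0.
    rewrite -[X in _ --> X]addr0 -(scale0r v); apply: cvgD; first exact: cvg_cst.
    by apply: cvgZr_tmp; exact: cvg_id.
  have /nbhs_ballP[eps /= eps0 h] := cf _ U_nbhs.
  exists eps => // c hc; apply: h; rewrite /ball /= sub0r normrN //.
have lim := powR_cvg0 delta_gt0.
have q0 : 0 < root_threshold R rst e / C0 by rewrite divr_gt0// root_threshold_gt0.
near=> t.
have t0 : 0 < t by near: t; exact: nbhs_right_gt.
have t1 : t < 1 by near: t; apply: nbhs_right_lt.
have t01 : 0 < t < 1 by rewrite t0 t1.
have tl : t < expR (- (ln (2 * (c2 / c1 + 1)) / eps)).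
  by near: t; apply: nbhs_right_lt; exact: expR_gt0.
have KB : forall m, m \in A ->
    c1 * t `^ pval (k m) <= Cmod (peval (k m) t) <= c2 * t `^ pval (k m).
  by near: t; exact: Hc.
have he : C0 * t `^ delta < root_threshold R rst e.
  have : `|0 - t `^ delta| < root_threshold R rst e / C0.
    by near: t; have /cvgrPdist_lt := lim; apply.
  by rewrite sub0r normrN ger0_norm ?powR_ge0// ltr_pdivlMr// mulrC.
have e16 : C0 * t `^ delta <= 16^-1 by apply: ltW; apply: lt_le_trans he (root_threshold_le _ _ _).
have lnt : ln (2 * (c2 / c1 + 1)) < eps * - ln t.
  have : ln t < - (ln (2 * (c2 / c1 + 1)) / eps).
    by rewrite -[ltRHS]expRK ltr_ln ?posrE ?expR_gt0.
  by rewrite ltrNr ltr_pdivrMr// [eps * _]mulrC.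
split=> //.
- exact: (K_neq0 t01 c10 KB wA).
- exact: (b_neq0 t01 c10 KB).
split.
- exact: (scaled_base_coef_small t01 c10 c20 KB).
- exact: (regime_near t01 c10 c20 KB e16).
- by move=> th y; exact: (regime_contains t01 c10 c20 KB e16 th eps0 hU lnt).
Unshelve. all: by end_near. Qed.

End Regime.

(** * Combinatorics of the dual edge *)
Section Combinatorics.
Variables (R : realType) (d : nat).
Local Notation M := 'rV[int]_d.+1.

Lemma toR_inj : injective (@toR R d).
Proof.
move=> m m' /matrixP h; apply/rowP => i.
by have := h 0 i; rewrite !mxE => /intr_inj.
Qed.

Lemma conv_mem n (S : set 'rV[R]_n) x : S x -> Defs.conv S x.
Proof.
move=> Sx; exists 1%N, (fun=> x), (fun=> 1); split=> //.
- by rewrite big_ord1.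
- by rewrite big_ord1 scale1r.
Qed.

Lemma conv_sub_point n (S : set 'rV[R]_n) a x :
  (forall y, S y -> y = a) -> Defs.conv S x -> x = a.
Proof.
move=> Sa [r [q [c [Sq _ c1 ->]]]].
under eq_bigr do rewrite (Sa _ (Sq _)).
by rewrite -scaler_suml c1 scale1r.
Qed.

Lemma hull_vertex (V : {fset M}) m : m \in V -> hull R V (toR R m).
Proof. by move=> mV; apply: conv_mem; exists m. Qed.

Lemma hull_fset1 (u m : M) : hull R [fset u]%fset (toR R m) -> m = u.
Proof.
move=> h; apply: toR_inj; apply: conv_sub_point h => y [m' /=].
by rewrite inE => /eqP-> <-.
Qed.

(** The finite set attached to an infinite set is empty. *)
Lemma lattice_points_finite (P : set 'rV[R]_d.+1) m : m \in lattice_points P ->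
  finite_set [set m' : M | P (toR R m')].
Proof.
move=> mP; apply: contrapT => inf; move: mP.
by rewrite /lattice_points /fset_set; case: pselect => // ?; rewrite inE.
Qed.

Lemma mem_lattice_points (P : set 'rV[R]_d.+1) m :
  finite_set [set m' : M | P (toR R m')] ->
  (m \in lattice_points P) = `[< P (toR R m) >].
Proof. by move=> fin; rewrite /lattice_points in_fset_set// ; apply/idP/asboolP => [/set_mem|/mem_set]. Qed.

Lemma trop_le (A : {fset M}) (k : M -> puiseux R) m n : m \in A ->
  trop A k n <= mu k m n.
Proof.
move=> mA.
have lb : has_lbound [set mu k m' n | m' in [set` A]].
  exists (- \sum_(m' <- A) `|mu k m' n|) => _ [m' /= m'A <-].
  rewrite lerNl (big_fsetD1 m')//=; apply: le_trans (ler_norm _) _.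
  by rewrite normrN lerDl sumr_ge0.
by apply: (ge_inf lb); exists m.
Qed.

Lemma interior_dilate (D : set 'rV[R]_d.+1) l x : (0 < l)%N ->
  interior (dilate l D) (l%:R *: x) -> interior D x.
Proof.
move=> l0 h; have l1 : l%:R != 0 :> R by rewrite pnatr_eq0 -lt0n.
have c : (fun y : 'rV[R]_d.+1 => l%:R *: y) @ x --> l%:R *: x.
  exact: scaler_continuous.
have H : nbhs x ((fun y => l%:R *: y) @^-1` dilate l D) := c _ h.
rewrite /interior /=; apply: (filterS _ H) => y [z Dz zy].
by have -> : y = z by apply: (scalerI l1).
Qed.

(** If one end of the edge were not minimal on the cell, the dual cell would be
    contained in the other end. *)
Lemma dual_edge_minimal (A : {fset M}) (k : M -> puiseux R)
    (sigma : set 'rV[R]_d.+1) (w m0 : M) :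
  (forall m, m \in A -> (forall n, sigma n -> trop A k n = mu k m n) ->
     m = w \/ m = m0) ->
  w != m0 -> dual_cell A k sigma = hull R [fset w; m0]%fset ->
  (forall n, sigma n -> trop A k n = mu k w n) /\
  (forall n, sigma n -> trop A k n = mu k m0 n).
Proof.
move=> two wm0 dual.
have vertex u u' : u != u' -> (forall m, m \in A ->
    (forall n, sigma n -> trop A k n = mu k m n) -> m = u \/ m = u') ->
    dual_cell A k sigma (toR R u) -> forall n, sigma n -> trop A k n = mu k u n.
  move=> uu' two' hu; apply: contrapT => no.
  have /toR_inj E : toR R u = toR R u'.
    apply: conv_sub_point hu => y [m [mA hm] <-].
    by case: (two' m mA hm) => [mE|->//]; case: no; rewrite -mE.
  by move: uu'; rewrite E eqxx.
split; [apply: (vertex w m0)|apply: (vertex m0 w)] => //.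
- by rewrite dual; apply: hull_vertex; rewrite !inE eqxx.
- by rewrite eq_sym.
- by move=> m mA hm; case: (two m mA hm); [right|left].
- by rewrite dual; apply: hull_vertex; rewrite !inE eqxx orbT.
Qed.

Lemma leading_value : (two_pi_i R)^-1 *
  ((2 * pi)%:C%C ^+ d * - ((2 * pi)%:C%C * 'i%C ^+ d.+1)) = - two_pi_i R ^+ d.
Proof.
have -> : two_pi_i R = 'i%C * (2 * pi)%:C%C.
  apply/eqP; rewrite eq_complex /=; apply/andP; split; apply/eqP; ring.
have p0 : (2 * pi)%:C%C != 0 :> R[i].
  by rewrite -Cmod_eq0 ge0_CmodC ?mulr_ge0 ?pi_ge0// mulf_neq0 ?gt_eqF ?pi_gt0.
have i0 : 'i%C != 0 :> R[i].
  by rewrite -Cmod_eq0 /Cmod /Normc.normc /= expr0n /= add0r expr1n sqrtr1 oner_eq0.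
rewrite exprMn exprS; move: ('i%C ^+ d) ((2 * pi)%:C%C ^+ d) => x y.
move: 'i%C i0 (2 * pi)%:C%C p0 => j j0 z z0.
by field; rewrite j0 z0.
Qed.

Lemma mu_eq_edge (k : M -> puiseux R) (m m' : M) n : mu k m n = mu k m' n ->
  pval (k m) - pval (k m') = pairing (m' - m) n.
Proof. by rewrite pairingB /mu; lra. Qed.

End Combinatorics.

Theorem theorem1p3 (R : realType) (d : nat) (d_ge1 : (0 < d)%N)
  (Delta : set 'rV[R]_d.+1)
  (Delta_lattice : lattice_polytope Delta)
  (Delta_dim : affine_dim Delta d.+1)
  (A : {fset 'rV[int]_d.+1}) (A_def : A = lattice_points Delta)
  (W : set 'rV[int]_d.+1)
  (W_def : W = [set m | interior Delta (toR R m)])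
  (W_neq0 : W !=set0)
  (k : 'rV[int]_d.+1 -> puiseux R)
  (k_neq0 : forall m, m \in A -> pnonzero (k m))
  (T : set {fset 'rV[int]_d.+1})
  (T_tri : triangulation Delta T)
  (T_unimod : unimodular R T)
  (T_convex : exists h : 'rV[R]_d.+1 -> R,
     strictly_convex_pa Delta T h /\
     forall m, m \in A -> h (toR R m) = pval (k m))
  (sigma : set 'rV[R]_d.+1)
  (sigma_cell : trop_cell A k sigma)
  (sigma_dim : affine_dim sigma d)
  (sigma_trop : sigma `<=` trop_hypersurface A k)
  (w m0 : 'rV[int]_d.+1)
  (w_in : W w) (m0_in : m0 \in A) (w_neq_m0 : w != m0)
  (edge_in : T [fset w; m0]%fset)
  (edge_dual : dual_cell A k sigma = hull R [fset w; m0]%fset)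
  (l : nat) (l_ge1 : (0 < l)%N)
  (v : 'rV[int]_d.+1)
  (v_in : interior (dilate l Delta) (toR R v))
  (tau : {fset 'rV[int]_d.+1}) (tau_min : minimal_cell R T l v tau)
  (p : 'rV[int]_d.+1 -> nat)
  (p_bnd : forall m, m \in lattice_points (hull R tau) -> (0 < p m <= l)%N)
  (p_sum : (\sum_(m <- lattice_points (hull R tau)) p m)%N = l)
  (p_bary : \sum_(m <- lattice_points (hull R tau)) m *+ p m = v)
  (orient : forall u, tau = [fset u]%fset -> W u ->
     u \in [fset w; m0]%fset -> w = u)
  (gamma : 'M[int]_(d, d.+1))
  (gamma_coord : \det (coord_mx w m0 gamma) = 1)
  (n0 : 'rV[R]_d.+1) (n0_in : relint sigma n0)
  (U : set 'rV[R]_d.+1) (U_nbhs : nbhs n0 U)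
  (delta : R) (delta_gt0 : 0 < delta)
  (U_small : forall m n, m \in A -> m != w -> m != m0 -> U n ->
     delta <= mu k m n - mu k m0 n) :
  exists eps C : R, 0 < eps /\
    \forall t \near 0^'+, exists2 I : R[i],
      period A k w m0 gamma n0 U
        (omega_coef A k l (lattice_points (hull R tau)) p t) t I &
      ((exists u, [/\ tau = [fset u]%fset, W u &
                   forall n, sigma n -> trop A k n = mu k u n]) ->
         Cmod (I - - (two_pi_i R) ^+ d) <= C * t `^ eps) /\
      (~ (exists u, [/\ tau = [fset u]%fset, W u &
                     forall n, sigma n -> trop A k n = mu k u n]) ->
         Cmod I <= C * t `^ eps).
Proof.
pose B := lattice_points (hull R tau).
(* [Delta] has finitely many lattice points, since [m0] is listed in [A]. *)
have finA : finite_set [set m | Delta (toR R m)].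
  by apply: (@lattice_points_finite _ _ _ m0); rewrite -A_def.
have inA m : (m \in A) = `[< Delta (toR R m) >] by rewrite A_def mem_lattice_points.
have wA : w \in A.
  by rewrite inA; apply/asboolP; move: w_in; rewrite W_def; exact: interior_subset.
have [Ttau _ _] := tau_min.
have tau_neq0 := (tri_simplex T_tri Ttau).1.
have tau_sub x : hull R tau x -> Delta x.
  by move=> hx; rewrite -(tri_cover T_tri); exists tau.
have finB : finite_set [set m | hull R tau (toR R m)].
  by apply: sub_finite_set finA => m /=; exact: tau_sub.
have inB m : (m \in B) = `[< hull R tau (toR R m) >] by exact: mem_lattice_points.
have BA m : m \in B -> m \in A by rewrite inB inA => /asboolP/tau_sub/asboolP.
have tauB m : m \in tau -> m \in B.
  by move=> mt; rewrite inB; apply/asboolP; exact: hull_vertex.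
have n0U : U n0 := nbhs_singleton U_nbhs.
have sn0 : sigma n0 := n0_in.1.
have two m : m \in A -> trop A k n0 = mu k m n0 -> m = w \/ m = m0.
  move=> mA hm; have [->|mw] := eqVneq m w; first by left.
  have [->|mm0] := eqVneq m m0; first by right.
  have := U_small m n0 mA mw mm0 n0U; have := trop_le k n0 m0_in; rewrite hm.
  rewrite -subr_le0 => h1 h2; have := lt_le_trans delta_gt0 (le_trans h2 h1).
  by rewrite ltxx.
have [minw minm0] := dual_edge_minimal (fun m mA hm => two m mA (hm _ sn0)) w_neq_m0 edge_dual.
have n0_edge : pval (k w) - pval (k m0) = pairing (m0 - w) n0.
  by apply: mu_eq_edge; rewrite -minw// -minm0.
have p_gt0 m : m \in B -> (0 < p m)%N by move/p_bnd => /andP[].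
have tau1 u : (forall m, m \in B -> m = u) -> tau = [fset u]%fset.
  move=> hB; have /fset0Pn[m mt] := tau_neq0.
  apply/fsetP => m'; rewrite inE; apply/idP/eqP => [/tauB/hB//|->].
  by rewrite -(hB m (tauB _ mt)).
pose P := exists u, [/\ tau = [fset u]%fset, W u &
  forall n, sigma n -> trop A k n = mu k u n].
have BofP : P -> forall m, m \in B -> m = w.
  move=> [u [tu Wu hu]] m mB.
  have uA : u \in A by apply/BA/tauB; rewrite tu inE.
  have uE : w = u.
    apply: (orient u tu Wu); rewrite !inE.
    by case: (two u uA (hu _ sn0)) => ->; rewrite eqxx ?orbT.
  by move: mB; rewrite inB tu uE => /asboolP/hull_fset1.
(* The exponent of [m0] decides between the two cases of the conclusion. *)
pose q := (\sum_(m <- B | m == m0) p m)%N.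
have l_split : l = (q + \sum_(m <- B | m != m0) p m)%N.
  by rewrite -[LHS]p_sum -/B (bigID (fun m => m == m0)).
have q_lt m : m \in B -> m != m0 -> (q < l)%N.
  move=> mB mm0; rewrite l_split -[ltnLHS]addn0 ltn_add2l.
  by rewrite (big_rem m)//= mm0 addn_gt0 p_gt0.
have q_gt0 : m0 \in B -> (0 < q)%N.
  by move=> mB; rewrite /q (big_rem m0)//= eqxx addn_gt0 p_gt0.
have [C0 HC] := regime gamma_coord n0_edge wA m0_in delta_gt0 n0U U_small U_nbhs k_neq0.
have K1 : 0 <= leading_residue_cst R l.
  by rewrite /leading_residue_cst addr_ge0 ?mulr_ge0 ?exprn_ge0 ?pi_ge0.
have K2 : 0 <= 4 * pi * (2 ^+ l * 8 ^+ l) :> R.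
  by rewrite !mulr_ge0 ?exprn_ge0 ?pi_ge0.
pose Kl := leading_residue_cst R l + 4 * pi * (2 ^+ l * 8 ^+ l).
exists delta, ((2 * pi)^-1 * ((4 * pi) ^+ d * (Kl * C0))); split=> //.
apply: filterS HC => t [t0 Kw0 b0 he [sm hnear hcont]].
have eta_ge0 : 0 <= C0 * t `^ delta.
  apply: le_trans sm; apply: sumr_ge0 => m _.
  by rewrite mulr_ge0 ?Cmod_ge0// (le_trans ler01) ?annulus_cst_ge1.
have le1 x : x <= leading_residue_cst R l * (C0 * t `^ delta) -> x <= Kl * (C0 * t `^ delta).
  by move=> h; apply: le_trans h _; rewrite ler_wpM2r// lerDl.
have scale (x : R) : (2 * pi)^-1 * ((4 * pi) ^+ d * (Kl * (C0 * x))) =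
    (2 * pi)^-1 * ((4 * pi) ^+ d * (Kl * C0)) * x by rewrite !mulrA.
have edge th := inner_edge gamma_coord n0_edge wA m0_in w_neq_m0 t0 Kw0 b0 he sm p_sum th.
have [PP|nP] := pselect P.
- have hB m : m \in B -> m = w \/ m = m0 by move/(BofP PP); left.
  have q0 : q = 0%N.
    by rewrite /q big_seq_cond big1// => m /andP[/(BofP PP)->]; rewrite (negPf w_neq_m0).
  have l_gt : (q < l)%N by rewrite q0.
  have bound th : Cmod (inner_integral he sm l B p (tube_rad k w m0 n0 t) th -
      - ((2 * pi)%:C%C * 'i%C ^+ d.+1)) <= Kl * (C0 * t `^ delta).
    have := edge th hB l_gt; rewrite -/B -/q q0 eqxx mulr1 opprK => /le1.
    exact.
  have [I hI hb] := period_fixed gamma_coord n0_edge wA m0_in w_neq_m0 t0 Kw0 b0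
    hnear hcont l_ge1 p_sum bound.
  exists I => //; split=> [_|/(_ PP)//].
  by move: hb; rewrite leading_value scale.
- have bound th : Cmod (inner_integral he sm l B p (tube_rad k w m0 n0 t) th - 0) <=
      Kl * (C0 * t `^ delta).
    rewrite subr0.
    have [[m1 [m1B m1w m1m0]]|none] :=
        pselect (exists m1, [/\ m1 \in B, m1 != w & m1 != m0]).
      have := inner_other gamma_coord n0_edge wA m0_in w_neq_m0 t0 Kw0 b0 he sm p_sum th
        BA m1B m1w m1m0 (p_gt0 _ m1B).
      move=> h; apply: le_trans h _; rewrite [_ * 8 ^+ l]mulrAC [leLHS]mulrA.
      by rewrite ler_wpM2r// lerDr.
    have hB m : m \in B -> m = w \/ m = m0.
      move=> mB; have [->|mw] := eqVneq m w; first by left.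
      by have [->|mm0] := eqVneq m m0; [right|case: none; exists m].
    have ql : (q < l)%N.
      have [[m [mB mm0]]|allm0] := pselect (exists m, m \in B /\ m != m0).
        exact: q_lt mB mm0.
      (* Then [v = l m0] is an interior point, so [m0] lies in [W]: excluded by
         the choice of [w]. *)
      have hm0 m : m \in B -> m = m0.
        by move=> mB; case: (eqVneq m m0) => // mm0; case: allm0; exists m.
      have tm0 := tau1 m0 hm0; exfalso.
      have vE : toR R v = l%:R *: toR R m0.
        rewrite -p_bary -p_sum -/B; apply/rowP => i.
        rewrite !mxE summxE rmorph_sum natr_sum mulr_suml /= big_seq [RHS]big_seq.
        apply: eq_bigr => m /hm0->; rewrite mulmxnE rmorphMn /=.
        by rewrite mulr_natl.
      have Wm0 : W m0 by rewrite W_def /=; move: v_in; rewrite vE; exact: interior_dilate.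
      have := orient m0 tm0 Wm0; rewrite !inE eqxx orbT => /(_ isT) E.
      by move: w_neq_m0; rewrite E eqxx.
    have q1 : q != 0%N.
      rewrite -lt0n; have [m0B|m0B] := boolP (m0 \in B); first exact: q_gt0.
      exfalso; apply: nP; exists w; split=> //; apply: tau1 => m mB.
      by case: (hB m mB) => // E; move: m0B; rewrite -E mB.
    by have := edge th hB ql; rewrite -/B -/q (negPf q1) mulr0 addr0 => /le1.
  have [I hI hb] := period_fixed gamma_coord n0_edge wA m0_in w_neq_m0 t0 Kw0 b0
    hnear hcont l_ge1 p_sum bound.
  exists I => //; split=> [/nP//|_].
  by move: hb; rewrite !mulr0 subr0 scale.
Qed.
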